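(* Let $d$ be a distance on $\mathcal I$. Suppose that there exists a sector-germ $\mathfrak s$ of $\mathcal I$ such that every apartment containing $\mathfrak s$ is closed and has empty interior in $(\mathcal I,d)$. Then $(\mathcal I,d)$ is incomplete and the interior of every compact subset of $\mathcal I$ is empty.
   Context: **Vectorial data.** $I$ is a finite set and $C=(c_{i,j})_{i,j\in I}$ is a Kac--Moody matrix: $c_{i,j}\in\mathbb Z$, $c_{i,i}=2$, $c_{i,j}\le 0$ for $i\neq j$, and $c_{i,j}=0\iff c_{j,i}=0$. $X,Y$ are dual free $\mathbb Z$-modules of finite rank with $\mathbb Z$-linearly independent families $(\alpha_i)_{i\in I}$ in $X$ and $(\alpha_i^\vee)_{i\in I}$ in $Y$ such that $\alpha_j(\alpha_i^\vee)=c_{i,j}$. $\mathbb A=Y\otimes\mathbb R$, with its usual topology; elements of $X$ are linear forms on $\mathbb A$. $r_i(v)=v-\alpha_i(v)\alpha_i^\vee$, and $W^v=\langle r_i\mid i\in I\rangle\subset \mathrm{GL}(\mathbb A)$ (Weyl group), acting on $\mathbb A^*$ by $(w.\alpha)(x)=\alpha(w^{-1}x)$. $\Phi=\{w.\alpha_i\}$ is the set of real roots; for $\alpha=w.\alpha_i\in\Phi$, $\alpha^\vee=w.\alpha_i^\vee$. $Q^\vee=\bigoplus_i\mathbb Z\alpha_i^\vee$ and $W^a=Q^\vee\rtimes W^v$. $\Delta\subset\bigoplus_i\mathbb Z\alpha_i\subset\mathbb A^*$ is the set of all (real and imaginary) roots of the Kac--Moody algebra of $C$. For $\alpha\in\mathbb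 A^*$, $k\in\mathbb R$: $D(\alpha,k)=\{\alpha(x)+k\ge0\}$, $D^\circ(\alpha,k)=\{\alpha(x)+k>0\}$, $M(\alpha,k)=\{\alpha(x)+k=0\}$, and $D(\alpha,+\infty)=D^\circ(\alpha,+\infty)=\mathbb A$. Walls (resp. half-apartments) are the $M(\alpha,k)$ (resp. $D(\alpha,k)$), $\alpha\in\Phi$, $k\in\mathbb Z$. $C^v_f=\{v\mid\alpha_i(v)>0\ \forall i\}$; for $J\subset I$, $F^v(J)=\{v\mid \alpha_i(v)=0\ (i\in J),\ \alpha_i(v)>0\ (i\notin J)\}$. Positive (resp. negative) vectorial faces are the $w.F^v(J)$ (resp. $-w.F^v(J)$), $w\in W^v$; vectorial chambers are the $\pm w.C^v_f$. Tits cone: $\mathcal T=\bigcup_{w}w.\overline{C^v_f}$. A vectorial face is spherical if it meets $\pm\mathring{\mathcal T}$. $x\le y$ means $y-x\in\mathcal T$. A ray or segment through $x\ne y$ from $x$ is preordered if $x\le y$ or $y\le x$, generic if $y-x\in\pm\mathring{\mathcal T}$. **Filters.** A filter lies in a set $Z$ if $Z$ is an element of it; a set (e.g. an apartment) contains a filter if it contains an element of it; a map fixes a filter if it fixes pointwise some element of it. The support of a filter is the smallest affine subspace containing it. $\mathcal F\Cup\mathcal F'=\{E\cup E'\mid E\in\mathcal F,E'\in\mathcal F'\}$. The enclosure $\mathrm{cl}(\mathcal F)$ of a filter on $\mathbb A$ is the filter of sets $E$ containing some $\bigcap_{\alpha\in\Delta}D(\alpha,k_\alpha)\in\mathcal F$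 with $k_\alpha\in\mathbb Z\cup\{+\infty\}$ (a set is treated as its principal filter). A sector-face is $f=x+F^v$ ($F^v$ a vectorial face); its germ at infinity is the filter of sets containing $x+u+F^v$ for some $u\in\overline{F^v}$. If $F^v$ is a vectorial chamber, $f$ is a sector and its germ is a sector-germ, with the sign of $F^v$. The face $F(x,F^v)$ is the filter of sets $E$ for which there are $k_\alpha,k'_\alpha\in\mathbb Z\cup\{+\infty\}$ $(\alpha\in\Delta)$ and a neighbourhood $\Omega$ of $x$ with $E\supset\bigcap_{\alpha}(D(\alpha,k_\alpha)\cap D^\circ(\alpha,k'_\alpha))\supset\Omega\cap(x+F^v)$. A chamber (resp. panel) is a face with support $\mathbb A$ (resp. a wall). A chimney is $\mathfrak r(F,F^v)=\mathrm{cl}(F+F^v)$, $F$ a face, $F^v$ a vectorial face; it is splayed if $F^v$ is spherical, solid if the pointwise stabilizer in $W^v$ of the direction of its support is finite. Its germ is the filter of sets belonging to some $\mathfrak r(F+u,F^v)$, $u\in\overline{F^v}$. **Apartments.** $\mathrm{Aut}(\mathbb A)$ is the group of affine bijections of $\mathbb A$ stabilizing $\{(M(\alpha,k),\alpha^\vee)\mid\alpha\in\Phi,k\in\mathbb Z\}$. An apartment of type $\mathbb A$ is a set $A$ with a nonempty set $\mathrm{Isom}^w(\mathbb A,A)$ of bijections $\mathbb A\to A$ forming one orbit $f_0\circ W^a$. A bijection $\phi:A\to A'$ is a Weyl isomorphism (resp. an isomorphism, which here always means vectorially Weyl isomorphism) if $f'^{-1}\circ\phi\circ f\in W^a$ (resp.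 $\in(W^v\ltimes\mathbb A)\cap\mathrm{Aut}(\mathbb A)$) for $f\in\mathrm{Isom}^w(\mathbb A,A)$, $f'\in\mathrm{Isom}^w(\mathbb A,A')$. All above notions, the affine structure and the affine topology are transported to every apartment. **Masure.** A masure of type $\mathbb A$ is a set $\mathcal I$ covered by a family of subsets called apartments such that: (MA1) each apartment has a structure of apartment of type $\mathbb A$. (MA2) If $F$ is a point, a germ of a preordered interval, a generic ray or a solid chimney in an apartment $A$, and $A'$ is another apartment containing $F$, then $A\cap A'$ contains $\mathrm{cl}_A(F)$ and there is a Weyl isomorphism $A\to A'$ fixing $\mathrm{cl}_A(F)$. (MA3) If $\mathfrak R$ is the germ of a splayed chimney and $F$ is a face or a germ of a solid chimney, some apartment contains $\mathfrak R$ and $F$. (MA4) If apartments $A,A'$ contain $\mathfrak R$ and $F$ as in (MA3), there is a Weyl isomorphism $A\to A'$ fixing $\mathrm{cl}_A(\mathfrak R\Cup F)$. (MAO) If $x,y\in A\cap A'$ and $x\le_A y$ then $[x,y]_A=[x,y]_{A'}$. Standing assumptions: $\mathcal I$ is such a masure; each panel lies in the closure of finitely many, and more than $2$, chambers; a group $G$ acts strongly transitively on $\mathcal I$ (it permutes apartments, each $g:A\to g.A$ is an isomorphism of apartments, and all isomorphisms in the axioms are induced by elements of $G$); $\mathbb A$ is identified with a fixed apartment of $\mathcal I$, and the stabilizer of $\mathbb A$ in $G$ induces on $\mathbb A$ the group $W^v\ltimes Y$. Sector-germs of $\mathcal I$ are sector-germs of its apartments (a sector-germ contained in an apartment $B$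 is a sector-germ of $B$, of the same sign). *)

(* Defs.v *)
From HB Require Import structures.
From mathcomp Require Import all_boot all_order all_algebra.
From mathcomp Require Import all_classical all_reals all_analysis.
From mathcomp Require Import complex.
Set Implicit Arguments.
Unset Strict Implicit.
Unset Printing Implicit Defensive.
Import Order.TTheory GRing.Theory Num.Theory.
Import numFieldNormedType.Exports.
Local Open Scope classical_set_scope.
Local Open Scope ring_scope.

Definition pairing (K : pzRingType) (n : nat) (a : 'rV[K]_n) (x : 'cV[K]_n) : K :=
  (a *m x) ord0 ord0.

(* A basis of Y is chosen, together with the dual basis of X: elements of Y are
   columns, elements of X are rows, and the duality is the matrix product. *)
Record vectorial_datum := VectorialDatum {
  km_index : finType;
  km_matrix : km_index -> km_index -> int;
  km_diag : forall i, km_matrix i i = 2;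
  km_offdiag : forall i j, i != j -> km_matrix i j <= 0;
  km_zero : forall i j, km_matrix i j = 0 <-> km_matrix j i = 0;
  yrank : nat;
  sroot : km_index -> 'rV[int]_yrank;
  scoroot : km_index -> 'cV[int]_yrank;
  sroot_free : forall z : km_index -> int,
    \sum_i z i *: sroot i = 0 -> forall i, z i = 0;
  scoroot_free : forall z : km_index -> int,
    \sum_i z i *: scoroot i = 0 -> forall i, z i = 0;
  sroot_scoroot : forall i j, pairing (sroot j) (scoroot i) = km_matrix i j
}.

Section KacMoodyAlgebra.
Variables (R : realType) (V : vectorial_datum).

(* The Kac-Moody algebra of the Kac-Moody matrix, with Cartan subalgebra
   Y (x) C, over the complex numbers: it is generated by the Cartan subalgebra
   and the Chevalley generators, subject to the usual relations, and no nonzero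
   ideal meets the Cartan subalgebra trivially (V. Kac, Infinite dimensional Lie
   algebras, Prop. 1.4: this determines it up to isomorphism). *)
Record kac_moody_algebra (L : lmodType R[i]) := KacMoodyAlgebra {
  bracket : L -> L -> L;
  bracket_linearl : forall y, linear (bracket ^~ y);
  bracket_linearr : forall x, linear (bracket x);
  bracket_alt : forall x, bracket x x = 0;
  bracket_jacobi : forall x y z,
    bracket x (bracket y z) + bracket y (bracket z x) + bracket z (bracket x y) = 0;
  cartan : {linear 'cV[R[i]]_(yrank V) -> L};
  cartan_inj : injective cartan;
  chev_e : km_index V -> L;
  chev_f : km_index V -> L;
  bracket_hh : forall h h', bracket (cartan h) (cartan h') = 0;
  bracket_he : forall h i, bracket (cartan h) (chev_e i) =
    pairing (map_mx intr (sroot i)) h *: chev_e i;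
  bracket_hf : forall h i, bracket (cartan h) (chev_f i) =
    - pairing (map_mx intr (sroot i)) h *: chev_f i;
  bracket_ef : forall i j, bracket (chev_e i) (chev_f j) =
    if i == j then cartan (map_mx intr (scoroot i)) else 0;
  km_generated : forall S : set L,
    (forall h, S (cartan h)) -> (forall i, S (chev_e i)) -> (forall i, S (chev_f i)) ->
    (forall (c : R[i]) x y, S x -> S y -> S (c *: x + y)) ->
    (forall x y, S x -> S y -> S (bracket x y)) ->
    forall x, S x;
  km_no_ideal : forall J : set L,
    J 0 ->
    (forall (c : R[i]) x y, J x -> J y -> J (c *: x + y)) ->
    (forall x y, J y -> J (bracket x y)) ->
    (forall h, J (cartan h) -> cartan h = 0) ->
    forall x, J x -> x = 0
}.

Variables (L : lmodType R[i]) (g : kac_moody_algebra L).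

Definition root_space (a : 'rV[int]_(yrank V)) : set L :=
  [set x | forall h, bracket g (cartan g h) x = pairing (map_mx intr a) h *: x].

(* The roots, real and imaginary, seen as linear forms on Y (x) R. *)
Definition all_roots : set 'rV[R]_(yrank V) :=
  [set a | exists z : km_index V -> int,
     let b := \sum_i z i *: sroot i in
     [/\ b != 0, (exists2 x, root_space b x & x != 0) & a = map_mx intr b]].

End KacMoodyAlgebra.

Section ModelApartment.
Variables (R : realType) (V : vectorial_datum).
Local Notation n := (yrank V).
Local Notation AA := 'cV[R]_n.
Local Notation form := 'rV[R]_n.

Definition rsroot (i : km_index V) : form := map_mx intr (sroot i).
Definition rscoroot (i : km_index V) : AA := map_mx intr (scoroot i).

(* As a matrix acting on columns: v |-> v - alpha_i(v) alpha_i^vee. *)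
Definition srefl (i : km_index V) : 'M[R]_n := 1%:M - rscoroot i *m rsroot i.

Inductive weyl : set 'M[R]_n :=
| weyl_1 : weyl 1%:M
| weyl_srefl i : weyl (srefl i)
| weyl_mul u v : weyl u -> weyl v -> weyl (u *m v)
| weyl_inv u : weyl u -> weyl (invmx u).

(* The pairs (alpha, alpha^vee), alpha a real root; w acts on a linear form alpha
   by alpha *m w^-1. *)
Definition real_root_coroot : set (form * AA) :=
  [set p | exists w i, weyl w /\ p = (rsroot i *m invmx w, w *m rscoroot i)].

Definition real_root : set form := [set a | exists av, real_root_coroot (a, av)].

Definition affmap (w : 'M[R]_n) (b : AA) : AA -> AA := fun x => w *m x + b.

Definition coroot_lattice : set AA :=
  [set q | exists z : km_index V -> int, q = map_mx intr (\sum_i z i *: scoroot i)].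

Definition Y_lattice : set AA := [set q | exists y : 'cV[int]_n, q = map_mx intr y].

Definition affine_weyl : set (AA -> AA) :=
  [set u | exists w q, [/\ weyl w, coroot_lattice q & u = affmap w q]].

Definition weyl_Y : set (AA -> AA) :=
  [set u | exists w y, [/\ weyl w, Y_lattice y & u = affmap w y]].

(* D(a, k), D°(a, k) with k in Z or k = +oo (encoded by None). *)
Definition halfspace (a : form) (k : option int) : set AA :=
  [set x | if k is Some m then 0 <= pairing a x + m%:~R else true].

Definition open_halfspace (a : form) (k : option int) : set AA :=
  [set x | if k is Some m then 0 < pairing a x + m%:~R else true].

Definition hyperplane (a : form) (k : int) : set AA :=
  [set x | pairing a x + k%:~R = 0].

Definition wall : set (set AA) :=
  [set H | exists a k, real_root a /\ H = hyperplane a k].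

Definition wall_coroot : set (set AA * AA) :=
  [set p | exists a av k, real_root_coroot (a, av) /\ p = (hyperplane a k, av)].

(* The linear part acts on the second component. *)
Definition automorphism : set (AA -> AA) :=
  [set u | exists l b, [/\ l \in unitmx, u = affmap l b &
     [set (u @` p.1, l *m p.2) | p in wall_coroot] = wall_coroot]].

Definition vect_weyl_automorphism : set (AA -> AA) :=
  [set u | automorphism u /\ exists2 w, weyl w & exists b, u = affmap w b].

Definition fund_chamber : set AA := [set x | forall i, 0 < pairing (rsroot i) x].

Definition fund_face (J : {set km_index V}) : set AA :=
  [set x | forall i, if i \in J then pairing (rsroot i) x == 0
                     else 0 < pairing (rsroot i) x].

Definition weyl_orbit (S : set AA) : set (set AA) :=
  [set F | exists2 w, weyl w &
     F = [set w *m x | x in S] \/ F = [set - (w *m x) | x in S]].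

Definition vect_face : set (set AA) :=
  [set F | exists J, weyl_orbit (fund_face J) F].

Definition vect_chamber : set (set AA) := weyl_orbit fund_chamber.

Definition tits_cone : set AA :=
  \bigcup_(w in weyl) [set w *m x | x in closure fund_chamber].

Definition pm_tits_interior : set AA :=
  [set v | interior tits_cone v \/ interior tits_cone (- v)].

Definition spherical (F : set AA) := F `&` pm_tits_interior !=set0.

Definition tits_le (x y : AA) := tits_cone (y - x).

Definition preordered (x y : AA) := tits_le x y \/ tits_le y x.

Definition generic (x y : AA) := pm_tits_interior (y - x).

Definition segment (x y : AA) : set AA :=
  [set x + t *: (y - x) | t in [set t : R | 0 <= t <= 1]].

Definition ray (x y : AA) : set AA :=
  [set x + t *: (y - x) | t in [set t : R | 0 <= t]].

Definition segment_germ (x y : AA) : set_system AA :=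
  [set E | exists2 U, nbhs x U & segment x y `&` U `<=` E].

Definition affine_subspace (S : set AA) :=
  S !=set0 /\ forall x y (t : R), S x -> S y -> S (x + t *: (y - x)).

Definition filter_support (F : set_system AA) : set AA :=
  \bigcap_(S in [set S | affine_subspace S /\ F S]) S.

Definition translate (x : AA) (S : set AA) : set AA := [set x + v | v in S].

Definition sector_germ_at (x : AA) (Fv : set AA) : set_system AA :=
  [set E | exists2 u, closure Fv u & translate (x + u) Fv `<=` E].

Definition sector_germ : set (set_system AA) :=
  [set F | exists x C, vect_chamber C /\ F = sector_germ_at x C].

Variables (L : lmodType R[i]) (g : kac_moody_algebra V L).
Local Notation Delta := (all_roots g).

Definition enclosure (F : set_system AA) : set_system AA :=
  [set E | exists k : form -> option int,
     let P := \bigcap_(a in Delta) halfspace a (k a) in F P /\ P `<=` E].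

Definition face_at (x : AA) (Fv : set AA) : set_system AA :=
  [set E | exists (k k' : form -> option int) (U : set AA),
     let P := \bigcap_(a in Delta)
       (halfspace a (k a) `&` open_halfspace a (k' a)) in
     [/\ nbhs x U, P `<=` E & U `&` translate x Fv `<=` P]].

Definition face : set (set_system AA) :=
  [set F | exists x Fv, vect_face Fv /\ F = face_at x Fv].

Definition chamber : set (set_system AA) :=
  [set F | face F /\ filter_support F = setT].

Definition panel : set (set_system AA) :=
  [set F | face F /\ wall (filter_support F)].

Definition chimney (F : set_system AA) (Fv : set AA) : set_system AA :=
  enclosure [set Z | exists2 E, F E & [set x + v | x in E & v in Fv] `<=` Z].

Definition chimney_germ (F : set_system AA) (Fv : set AA) : set_system AA :=
  [set Z | exists2 u, closure Fv u & chimney ((fun x => x + u) @ F) Fv Z].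

Definition solid (F : set_system AA) (Fv : set AA) :=
  let S := filter_support (chimney F Fv) in
  finite_set [set w | weyl w /\ forall x y, S x -> S y -> w *m (y - x) = y - x].

Definition solid_chimney : set (set_system AA) :=
  [set C | exists F Fv, [/\ face F, vect_face Fv, solid F Fv & C = chimney F Fv]].

Definition solid_chimney_germ : set (set_system AA) :=
  [set C | exists F Fv,
     [/\ face F, vect_face Fv, solid F Fv & C = chimney_germ F Fv]].

Definition splayed_chimney_germ : set (set_system AA) :=
  [set C | exists F Fv,
     [/\ face F, vect_face Fv, spherical Fv & C = chimney_germ F Fv]].

Definition MA2_filter : set (set_system AA) :=
  [set F | [\/ exists x, F = globally [set x],
               exists x y, [/\ x != y, preordered x y & F = segment_germ x y],
               exists x y, [/\ x != y, generic x y & F = globally (ray x y)] |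
               solid_chimney F]].

Definition filter_closure (F : set_system AA) : set_system AA :=
  [set Z | exists2 E, F E & closure E `<=` Z].

End ModelApartment.

(* [isomw A] is Isom^w(AA, A); it is only meaningful when A is an apartment. *)
Record apartment_system (R : realType) (V : vectorial_datum) (T : Type) :=
  ApartmentSystem {
    apartment : set (set T);
    isomw : set T -> set ('cV[R]_(yrank V) -> T)
  }.

(* Filters of an apartment are viewed as filters on the whole set T, by pushing
   them forward; thus a subset A of T contains the filter F iff F A holds. *)
Section Masure.
Variables (R : realType) (V : vectorial_datum).
Variables (L : lmodType R[i]) (g : kac_moody_algebra V L) (T : Type).
Variable M : apartment_system R V T.
Local Notation AA := 'cV[R]_(yrank V).
Local Notation apt := (apartment M).
Local Notation isom := (isomw M).

Definition apartment_structure (A : set T) :=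
  exists2 f0, set_bij setT A f0 &
    isom A = [set f0 \o u | u in @affine_weyl R V].

(* Maps A -> A' are given by total functions, relevant only on A. *)
Definition iso_for (P : set (AA -> AA)) (A A' : set T) (phi : T -> T) :=
  set_bij A A' phi /\
  forall f f', isom A f -> isom A' f' -> exists2 u, P u & phi \o f = f' \o u.

Definition weyl_iso := iso_for (@affine_weyl R V).
Definition apt_iso := iso_for (@vect_weyl_automorphism R V).

Definition in_apartment (P : set (set_system AA)) (A : set T) (F : set_system T) :=
  exists2 f, isom A f & exists2 F0, P F0 & F = f @ F0.

Definition in_masure (P : set (set_system AA)) : set (set_system T) :=
  [set F | exists2 A, apt A & in_apartment P A F].

Definition pullback (f : AA -> T) (F : set_system T) : set_system AA :=
  [set S | F (f @` S)].

Definition enclosure_in (A : set T) (F : set_system T) : set_system T :=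
  [set Z | exists2 f, isom A f & (f @ enclosure g (pullback f F)) Z].

Definition filter_cup (F F' : set_system T) : set_system T :=
  [set E `|` E' | E in F & E' in F'].

Definition fixes (phi : T -> T) (F : set_system T) :=
  exists2 S, F S & forall x, S x -> phi x = x.

Definition MA2_situation (A A' : set T) (F : set_system T) :=
  [/\ apt A, apt A', in_apartment (MA2_filter g) A F & F A'].

Definition MA3_situation (Rg F : set_system T) :=
  in_masure (splayed_chimney_germ g) Rg /\
  (in_masure (face g) F \/ in_masure (solid_chimney_germ g) F).

Definition MA4_situation (A A' : set T) (Rg F : set_system T) :=
  [/\ apt A, apt A', MA3_situation Rg F, Rg A /\ F A & Rg A' /\ F A'].

Record masure : Prop := Masure {
  masure_cover : \bigcup_(A in apt) A = setT;
  MA1 : forall A, apt A -> apartment_structure A;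
  MA2 : forall A A' F, MA2_situation A A' F ->
    enclosure_in A F (A `&` A') /\
    exists2 phi, weyl_iso A A' phi & fixes phi (enclosure_in A F);
  MA3 : forall Rg F, MA3_situation Rg F -> exists2 A, apt A & Rg A /\ F A;
  MA4 : forall A A' Rg F, MA4_situation A A' Rg F ->
    exists2 phi, weyl_iso A A' phi &
      fixes phi (enclosure_in A (filter_cup Rg F));
  MAO : forall A A' f f' x y x' y', apt A -> apt A' -> isom A f -> isom A' f' ->
    f x = f' x' -> f y = f' y' -> tits_le x y ->
    f @` segment x y = f' @` segment x' y'
}.

(* A filter lies in the closure of another one when every set of the latter
   belongs to it. *)
Definition lies_in_closure (P C : set_system T) :=
  exists A f C0, [/\ apt A, isom A f, chamber g C0, C = f @ C0 &
    (f @ filter_closure C0) `<=` P].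

Definition thick_finite :=
  forall P, in_masure (panel g) P ->
    let Ch := [set C | in_masure (chamber g) C /\ lies_in_closure P C] in
    finite_set Ch /\ (`I_3 #<= Ch)%card.

Definition induced (G : Type) (act : G -> T -> T) (A : set T) (phi : T -> T) :=
  exists h, forall x, A x -> act h x = phi x.

Record strongly_transitive (G : groupType) (act : G -> T -> T) : Prop :=
  StronglyTransitive {
    act_one : forall x, act 1%g x = x;
    act_mul : forall h k x, act (h * k)%g x = act h (act k x);
    act_apartment : forall h A, apt A -> apt (act h @` A);
    act_apt_iso : forall h A, apt A -> apt_iso A (act h @` A) (act h);
    act_MA2 : forall A A' F phi, MA2_situation A A' F ->
      weyl_iso A A' phi -> fixes phi (enclosure_in A F) -> induced act A phi;
    act_MA4 : forall A A' Rg F phi, MA4_situation A A' Rg F ->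
      weyl_iso A A' phi -> fixes phi (enclosure_in A (filter_cup Rg F)) ->
      induced act A phi
  }.

(* [iota] identifies the model apartment with the apartment A0; the stabilizer of
   A0 induces on it the group W^v |x Y. *)
Definition stabilizer_induces_weyl_Y (G : Type) (act : G -> T -> T)
    (A0 : set T) (iota : AA -> T) :=
  [set u : AA -> AA | exists2 h, act h @` A0 = A0 & act h \o iota = iota \o u] =
  @weyl_Y R V.

End Masure.

Definition metric_complete (R : realType) (T : metricType R) :=
  forall u : nat -> T, cauchy (u @ \oo) -> exists l : T, u @ \oo --> l.

(* Main.v *)
Require Import Defs.
From HB Require Import structures.
From mathcomp Require Import all_boot all_order all_algebra.
From mathcomp Require Import all_classical all_reals all_analysis.
From mathcomp Require Import complex.
From mathcomp Require Import zify ring lra.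
Set Implicit Arguments.
Unset Strict Implicit.
Unset Printing Implicit Defensive.
Import Order.TTheory GRing.Theory Num.Theory.
Import numFieldNormedType.Exports.
Local Open Scope classical_set_scope.
Local Open Scope ring_scope.

(** Fix a sector-germ s as in the hypothesis. By Baire's theorem it is enough to cover
the masure by countably many apartments containing s.

Let s' be opposite to s in some apartment. Given a point y, choose an apartment A
containing s and y, and let c be the chamber at y opposite to s in A. Some apartment
contains s' and c; there the direction of c is w s' for some w in W^v. If w = 1, then the
sectors from y towards s and s' extend each other to straight lines (this is where (MAO)
is used), so y lies in every apartment containing s and s'. Otherwise write w = r_i w'
and replace s' by a sector-germ s'' adjacent to s' along its i-th panel, in such a way that
the direction of c becomes w' s''. It suffices to take s'' in a countable family that
depends only on s' and i: the apartments containing s', seen near the i-th panel at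
infinity, branch only along walls of direction alpha_i, and finitely many branches leave
each panel. After finitely many steps y lies in one of the apartments attached to the
countably many sector-germs obtained from s'.

That there is no branching between two consecutive walls of direction alpha_i follows from
the form of the enclosure, once one knows that Delta is W^v-invariant, that roots are
positive or negative, and that the only multiples of alpha_i in Delta are alpha_i and
- alpha_i; these facts are derived from the definition of the Kac-Moody algebra. *)

(** * Roots of the Kac-Moody algebra *)

(** Baire's construction of shrinking balls is run inside a nonempty open set, where it yields a
    Cauchy sequence without cluster point. The whole space gives incompleteness, the interior of a
    compact set gives the other conclusion. Apartments are handled through charts, the maps of
    [isomw] from the model. Two charts of one apartment that agree deep inside one sector are equal,
    so normalizing charts at a sector-germ turns comparisons of apartments into equalities of maps.
    The obstacle is that a straight line leaving a sector-germ might bend when it is continued in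
    another apartment, its direction v becoming w v. (MAO) forces w v to be a nonnegative multiple
    of v, and the integrality of the action of W^v on roots leaves only w v = v; this is why the
    directions in use have levels 0 and -1. Any word for w serves, reduced or not: the exchange step
    cancels its first letter in all cases, and the induction is on the word. A chart agrees with a
    reference chart only above a level that depends on it, so the starting level, the number of
    walls crossed and the depth along the panel are all enumerated by integers. *)

Section LinearSpan.
Variables (K : pzRingType) (E : lmodType K).

Inductive lspan (B : set E) : set E :=
| lspan0 : lspan B 0
| lspanD c x y : B x -> lspan B y -> lspan B (c *: x + y).

Lemma lspan_lin (B : set E) c x y : lspan B x -> lspan B y -> lspan B (c *: x + y).
Proof.
move=> Bx By; elim: Bx => [|d u v Bu _ IH]; first by rewrite scaler0 add0r.
by rewrite scalerDr scalerA -addrA; apply: lspanD.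
Qed.

Lemma lspan_mem (B : set E) x : B x -> lspan B x.
Proof. by move=> Bx; rewrite -[x]scale1r -[_ *: x]addr0; apply: lspanD => //; apply: lspan0. Qed.

Lemma lspanZ (B : set E) c x : lspan B x -> lspan B (c *: x).
Proof. by move=> Bx; rewrite -[_ *: x]addr0; apply: lspan_lin => //; apply: lspan0. Qed.

Lemma lspan_add (B : set E) x y : lspan B x -> lspan B y -> lspan B (x + y).
Proof. by move=> Bx By; rewrite -[x]scale1r; apply: lspan_lin. Qed.

Lemma lspanN (B : set E) x : lspan B x -> lspan B (- x).
Proof. by move=> Bx; rewrite -scaleN1r; apply: lspanZ. Qed.

Lemma lspan_image (B B' : set E) (f : E -> E) :
  linear f -> (forall x, B x -> lspan B' (f x)) -> forall x, lspan B x -> lspan B' (f x).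
Proof.
move=> f_lin fB x; elim=> [|c u v Bu _ IH]; last first.
  by rewrite f_lin; apply: lspan_lin => //; apply: fB.
suff -> : f 0 = 0 by apply: lspan0.
by have := f_lin (-1) 0 0; rewrite scaler0 addr0 scaleN1r addNr.
Qed.

Lemma lspan_sub (B B' : set E) : B `<=` B' -> lspan B `<=` lspan B'.
Proof. by move=> sB x; elim=> [|c u v Bu _ IH]; [apply: lspan0|apply: lspanD => //; apply: sB]. Qed.

Lemma lspan_zero (B : set E) : (forall x, B x -> x = 0) -> forall x, lspan B x -> x = 0.
Proof. by move=> B0 x; elim=> [//|c u v /B0 -> _ ->]; rewrite scaler0 addr0. Qed.

End LinearSpan.

Section RootSystem.
Variables (R : realType) (V : vectorial_datum).

Definition word_weight (w : seq (km_index V)) : 'rV[int]_(yrank V) := \sum_(i <- w) sroot i.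

Lemma word_weightE w : word_weight w = \sum_i (count_mem i w)%:Z *: sroot i.
Proof.
rewrite /word_weight; elim: w => [|j w IH].
  by rewrite big_nil big1 // => i _; rewrite scale0r.
rewrite big_cons IH.
have {1}-> : sroot j = \sum_i (i == j)%:Z *: sroot i.
  rewrite (bigD1 j) //= eqxx scale1r big1 ?addr0 // => i /negbTE ->.
  by rewrite scale0r.
by rewrite -big_split; apply: eq_bigr => i _ /=; rewrite eq_sym PoszD scalerDl.
Qed.

(** No cancellation can occur: the coefficients are letter counts and the simple roots are free. *)
Lemma word_weight_eq0 w : word_weight w = 0 -> w = [::].
Proof.
move=> w0; case: w w0 => [//|j w] w0; exfalso.
have := @sroot_free V (fun i => (count_mem i (j :: w))%:Z).
by rewrite -word_weightE => /(_ w0 j); rewrite /= eqxx.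
Qed.

Lemma pairing_map_int (S : pzRingType) (b : 'rV[int]_(yrank V)) y :
  pairing (map_mx intr b) (map_mx intr y) = (pairing b y)%:~R :> S.
Proof.
rewrite /pairing !mxE rmorph_sum /=; apply: eq_bigr => i _.
by rewrite !mxE rmorphM.
Qed.

Lemma pairingDl (S : pzRingType) n (a b : 'rV[S]_n) x : pairing (a + b) x = pairing a x + pairing b x.
Proof. by rewrite /pairing mulmxDl mxE. Qed.

Lemma pairingNl (S : pzRingType) n (a : 'rV[S]_n) x : pairing (- a) x = - pairing a x.
Proof. by rewrite /pairing mulNmx mxE. Qed.

Lemma pairingZl (S : pzRingType) n c (a : 'rV[S]_n) x : pairing (c *: a) x = c * pairing a x.
Proof. by rewrite /pairing -scalemxAl mxE. Qed.

Lemma pairing0l (S : pzRingType) n (x : 'cV[S]_n) : pairing 0 x = 0.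
Proof. by rewrite /pairing mul0mx mxE. Qed.

Lemma pairingDr (S : pzRingType) n (a : 'rV[S]_n) x y : pairing a (x + y) = pairing a x + pairing a y.
Proof. by rewrite /pairing mulmxDr mxE. Qed.

Lemma pairingNr (S : pzRingType) n (a : 'rV[S]_n) x : pairing a (- x) = - pairing a x.
Proof. by rewrite /pairing mulmxN mxE. Qed.

Lemma pairing0r (S : pzRingType) n (a : 'rV[S]_n) : pairing a 0 = 0.
Proof. by rewrite /pairing mulmx0 mxE. Qed.

Lemma pairingZr (S : comPzRingType) n c (a : 'rV[S]_n) x : pairing a (c *: x) = c * pairing a x.
Proof. by rewrite /pairing -scalemxAr mxE. Qed.

Lemma pairing_suml (S : pzRingType) n (J : Type) (r : seq J) P (F : J -> 'rV[S]_n) x :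
  pairing (\sum_(j <- r | P j) F j) x = \sum_(j <- r | P j) pairing (F j) x.
Proof. by rewrite /pairing mulmx_suml summxE. Qed.

Lemma pairing_mulmx (S : pzRingType) n (a : 'rV[S]_n) (w : 'M[S]_n) x :
  pairing a (w *m x) = pairing (a *m w) x.
Proof. by rewrite /pairing mulmxA. Qed.

End RootSystem.

Section KacMoody.
Variables (R : realType) (V : vectorial_datum) (L : lmodType R[i]).
Local Notation K := R[i].
Local Notation weight := 'rV[int]_(yrank V).

(** * Weight spaces and iterated brackets of Chevalley generators *)

Section Bracket.
Variable g : kac_moody_algebra V L.
Local Notation br := (bracket g).
Local Notation e := (chev_e g).
Local Notation f := (chev_f g).
Local Notation wt := (root_space g).

Lemma br0l y : br 0 y = 0.
Proof. by have := bracket_linearl g y (-1) 0 0; rewrite scaler0 addr0 scaleN1r addNr. Qed.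
Lemma br0r y : br y 0 = 0.
Proof. by have := bracket_linearr g y (-1) 0 0; rewrite scaler0 addr0 scaleN1r addNr. Qed.
Lemma brDl x x' y : br (x + x') y = br x y + br x' y.
Proof. by have := bracket_linearl g y 1 x x'; rewrite !scale1r. Qed.
Lemma brDr x y y' : br x (y + y') = br x y + br x y'.
Proof. by have := bracket_linearr g x 1 y y'; rewrite !scale1r. Qed.
Lemma brZl c x y : br (c *: x) y = c *: br x y.
Proof. by have := bracket_linearl g y c x 0; rewrite br0l !addr0. Qed.
Lemma brZr c x y : br x (c *: y) = c *: br x y.
Proof. by have := bracket_linearr g x c y 0; rewrite br0r !addr0. Qed.
Lemma brNl x y : br (- x) y = - br x y.
Proof. by rewrite -scaleN1r brZl scaleN1r. Qed.
Lemma brNr x y : br x (- y) = - br x y.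
Proof. by rewrite -scaleN1r brZr scaleN1r. Qed.
Lemma brC x y : br x y = - br y x.
Proof.
apply/eqP; rewrite -addr_eq0; have := bracket_alt g (x + y).
by rewrite brDl !brDr !bracket_alt add0r addr0 => ->.
Qed.
Lemma br_jacobi x y z : br x (br y z) = br (br x y) z + br y (br x z).
Proof.
have := bracket_jacobi g x y z; rewrite (brC z (br x y)) (brC z x) -scaleN1r brZr scaleN1r.
move=> /eqP; rewrite addrAC subr_eq0 subr_eq => /eqP ->; by rewrite addrC.
Qed.

Lemma wt_lin b c x y : wt b x -> wt b y -> wt b (c *: x + y).
Proof. by move=> bx b_y h; rewrite brDr brZr bx b_y scalerDr !scalerA mulrC. Qed.
Lemma wt0 b : wt b 0.
Proof. by move=> h; rewrite br0r scaler0. Qed.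
Lemma wtZ b c x : wt b x -> wt b (c *: x).
Proof. by move=> bx; rewrite -[_ *: x]addr0; apply: wt_lin => //; apply: wt0. Qed.
Lemma wt_br b c x y : wt b x -> wt c y -> wt (b + c) (br x y).
Proof.
move=> bx cy h; rewrite br_jacobi bx cy brZl brZr -scalerDl.
by rewrite map_mxD pairingDl.
Qed.
Lemma wt_e i : wt (sroot i) (e i).
Proof. by move=> h; rewrite bracket_he. Qed.
Lemma wt_f i : wt (- sroot i) (f i).
Proof. by move=> h; rewrite bracket_hf map_mxN pairingNl. Qed.
Lemma wt_h h : wt 0 (cartan g h).
Proof. by move=> h'; rewrite bracket_hh map_mx0 pairing0l scale0r. Qed.

Lemma weight_separation (b c : weight) : b != c ->
  exists h : 'cV[K]_(yrank V), pairing (map_mx intr b) h != pairing (map_mx intr c) h.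
Proof.
move=> nbc; have [j hj] : exists j, b ord0 j != c ord0 j.
  apply/existsP; apply: contraNT nbc; rewrite negb_exists => /forallP h.
  apply/eqP/rowP => j; apply/eqP; have := h j; by rewrite negbK.
exists (delta_mx j ord0); rewrite /pairing -!colE !mxE.
by rewrite (inj_eq (@intr_inj K)).
Qed.

(** For [h] separating [b] from the first weight, subtracting that weight's value from the action of
    [h] kills the first summand, rescales the others and multiplies [x] by a nonzero scalar.
    Induction on the number of summands follows. *)
Lemma wt_indep b (s : seq (weight * L)) x :
  (forall p, p \in s -> p.1 != b /\ wt p.1 p.2) -> wt b x ->
  x = \sum_(p <- s) p.2 -> x = 0.
Proof.
move sn : (size s) => n; elim: n s sn x => [|n IH] [|p s] //= => [_|[sn]] x sP bx.
  by rewrite big_nil.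
rewrite big_cons => xE.
have [pb pw] := sP p (mem_head _ _).
have [h hP] := weight_separation pb.
pose k (c : weight) : K := pairing (map_mx intr c) h - pairing (map_mx intr p.1) h.
suff : k b *: x = 0.
  by move/eqP; rewrite scaler_eq0 /k subr_eq0 eq_sym (negbTE hP) => /eqP.
have kE c y : wt c y -> br (cartan g h) y - pairing (map_mx intr p.1) h *: y = k c *: y.
  by move=> ->; rewrite -scalerBl.
apply: (IH [seq (q.1, k q.1 *: q.2) | q <- s]) => [|q /mapP[r rs ->]||] /=.
- by rewrite size_map.
- by have [rb rw] := sP r (mem_behead (s := p :: s) rs); split => //; apply: wtZ.
- exact: wtZ.
rewrite big_map /= -(kE b x bx) xE brDr scalerDr opprD addrACA (kE _ _ pw) {1}/k subrr scale0r add0r.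
have -> : br (cartan g h) (\sum_(q <- s) q.2) = \sum_(q <- s) br (cartan g h) q.2.
  by elim: (s) => [|q t IHt]; rewrite ?big_nil ?br0r // !big_cons brDr IHt.
rewrite scaler_sumr -sumrB; apply: eq_big_seq => q qs; apply: kE.
by have [] := sP q (mem_behead (s := p :: s) qs).
Qed.

(** The terms of weight other than [b] are gathered in a sum that is also a vector of weight [b],
    hence zero by [wt_indep]. *)
Lemma lspan_wt (B : set L) b x : (forall y, B y -> exists c, wt c y) ->
  lspan B x -> wt b x -> lspan (B `&` wt b) x.
Proof.
move=> Bwt Bx bx.
have sub_wt y : lspan (B `&` wt b) y -> wt b y.
  by elim=> [|c u v [_ bu] _ IH]; [exact: wt0|exact: wt_lin].
have [y [s [By sP xE]]] : exists y (s : seq (weight * L)), [/\ lspan (B `&` wt b) y,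
    (forall p, p \in s -> p.1 != b /\ wt p.1 p.2) & x = y + \sum_(p <- s) p.2].
  elim: Bx => [|c u v Bu _ [y [s [By sP ->]]]].
    by exists 0, [::]; split=> //; [exact: lspan0|rewrite big_nil addr0].
  have [a au] := Bwt u Bu; have [ab|ab] := eqVneq a b.
    exists (c *: u + y), s; split=> //; last by rewrite addrA.
    by apply: lspanD => //; split=> //; rewrite -ab.
  exists y, ((a, c *: u) :: s); split=> // [p|]; last by rewrite big_cons addrCA.
  by rewrite inE => /orP[/eqP -> /=|/sP //]; split=> //; apply: wtZ.
suff : x - y = 0 by move/eqP; rewrite subr_eq0 => /eqP ->.
apply: (@wt_indep b s) => //; last by rewrite xE addrC addKr.
by rewrite addrC -scaleN1r; apply: wt_lin => //; apply: sub_wt.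
Qed.

Lemma wt_unique b c x : x != 0 -> wt b x -> wt c x -> b = c.
Proof.
move=> x0 bx cx; apply/eqP; apply: contraNT x0 => nbc; apply/eqP.
apply: (@wt_indep c [:: (b, x)]) => //; last by rewrite big_seq1.
by move=> p; rewrite inE => /eqP ->.
Qed.

(** By the Jacobi identity the elements mapping [S] into itself form a subalgebra, so stability
    under the generators suffices. *)
Lemma chevalley_ideal (S : set L) : S 0 ->
  (forall c x y, S x -> S y -> S (c *: x + y)) ->
  (forall h y, S y -> S (br (cartan g h) y)) -> (forall i y, S y -> S (br (e i) y)) ->
  (forall i y, S y -> S (br (f i) y)) -> forall x y, S y -> S (br x y).
Proof.
move=> S0 Slin Sh Se Sf x.
apply: (km_generated (k := g) (S := [set x | forall y, S y -> S (br x y)])) => //=.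
  by move=> c u v Su Sv y Sy; rewrite brDl brZl; apply: Slin; [apply: Su|apply: Sv].
move=> u v Su Sv y Sy.
have -> : br (br u v) y = (-1) *: br v (br u y) + br u (br v y).
  by rewrite (br_jacobi u v) scaleN1r addrC addrK.
by apply: Slin; [apply/Sv/Su|apply/Su/Sv].
Qed.

(** Right-nested brackets. One-letter words are a separate case, since [br (e i) 0] would give zero
    instead of [e i]. *)
Fixpoint eword (w : seq (km_index V)) : L :=
  match w with
  | [::] => 0
  | [:: i] => e i
  | i :: w => br (e i) (eword w)
  end.

Arguments eword : simpl never.

Lemma eword1 i : eword [:: i] = e i.
Proof. by []. Qed.

Lemma eword_cons i w : w != [::] -> eword (i :: w) = br (e i) (eword w).
Proof. by case: w. Qed.

Lemma wt_eword w : wt (word_weight w) (eword w).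
Proof.
elim: w => [|i w IH]; first exact: wt0.
have [->|w0] := eqVneq w [::].
  by rewrite /word_weight big_seq1; apply: wt_e.
by rewrite eword_cons // /word_weight big_cons; apply: wt_br => //; apply: wt_e.
Qed.

(** The innermost bracket is [[e_i, e_i] = 0]. This is what excludes proper multiples of a simple
    root from the roots. *)
Lemma eword_nseq i w : (1 < size w)%N -> all (pred1 i) w -> eword w = 0.
Proof.
elim: w => [//|j w IH] /= sw /andP[/eqP -> wi].
have [w1|] := ltnP 1 (size w).
  by rewrite eword_cons ?IH ?br0r //; case: (w) w1.
by case: w wi sw {IH} => [//|k []] //= /andP[/eqP -> _] _ _; rewrite eword_cons // eword1 bracket_alt.
Qed.

End Bracket.

Section Opposite.
Variable g : kac_moody_algebra V L.

Let ch : {linear 'cV[K]_(yrank V) -> L} := \- cartan g.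
Let negE h : ch h = - cartan g h.
Proof. by []. Qed.

(* The Chevalley involution exchanges positive and negative roots. *)
Definition opposite : kac_moody_algebra V L.
Proof.
apply: (@KacMoodyAlgebra R V L (bracket g) (bracket_linearl g) (bracket_linearr g)
  (bracket_alt g) (bracket_jacobi g) ch _ (chev_f g) (chev_e g)).
- by move=> h h'; rewrite !negE => /oppr_inj /cartan_inj.
- by move=> h h'; rewrite !negE brNl brNr bracket_hh !oppr0.
- by move=> h i; rewrite negE brNl bracket_hf scaleNr opprK.
- by move=> h i; rewrite negE brNl bracket_he scaleNr.
- move=> i j; rewrite negE brC bracket_ef eq_sym; case: ifP => [/eqP -> //|_]; exact: oppr0.
- move=> S Sh Sf Se Slin Sbr; apply: (km_generated (k := g)) => // h.
  by rewrite -[h]opprK linearN -negE; apply: Sh.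
- move=> J J0 Jlin Jbr Jh; apply: (km_no_ideal (k := g)) => // h Jc.
  have : ch (- h) = 0 by apply: Jh; rewrite negE linearN opprK.
  by rewrite negE linearN opprK.
Defined.

Lemma cartan_oppositeE h : cartan opposite h = - cartan g h.
Proof. by []. Qed.

Lemma wt_opposite b x : root_space opposite b x <-> root_space g (- b) x.
Proof.
have brE h : bracket opposite (cartan opposite h) x = - bracket g (cartan g h) x.
  by rewrite cartan_oppositeE -brNl.
split=> bx h.
  by rewrite -[LHS]opprK -brE bx map_mxN pairingNl scaleNr.
by rewrite brE bx map_mxN pairingNl scaleNr opprK.
Qed.

End Opposite.

(** * Triangular decomposition; roots are positive or negative *)

Section Triangular.
Variable g : kac_moody_algebra V L.
Local Notation br := (bracket g).
Local Notation e := (chev_e g).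
Local Notation f := (chev_f g).
Local Notation wt := (root_space g).
Local Notation fword := (eword (opposite g)).

Lemma wt_fword w : wt (- word_weight w) (fword w).
Proof. by apply/wt_opposite/wt_eword. Qed.

Definition cartan_vector : set L := range (cartan g).
Definition words (h : kac_moody_algebra V L) : set L :=
  [set x | exists2 w, w != [::] & x = eword h w].

End Triangular.

Lemma words_e (g : kac_moody_algebra V L) i x :
  lspan (cartan_vector g `|` words g) x -> lspan (words g) (bracket g (chev_e g i) x).
Proof.
apply: lspan_image => [|y]; first exact: bracket_linearr.
case=> [[h _ <-]|[w w0 ->]].
  rewrite brC bracket_he -scaleNr; apply/lspanZ/lspan_mem; by exists [:: i].
by apply: lspan_mem; exists (i :: w) => //; rewrite eword_cons.
Qed.

Lemma cartan_opposite (g : kac_moody_algebra V L) : cartan_vector (opposite g) = cartan_vector g.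
Proof.
by apply/seteqP; split=> _ [h _ <-]; exists (- h) => //; rewrite ?cartan_oppositeE linearN ?cartan_oppositeE ?opprK.
Qed.

(** [f_i] acts as a derivation. On meeting a letter [e_j] it gives zero or a Cartan element, which
    acts by a scalar on the rest of the word. *)
Lemma words_f (g : kac_moody_algebra V L) i x : lspan (words g) x ->
  lspan (cartan_vector g `|` words g) (bracket g (chev_f g i) x).
Proof.
apply: lspan_image => [|y]; first exact: bracket_linearr.
case=> w w0 ->; elim: w w0 => [//|j w IH] _.
(* In [opposite g] the generators e and f are exchanged, so this is its relation [bracket_ef]. *)
have fe : bracket g (chev_f g i) (chev_e g j) =
   if i == j then cartan (opposite g) (map_mx intr (scoroot i)) else 0.
  by rewrite -(bracket_ef (opposite g)).
have [->|w0] := eqVneq w [::].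
  rewrite eword1 fe; case: ifP => _; last exact: lspan0.
  by apply: lspan_mem; left; rewrite -cartan_opposite; eexists.
rewrite eword_cons // br_jacobi fe; apply: lspan_add.
  case: ifP => _; last by rewrite br0l; apply: lspan0.
  rewrite cartan_oppositeE brNl (wt_eword g w); apply/lspanN/lspanZ/lspan_mem; right; by exists w.
by apply: (@lspan_sub _ _ (words g)); [right|apply/words_e/IH].
Qed.

(** The span is stable under all generators, hence an ideal by [chevalley_ideal], and it contains
    them. The negative half is obtained from [words_e] and [words_f] for [opposite g]. *)
Lemma triangular_decomposition (g : kac_moody_algebra V L) x :
  lspan (cartan_vector g `|` words g `|` words (opposite g)) x.
Proof.
set B := _ `|` _.
have Bh : cartan_vector g `<=` B by left; left.
have Be : words g `<=` B by left; right.
have Bf : words (opposite g) `<=` B by right.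
have closed_h h y : lspan B y -> lspan B (bracket g (cartan g h) y).
  apply: lspan_image => [|z Bz]; first exact: bracket_linearr.
  suff [b bz] : exists b, root_space g b z by rewrite bz; apply/lspanZ/lspan_mem.
  case: Bz => [[[h' _ <-]|[w _ ->]]|[w _ ->]]; first by exists 0; apply: wt_h.
    by exists (word_weight w); apply: wt_eword.
  by exists (- word_weight w); apply: wt_fword.
have closed_e i y : lspan B y -> lspan B (bracket g (chev_e g i) y).
  apply: lspan_image => [|z Bz]; first exact: bracket_linearr.
  case: Bz => [Bz|Bz].
    by apply: (lspan_sub Be); apply/words_e/lspan_mem.
  have := words_f (g := opposite g) i (lspan_mem Bz); apply: lspan_sub.
  by rewrite cartan_opposite => u [] ?; [apply: Bh|apply: Bf].
have closed_f i y : lspan B y -> lspan B (bracket g (chev_f g i) y).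
  apply: lspan_image => [|z Bz]; first exact: bracket_linearr.
  have [Bz'|Bz'] : (cartan_vector (opposite g) `|` words (opposite g)) z \/ words g z.
  - by case: Bz => [[]|] ?; [left; left; rewrite cartan_opposite|right|left; right].
  - by apply: (lspan_sub Bf); have := words_e (g := opposite g) i (lspan_mem Bz').
  have := words_f i (lspan_mem Bz'); apply: lspan_sub.
  by move=> u [] ?; [apply: Bh|apply: Be].
apply: (km_generated (k := g)) => [h|i|i|c u v|u v _].
- by apply/lspan_mem/Bh; exists h.
- by apply/lspan_mem/Be; exists [:: i].
- by apply/lspan_mem/Bf; exists [:: i].
- exact: lspan_lin.
by apply: chevalley_ideal => //; [exact: lspan0|move=> *; exact: lspan_lin].
Qed.

(** Some spanning vector of weight [b] is nonzero; as [b != 0] it is not in the Cartan subalgebra,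
    so it is a word in the [e_i] or in the [f_i]. The last clause is [eword_nseq]. *)
Lemma root_word (g : kac_moody_algebra V L) b x : root_space g b x -> x != 0 -> b != 0 ->
  exists w, [/\ w != [::], b = word_weight w \/ b = - word_weight w &
    forall i, all (pred1 i) w -> size w = 1%N].
Proof.
move=> bx x0 b0.
have [u [[Bu bu] u0]] : exists u, ((cartan_vector g `|` words g `|` words (opposite g)) `&`
    root_space g b) u /\ u != 0.
  apply: contrapT => h; move/eqP: x0; apply.
  apply: lspan_zero (lspan_wt _ (triangular_decomposition g x) bx).
    move=> y By; apply: contrapT => /eqP y0; apply: h; by exists y.
  move=> y [[[h' _ <-]|[w _ ->]]|[w _ ->]]; first by exists 0; apply: wt_h.
    by exists (word_weight w); apply: wt_eword.
  by exists (- word_weight w); apply: wt_fword.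
have word1 h w : eword h w != 0 -> w != [::] -> forall i, all (pred1 i) w -> size w = 1%N.
  move=> hw w0 i wi; apply/eqP; rewrite eqn_leq lt0n size_eq0 w0 andbT leqNgt.
  by apply: contra hw => w1; apply/eqP; apply: (eword_nseq _ (i := i)).
case: Bu => [[[h _ hE]|[w w0 uE]]|[w w0 uE]].
- by move/eqP: b0; rewrite (wt_unique u0 bu (b := b) (c := 0)) // -hE; apply: wt_h.
- exists w; split=> //; last by apply: (word1 g) => //; rewrite -uE.
  by left; apply: (wt_unique u0 bu); rewrite uE; apply: wt_eword.
exists w; split=> //; last by apply: (word1 (opposite g)) => //; rewrite -uE.
by right; apply: (wt_unique u0 bu); rewrite uE; apply: wt_fword.
Qed.

(** * Serre relations, local nilpotency and reflection of roots *)

Section Integrability.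
Variable g : kac_moody_algebra V L.
Local Notation br := (bracket g).
Local Notation e := (chev_e g).
Local Notation f := (chev_f g).
Local Notation wt := (root_space g).
Local Notation F i := (bracket g (chev_f g i)).

Lemma wt_coroot c (i : km_index V) y : wt c y ->
  br (cartan g (map_mx intr (scoroot i))) y = (pairing c (scoroot i))%:~R *: y.
Proof. by move=> ->; rewrite pairing_map_int. Qed.

Lemma wt_iterF b (i : km_index V) k x : wt b x -> wt (b - sroot i *+ k) (iter k (F i) x).
Proof.
move=> bx; elim: k => [|k IH]; first by rewrite subr0.
by rewrite mulrS opprD addrCA; apply: wt_br => //; apply: wt_f.
Qed.

Lemma pairing_root_string (b : weight) (i : km_index V) k :
  pairing (b - sroot i *+ k) (scoroot i) = pairing b (scoroot i) - (2 * k%:Z).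
Proof.
rewrite pairingDl pairingNl; congr (_ - _); elim: k => [|k IH].
  by rewrite mulr0n pairing0l mulr0.
by rewrite mulrS pairingDl IH sroot_scoroot km_diag; lia.
Qed.

(** The usual sl2 computation: each passage of [e_i] past an [f_i] adds the value at the coroot of
    the weight reached, and this value drops by 2 at every step. *)
Lemma sl2_raise b (i : km_index V) x k : wt b x -> br (e i) x = 0 ->
  br (e i) (iter k.+1 (F i) x) =
    (k.+1%:Z * (pairing b (scoroot i) - k%:Z))%:~R *: iter k (F i) x.
Proof.
move=> bx ex; elim: k => [|k IH].
  by rewrite /= br_jacobi bracket_ef eqxx ex br0r addr0 (wt_coroot _ bx) mul1r subr0.
rewrite iterS br_jacobi bracket_ef eqxx IH brZr -iterS (wt_coroot _ (wt_iterF i k.+1 bx)).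
rewrite pairing_root_string -scalerDl -rmorphD /=; congr (_%:~R *: _).
by lia.
Qed.

Definition km_gap (i j : km_index V) : nat := `|km_matrix i j|%N.

Lemma km_gapE i j : i != j -> km_matrix i j = - (km_gap i j)%:Z.
Proof. by move=> ij; rewrite /km_gap lez0_abs ?opprK //; apply: km_offdiag. Qed.

(** For [k = i] the factor in [sl2_raise] vanishes at this exponent. For [k != i], [e_k] commutes
    with [f_i] and reaches [f_j]; if [k = j] this leaves a Cartan element, which [f_i] sends to
    [c_ji] times [f_i], and a second [f_i] kills it. If [c_ij = 0] there is no second [f_i], but
    then [c_ji = 0]. *)
Lemma serre_vector_killed i j k : i != j ->
  br (e k) (iter (km_gap i j).+1 (F i) (f j)) = 0.
Proof.
move=> ij; have fj := wt_f g j.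
have [->|ki] := eqVneq k i.
  rewrite (sl2_raise _ fj) ?bracket_ef ?(negbTE ij) //.
  by rewrite pairingNl sroot_scoroot km_gapE // opprK subrr mulr0 scale0r.
have swap m : br (e k) (iter m (F i) (f j)) = iter m (F i) (br (e k) (f j)).
  elim: m => [//|m IH]; rewrite iterS br_jacobi bracket_ef (negbTE ki) br0l add0r IH.
  by rewrite iterS.
rewrite swap bracket_ef; have [kj|_] := eqVneq k j; last first.
  by elim: (_.+1) => [//|m /= ->]; rewrite br0r.
rewrite iterSr brC bracket_hf pairing_map_int sroot_scoroot scaleNr opprK kj.
have [z|] := posnP (km_gap i j); last first.
  by case: (km_gap i j) => [//|m] _; rewrite iterSr brZr bracket_alt scaler0;
     elim: m => [//|m /= ->]; rewrite br0r.
have : km_matrix i j = 0 by rewrite km_gapE // z.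
by move/km_zero => ->; rewrite scale0r z.
Qed.

(** As [y] is killed by every [e_k], the vectors obtained from it by applying the [f_k] span an
    ideal. Its weights are opposite to weights of nonempty words, so it meets the Cartan subalgebra
    trivially and must vanish. *)
Lemma serre i j : i != j -> iter (km_gap i j).+1 (F i) (f j) = 0.
Proof.
move=> ij; set y := iter _ _ _.
pose B := [set x | exists w, x = foldr (fun k z => br (f k) z) y w].
pose top := rcons (nseq (km_gap i j).+1 i) j.
have wtB w : wt (- word_weight (w ++ top)) (foldr (fun k z => br (f k) z) y w).
  elim: w => [|k w IH] /=; last first.
    by rewrite /word_weight big_cons opprD; apply: wt_br => //; apply: wt_f.
  have := wt_iterF i (km_gap i j).+1 (wt_f g j); rewrite -/y.
  have nseqE k : \sum_(l <- nseq k i) sroot l = sroot i *+ k.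
    by elim: k => [|k IH]; rewrite ?big_nil // big_cons IH mulrS.
  by rewrite /word_weight /top -cats1 big_cat big_seq1 nseqE opprD addrC.
have Blin c u v : lspan B u -> lspan B v -> lspan B (c *: u + v) by apply: lspan_lin.
have Bh h u : lspan B u -> lspan B (br (cartan g h) u).
  apply: lspan_image => [|z [w ->]]; first exact: bracket_linearr.
  by rewrite wtB; apply/lspanZ/lspan_mem; exists w.
have Bf k u : lspan B u -> lspan B (br (f k) u).
  apply: lspan_image => [|z [w ->]]; first exact: bracket_linearr.
  by apply/lspan_mem; exists (k :: w).
have Be k u : lspan B u -> lspan B (br (e k) u).
  apply: lspan_image => [|z [w ->]]; first exact: bracket_linearr.
  elim: w => [|l w IH] /=; first by rewrite serre_vector_killed //; apply: lspan0.
  rewrite br_jacobi bracket_ef; apply: lspan_add; last exact: Bf.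
  case: ifP => _; last by rewrite br0l; apply: lspan0.
  by apply/Bh/lspan_mem; exists w.
apply: (km_no_ideal (k := g) (J := lspan B)) => //; first exact: lspan0.
- exact: chevalley_ideal (lspan0 _) _ _ _ _.
- move=> h Bc; apply: lspan_zero (lspan_wt _ Bc (wt_h g h)).
    move=> z [[w ->] zw]; apply/eqP; apply: contraT => z0.
    have := wt_unique z0 (wtB w) zw; move/eqP; rewrite oppr_eq0 => /eqP /word_weight_eq0.
    by case: w {z0 zw}.
  by move=> z [w ->]; eexists; apply: wtB.
- by apply: lspan_mem; exists [::].
Qed.

Lemma iter_br0 i k : iter k (F i) 0 = 0.
Proof. by elim: k => [//|k /= ->]; rewrite br0r. Qed.

Lemma iter_brD i k x y : iter k (F i) (x + y) = iter k (F i) x + iter k (F i) y.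
Proof. by elim: k => [//|k /= ->]; rewrite brDr. Qed.

Lemma iter_brZ i k c x : iter k (F i) (c *: x) = c *: iter k (F i) x.
Proof. by elim: k => [//|k /= ->]; rewrite brZr. Qed.

Lemma nilpotent_le i m n x : (m <= n)%N -> iter m (F i) x = 0 -> iter n (F i) x = 0.
Proof. by move=> /subnK <- h; rewrite iterD h iter_br0. Qed.

Lemma nilpotent_br i m n k x y : (m + n <= k)%N ->
  iter m (F i) x = 0 -> iter n (F i) y = 0 -> iter k (F i) (br x y) = 0.
Proof.
elim: k m n x y => [|k IH] m n x y.
  by rewrite leqn0 addn_eq0 => /andP[/eqP -> /eqP ->] /= -> _; rewrite br0l.
case: m => [|m]; first by move=> _ /= -> _; rewrite br0l -/(iter k.+1 _ _) iter_br0.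
case: n => [|n] mn; first by move=> _ /= ->; rewrite br0r -/(iter k.+1 _ _) iter_br0.
move=> xm yn; rewrite iterSr br_jacobi iter_brD (IH m n.+1) ?(IH m.+1 n) ?addr0 //.
- by rewrite addSn -addnS.
- by rewrite -iterSr.
- by rewrite -iterSr.
Qed.

(** By the Leibniz rule the vectors killed by a power of [ad f_i] form a subalgebra. Among the
    generators, only the [f_j] with [j != i] require the Serre relations. *)
Lemma locally_nilpotent i x : exists k, iter k (F i) x = 0.
Proof.
apply: (km_generated (k := g) (S := [set x | exists k, iter k (F i) x = 0])) => /=.
- move=> h; exists 2; rewrite /= [br _ (cartan g h)]brC bracket_hf -scaleNr brZr bracket_alt.
  by rewrite scaler0.
- move=> j; exists 3; rewrite /= [br _ (e j)]brC bracket_ef; case: ifP => _.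
    rewrite brNr [br _ (cartan g _)]brC bracket_hf opprK brZr.
    by rewrite bracket_alt scaler0.
  by rewrite oppr0 !br0r.
- move=> j; have [<-|ij] := eqVneq i j; last by eexists; apply: serre.
  by exists 1; rewrite /= bracket_alt.
- move=> c u v [m um] [n vn]; exists (maxn m n).
  rewrite iter_brD iter_brZ (nilpotent_le _ um) ?leq_maxl //.
  by rewrite (nilpotent_le _ vn) ?leq_maxr // scaler0 addr0.
by move=> u v [m um] [n vn]; exists (m + n)%N; apply: (nilpotent_br (leqnn _) um vn).
Qed.

End Integrability.

(** From the top of the string, reached by [p] applications of [e_i], one goes down by [f_i]: by
    [sl2_raise] the vectors are nonzero up to step [m + 2p], and at step [m + p] the weight is
    [r_i b]. *)
Lemma root_string_pos (g : kac_moody_algebra V L) b (i : km_index V) x (m : nat) :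
  root_space g b x -> x != 0 -> pairing b (scoroot i) = m ->
  exists2 y, root_space g (b - sroot i *+ m) y & y != 0.
Proof.
move=> bx x0 bm; pose E := bracket g (chev_e g i).
have [p [y0 Ey0]] : exists p, iter p E x != 0 /\ iter p.+1 E x = 0.
  have [k kx] := locally_nilpotent (opposite g) i x.
  elim: k kx => [|k IH] kx; first by rewrite -[x]/(iter 0 E x) kx eqxx in x0.
  by have [/IH //|k0] := eqVneq (iter k E x) 0; exists k.
have by_ : root_space g (b + sroot i *+ p) (iter p E x).
  have := @wt_iterF (opposite g) (- b) i p x; rewrite !wt_opposite opprK opprD !opprK.
  exact.
have pE : pairing (b + sroot i *+ p) (scoroot i) = (m + p.*2)%N.
  have := pairing_root_string (- b) i p.
  by rewrite -opprD pairingNl => /eqP; rewrite eqr_oppLR => /eqP ->; rewrite pairingNl bm; lia.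
have nz k : (k <= m + p.*2)%N -> iter k (bracket g (chev_f g i)) (iter p E x) != 0.
  elim: k => [//|k IH] km; apply: contraNneq (IH (ltnW km)) => k0.
  have := sl2_raise k by_ Ey0; rewrite k0 br0r pE => /esym /eqP.
  rewrite scaler_eq0 intr_eq0 mulf_eq0 => /orP[/orP[//|]|/eqP ->]; last by [].
  by rewrite subr_eq0 eqz_nat => /eqP kE; rewrite kE ltnn in km.
exists (iter (m + p)%N (bracket g (chev_f g i)) (iter p E x)); last by apply: nz; lia.
have -> : b - sroot i *+ m = b + sroot i *+ p - sroot i *+ (m + p).
  by rewrite mulrnDr opprD addrA addrAC addrK.
exact: wt_iterF.
Qed.

Lemma root_reflection (g : kac_moody_algebra V L) b (i : km_index V) x : root_space g b x -> x != 0 ->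
  exists2 y, root_space g (b - pairing b (scoroot i) *: sroot i) y & y != 0.
Proof.
move=> bx x0; have [m bm] : exists m : nat, `|pairing b (scoroot i)| = m :> int.
  by exists `|pairing b (scoroot i)|%N.
have [b0|/ltW b0] := lerP 0 (pairing b (scoroot i)).
  have [y yP y0] := root_string_pos (m := m) bx x0 (etrans (esym (ger0_norm b0)) bm).
  by exists y => //; move: yP; rewrite -scaler_nat natz -bm ger0_norm.
have [||y yP y0] := @root_string_pos (opposite g) (- b) i x m _ x0.
- by apply/wt_opposite; rewrite opprK.
- by rewrite pairingNl -(ler0_norm b0).
exists y => //; move: yP => /wt_opposite.
by rewrite opprD !opprK -scaler_nat natz -bm ler0_norm // scaleNr.
Qed.

End KacMoody.

(** * The model apartment *)

Section SimpleRoots.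
Variables (R : realType) (V : vectorial_datum).
Local Notation n := (yrank V).
Local Notation AA := 'cV[R]_n.

Definition simple_root_mx (S : pzRingType) (h : int -> S) : 'M[S]_(#|km_index V|, n) :=
  \matrix_(k, j) h (sroot (enum_val k) ord0 j).

(** Multiplying by the product [d] of all denominators turns a rational relation into an integral
    one. *)
Lemma simple_root_mx_rat : row_free (simple_root_mx (intr : int -> rat)).
Proof.
apply: inj_row_free => v v0.
pose d := \prod_k denq (v ord0 k).
have d0 : d != 0 by apply/prodf_neq0 => k _; apply: denq_neq0.
pose z (i : km_index V) : int :=
  numq (v ord0 (enum_rank i)) * \prod_(k | k != enum_rank i) denq (v ord0 k).
have zE i : (z i)%:~R = d%:~R * v ord0 (enum_rank i) :> rat.
  have -> : d = denq (v ord0 (enum_rank i)) * \prod_(k | k != enum_rank i) denq (v ord0 k).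
    by rewrite /d (bigD1 (enum_rank i)).
  by rewrite /z !intrM numqE; ring.
have z0 : \sum_i z i *: sroot i = 0.
  apply/rowP => j; rewrite summxE mxE; apply: (@intr_inj rat); rewrite rmorph_sum /=.
  transitivity (d%:~R * (v *m simple_root_mx (intr : int -> rat)) ord0 j); last first.
    by rewrite v0 mxE mulr0.
  rewrite mxE.
  rewrite mulr_sumr (reindex _ (onW_bij _ (@enum_val_bij (km_index V)))) /=; apply: eq_bigr => k _.
  by rewrite !mxE intrM zE enum_valK mulrA.
apply/rowP => k; rewrite mxE; have := sroot_free z0 (enum_val k) => /(congr1 (intr : int -> rat)).
by rewrite zE enum_valK => /eqP; rewrite mulf_eq0 intr_eq0 (negbTE d0) => /eqP.
Qed.

(** Row-freeness passes from the rationals to the reals, and a right inverse solves the system.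
    Every later choice of a point with prescribed levels rests on this. *)
Lemma simple_root_values (c : km_index V -> R) : exists x : AA, forall i, pairing (rsroot R i) x = c i.
Proof.
have : row_free (simple_root_mx (intr : int -> R)).
  have -> : simple_root_mx (intr : int -> R) = map_mx ratr (simple_root_mx (intr : int -> rat)).
    by apply/matrixP => k j; rewrite !mxE ratr_int.
  by rewrite row_free_map simple_root_mx_rat.
move=> /row_freeP[B AB]; exists (B *m \col_k c (enum_val k)) => i.
have -> : rsroot R i = row (enum_rank i) (simple_root_mx (intr : int -> R)).
  by apply/rowP => j; rewrite !mxE enum_rankK.
by rewrite /pairing -row_mul mulmxA AB mul1mx !mxE enum_rankK.
Qed.

End SimpleRoots.

Section Levels.
Variables (R : realType) (V : vectorial_datum).
Local Notation n := (yrank V).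
Local Notation AA := 'cV[R]_n.
Local Notation form := 'rV[R]_n.
Implicit Types (b : bool) (i j : km_index V) (x y v : AA).

(* The sign of a vectorial chamber is a boolean, [true] for negative ones. *)
Definition level b i x : R := (-1) ^+ b * pairing (rsroot R i) x.

Lemma levelD b i x y : level b i (x + y) = level b i x + level b i y.
Proof. by rewrite /level pairingDr mulrDr. Qed.
Lemma levelN b i x : level b i (- x) = - level b i x.
Proof. by rewrite /level pairingNr mulrN. Qed.
Lemma levelB b i x y : level b i (x - y) = level b i x - level b i y.
Proof. by rewrite levelD levelN. Qed.
Lemma levelZ b i t x : level b i (t *: x) = t * level b i x.
Proof. by rewrite /level pairingZr mulrCA. Qed.
Lemma level0 b i : level b i 0 = 0.
Proof. by rewrite /level pairing0r mulr0. Qed.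
Lemma level_negb b i x : level (~~ b) i x = - level b i x.
Proof. by rewrite /level signrN mulNr. Qed.

Lemma level_values b (c : km_index V -> R) : exists x, forall i, level b i x = c i.
Proof.
have [x xP] := simple_root_values (fun i => (-1) ^+ b * c i).
by exists x => i; rewrite /level xP mulrA -expr2 sqrr_sign mul1r.
Qed.

Lemma level_srefl b i j x :
  level b j (srefl R i *m x) = level b j x - level b i x * (km_matrix i j)%:~R.
Proof.
rewrite /level /srefl mulmxBl mul1mx pairingDr pairingNr mulrDr mulrN; congr (_ - _).
rewrite -mulrA; congr (_ * _).
have -> : rscoroot R i *m rsroot R i *m x = pairing (rsroot R i) x *: rscoroot R i.
  rewrite -mulmxA [_ *m x]mx11_scalar mul_mx_scalar.
  by rewrite -[X in X *: _]/(pairing _ _).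
by rewrite pairingZr pairing_map_int sroot_scoroot.
Qed.

Lemma level_srefl_self b i x : level b i (srefl R i *m x) = - level b i x.
Proof. by rewrite level_srefl km_diag; lra. Qed.

Lemma pairing_continuous (a : form) : continuous (pairing a : AA -> R).
Proof.
have -> : (pairing a : AA -> R) = fun x => \sum_j a ord0 j * x j ord0.
  by apply/funext => x; rewrite /pairing mxE.
suff h (r : seq 'I_n) : continuous (fun x : AA => \sum_(j <- r) a ord0 j * x j ord0) by exact: h.
elim: r => [|j r IH] x.
  have -> : (fun x : AA => \sum_(j <- [::]) a ord0 j * x j ord0) = cst 0.
    by apply/funext => y; rewrite big_nil.
  exact: cst_continuous.
have -> : (fun x : AA => \sum_(k <- j :: r) a ord0 k * x k ord0) =
    fun x : AA => a ord0 j * x j ord0 + \sum_(k <- r) a ord0 k * x k ord0.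
  by apply/funext => y; rewrite big_cons.
have cj : (fun y : AA => y j ord0) @ x --> x j ord0 by apply: coord_continuous.
exact: cvgD (cvgM (cvg_cst (a ord0 j)) cj) (IH x).
Qed.

Lemma level_continuous b i : continuous (level b i).
Proof.
suff lx (x : AA) : level b i @ x --> level b i x by move=> x; apply: lx.
have px : (pairing (rsroot R i) : AA -> R) @ x --> pairing (rsroot R i) x.
  exact: pairing_continuous.
exact: cvgM (cvg_cst ((-1) ^+ b : R)) px.
Qed.

Lemma near_level b i c x : c < level b i x -> \forall y \near x, c < level b i y.
Proof. by move=> cx; have := @level_continuous b i x _ (lt_nbhsr cx). Qed.

Lemma near_line x v (U : set AA) : nbhs x U ->
  exists2 t : R, 0 < t & forall s, 0 <= s <= t -> U (x + s *: v).
Proof.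
move=> xU; have : \forall s \near (0 : R), U (x + s *: v).
  have : (fun s : R => x + s *: v) @ (0 : R) --> x + 0 *: v.
    exact: cvgD (cvg_cst x) (cvgZ cvg_id (cvg_cst v)).
  by rewrite scale0r addr0; apply.
move=> /nbhs_ballP[t /= t0 tU]; exists (t / 2); first by rewrite divr_gt0.
move=> s /andP[s0 st]; apply: tU; rewrite /ball /= sub0r normrN ger0_norm //.
by rewrite (le_lt_trans st) // ltr_pdivrMr // ltr_pMr // ltr1n.
Qed.

End Levels.

(** * The Weyl group and the affine Weyl group *)

Section WeylGroup.
Variables (R : realType) (V : vectorial_datum).
Local Notation n := (yrank V).
Local Notation AA := 'cV[R]_n.
Local Notation weyl := (@weyl R V).
Local Notation srefl := (@srefl R V).
Local Notation coroot_lattice := (@coroot_lattice R V).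
Local Notation affine_weyl := (@affine_weyl R V).
Implicit Types (i j : km_index V) (x y v q : AA) (w : 'M[R]_n).

Lemma sreflK i : srefl i *m srefl i = 1%:M.
Proof.
rewrite /srefl mulmxBl mul1mx mulmxBr mulmx1; set A := rscoroot R i *m rsroot R i.
suff -> : A *m A = A + A by rewrite opprB addrK subrK.
rewrite {1}/A -mulmxA [rsroot R i *m _]mulmxA.
have -> : rsroot R i *m rscoroot R i = (2 : R)%:M.
  rewrite [LHS]mx11_scalar; congr (_%:M).
  by rewrite -[LHS]/(pairing _ _) pairing_map_int sroot_scoroot km_diag.
by rewrite mul_scalar_mx -scalemxAr scaler_nat mulr2n.
Qed.

Definition word_mx (s : seq (km_index V)) : 'M[R]_n := foldr (fun i w => srefl i *m w) 1%:M s.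

Lemma word_mx_cat s t : word_mx (s ++ t) = word_mx s *m word_mx t.
Proof. by elim: s => [|i s IH] /=; rewrite ?mul1mx // IH mulmxA. Qed.

Lemma word_mx_rev s : word_mx s *m word_mx (rev s) = 1%:M.
Proof.
elim: s => [|i s IH]; first by rewrite /= mul1mx.
by rewrite rev_cons -cats1 word_mx_cat /= mulmx1 !mulmxA -(mulmxA (srefl i)) IH mulmx1 sreflK.
Qed.

Lemma weyl_word w : weyl w -> exists s, w = word_mx s.
Proof.
elim=> {w} [|i|u v _ [s ->] _ [t ->]|u _ [s ->]].
- by exists [::].
- by exists [:: i]; rewrite /= mulmx1.
- by exists (s ++ t); rewrite word_mx_cat.
exists (rev s); have := word_mx_rev s; set A := word_mx s; set B := word_mx _ => AB.
by have [Au _] := mulmx1_unit AB; rewrite -[LHS]mulmx1 -AB mulmxA mulVmx // mul1mx.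
Qed.

Lemma weyl_word_mx s : weyl (word_mx s).
Proof.
by elim: s => [|i s IH] /=; [exact: weyl_1|apply: weyl_mul => //; exact: weyl_srefl].
Qed.

Lemma weyl_unitmx w : weyl w -> w \in unitmx.
Proof. by move=> /weyl_word[s ->]; have /mulmx1_unit[] := word_mx_rev s. Qed.

Lemma rsroot_srefl i j :
  rsroot R i *m srefl j = rsroot R i - (km_matrix j i)%:~R *: rsroot R j.
Proof.
rewrite /srefl mulmxBr mulmx1 mulmxA; congr (_ - _).
by rewrite [rsroot R i *m _]mx11_scalar mul_scalar_mx -[X in X *: _ = _]/(pairing _ _)
  pairing_map_int sroot_scoroot.
Qed.

Lemma weyl_root_lattice w i : weyl w ->
  exists z : km_index V -> int, rsroot R i *m w = \sum_j (z j)%:~R *: rsroot R j.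
Proof.
have base (c : int) k : exists z : km_index V -> int,
    c%:~R *: rsroot R k = \sum_j (z j)%:~R *: rsroot R j.
  exists (fun j => if j == k then c else 0); rewrite (bigD1 k) //= eqxx big1 ?addr0 // => j.
  by move=> /negbTE ->; rewrite scale0r.
move=> /weyl_word[s ->] {w}; elim: s i => [|k s IH] i.
  by have [z zP] := base 1 i; exists z; rewrite /= mulmx1 -zP scale1r.
rewrite /= mulmxA rsroot_srefl mulmxBl -scalemxAl.
have [z ->] := IH i; have [z' ->] := IH k.
exists (fun j => z j - km_matrix k i * z' j); rewrite scaler_sumr -sumrB.
by apply: eq_bigr => j _; rewrite scalerA -scalerBl rmorphB /= rmorphM.
Qed.

Lemma srefl_rscoroot i q : srefl i *m q = q - pairing (rsroot R i) q *: rscoroot R i.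
Proof.
rewrite /srefl mulmxBl mul1mx -mulmxA [rsroot R i *m q]mx11_scalar mul_mx_scalar.
by [].
Qed.

Lemma coroot_lattice_weyl w q : weyl w -> coroot_lattice q -> coroot_lattice (w *m q).
Proof.
move=> /weyl_word[s ->]; elim: s => [|k s IH] /=; first by rewrite mul1mx.
move=> /IH[z zq]; rewrite -mulmxA; set p := word_mx s *m q in zq *.
rewrite srefl_rscoroot zq pairing_map_int.
exists (fun i => z i - (if i == k then pairing (sroot k) (\sum_i z i *: scoroot i) else 0)).
under [in RHS]eq_bigr => i _ do rewrite /= scalerBl.
rewrite sumrB map_mxB; congr (_ - _).
rewrite [in RHS](bigD1 k) //= eqxx [X in _ *: _ + X]big1 ?addr0; last first.
  by move=> i /negbTE ->; rewrite scale0r.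
by rewrite map_mxZ.
Qed.

Lemma coroot_latticeD q q' : coroot_lattice q -> coroot_lattice q' -> coroot_lattice (q + q').
Proof.
move=> [z ->] [z' ->]; exists (fun i => z i + z' i); rewrite -map_mxD -big_split /=.
by congr map_mx; apply: eq_bigr => i _; rewrite scalerDl.
Qed.

Lemma coroot_latticeN q : coroot_lattice q -> coroot_lattice (- q).
Proof.
move=> [z ->]; exists (fun i => - z i); rewrite -map_mxN -sumrN.
by congr map_mx; apply: eq_bigr => i _; rewrite scaleNr.
Qed.

Lemma coroot_lattice0 : coroot_lattice (0 : AA).
Proof. by exists (fun => 0); rewrite big1 ?map_mx0 // => i _; rewrite scale0r. Qed.

Lemma affine_weyl_id : affine_weyl id.
Proof.
exists 1%:M, 0; split; [exact: weyl_1|exact: coroot_lattice0|].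
by apply/funext => x; rewrite /affmap mul1mx addr0.
Qed.

Lemma affine_weyl_linear w : weyl w -> affine_weyl (mulmx w).
Proof.
exists w, 0; split=> //; first exact: coroot_lattice0.
by apply/funext => x; rewrite /affmap addr0.
Qed.

Lemma affine_weyl_comp u u' : affine_weyl u -> affine_weyl u' -> affine_weyl (u \o u').
Proof.
move=> [w [q [wP qP ->]]] [w' [q' [wP' qP' ->]]].
exists (w *m w'), (w *m q' + q); split; first exact: weyl_mul.
  by apply: coroot_latticeD => //; apply: coroot_lattice_weyl.
by apply/funext => x; rewrite /affmap /= mulmxDr mulmxA addrA.
Qed.

Lemma affine_weyl_inv u : affine_weyl u ->
  exists u', [/\ affine_weyl u', cancel u u' & cancel u' u].
Proof.
move=> [w [q [wP qP ->]]]; have wU := weyl_unitmx wP.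
have wVP := weyl_inv wP.
exists (affmap (invmx w) (- (invmx w *m q))); split.
- exists (invmx w), (- (invmx w *m q)); split=> //.
  by apply/coroot_latticeN/coroot_lattice_weyl.
- by move=> x; rewrite /affmap mulmxDr mulmxA mulVmx // mul1mx addrK.
- by move=> x; rewrite /affmap mulmxDr mulmxN !mulmxA mulmxV // !mul1mx subrK.
Qed.

Lemma affine_weyl_injective u : affine_weyl u -> injective u.
Proof. by move=> /affine_weyl_inv[u' [_ uK _]]; apply: can_inj uK. Qed.

Lemma affine_weyl_line u x y t : affine_weyl u ->
  u (x + t *: (y - x)) = u x + t *: (u y - u x).
Proof.
move=> [w [q [_ _ ->]]]; rewrite /affmap mulmxDr -scalemxAr mulmxBr addrAC.
by rewrite [in RHS]opprD [in RHS](addrACA (w *m y)) subrr addr0.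
Qed.

(** On each ray from [p] the map fixes [p] and a second point, hence the whole ray. *)
Lemma affine_weyl_local u (p : AA) (S : set AA) : affine_weyl u -> nbhs p S ->
  (forall x, S x -> u x = x) -> forall x, u x = x.
Proof.
move=> uP pS uS x; have [t t0 tS] := near_line (x - p) pS.
have up : u p = p by apply: uS; apply: nbhs_singleton.
have : u (p + t *: (x - p)) = p + t *: (x - p) by apply/uS/tS; rewrite (ltW t0) lexx.
rewrite affine_weyl_line // up => /addrI /scalerI -/(_ (lt0r_neq0 t0)).
by move=> /addIr.
Qed.

End WeylGroup.

(** * Enclosed sets *)

Section Polyhedra.
Variables (R : realType) (V : vectorial_datum) (L : lmodType R[i]) (g : kac_moody_algebra V L).
Local Notation n := (yrank V).
Local Notation AA := 'cV[R]_n.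
Local Notation form := 'rV[R]_n.
Local Notation Delta := (all_roots g).
Local Notation affine_weyl := (@affine_weyl R V).
Implicit Types (i j : km_index V) (x y v q : AA) (w : 'M[R]_n) (b : bool).

Lemma all_roots_srefl a i : Delta a -> Delta (a *m srefl R i).
Proof.
move=> [z /= [b0 [x bx x0] ->]]; set b := \sum_i _ in b0 bx *.
have [y cy y0] := root_reflection i bx x0.
exists (fun j => z j - (if j == i then pairing b (scoroot i) else 0)) => /=.
set c := \sum_j _; have cE : c = b - pairing b (scoroot i) *: sroot i.
  rewrite /c /b -[X in _ - X](_ : \sum_j (if j == i then pairing b (scoroot i) else 0) *: sroot j = _).
    by rewrite -sumrB; apply: eq_bigr => j _; rewrite scalerBl.
  by rewrite (bigD1 i) //= eqxx big1 ?addr0 // => j /negbTE ->; rewrite scale0r.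
split.
(* If [b = n alpha_i] with [n] the value of [b] at the coroot, then [n = 2 n], so that [b = 0]. *)
- rewrite cE; apply: contraNneq b0 => /eqP; rewrite subr_eq0 => /eqP bE.
  have h : pairing b (scoroot i) = 2 * pairing b (scoroot i).
    by rewrite {1}bE pairingZl sroot_scoroot km_diag mulrC.
  by rewrite bE (_ : pairing b _ = 0) ?scale0r //; lia.
- by exists y; rewrite ?cE.
rewrite cE map_mxB map_mxZ /srefl mulmxBr mulmx1 mulmxA; congr (_ - _).
by rewrite [_ *m rscoroot R i]mx11_scalar mul_scalar_mx -[X in X *: _ = _]/(pairing _ _)
  pairing_map_int.
Qed.

Lemma all_roots_weyl a w : Delta a -> weyl w -> Delta (a *m w).
Proof.
move=> Da /weyl_word[s ->] {w}; elim: s a Da => [|i s IH] a Da /=; first by rewrite mulmx1.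
by rewrite mulmxA; apply/IH/all_roots_srefl.
Qed.

Lemma all_roots_int a : Delta a -> exists c, a = map_mx intr c.
Proof. by move=> [z /= [_ _ ->]]; eexists. Qed.

Lemma simple_all_root b i : Delta ((-1) ^+ b *: rsroot R i).
Proof.
have h_neq0 : cartan g (map_mx intr (scoroot i)) != 0.
  apply/eqP => h0; have : cartan g (map_mx intr (scoroot i)) = cartan g 0 by rewrite linear0.
  move=> /cartan_inj /(congr1 (pairing (map_mx intr (sroot i)))).
  rewrite pairing0r pairing_map_int sroot_scoroot km_diag => /eqP.
  by rewrite intr_eq0.
have simple_neq0 : sroot i != 0.
  apply/eqP => i0; have := sroot_scoroot i i; rewrite i0 pairing0l km_diag.
  by [].
exists (fun j => if j == i then (-1) ^+ b else 0) => /=.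
rewrite (bigD1 i) //= eqxx [X in _ + X]big1 ?addr0; last first.
  by move=> j /negbTE ->; rewrite scale0r.
split; last by rewrite map_mxZ rmorph_sign.
  by case: (b); rewrite ?expr0 ?expr1 ?scale1r ?scaleN1r ?oppr_eq0.
have := bracket_ef g i i; rewrite eqxx => ef.
case: b; rewrite ?expr1 ?expr0 ?scale1r ?scaleN1r.
  exists (chev_f g i); first exact: wt_f.
  by apply: contraNneq h_neq0 => f0; rewrite -ef f0 br0r.
exists (chev_e g i); first exact: wt_e.
by apply: contraNneq h_neq0 => e0; rewrite -ef e0 br0l.
Qed.

(** The sign [s] tells whether the root is positive relative to the sign [b]. The last clause rules
    out roots such as [2 alpha_i], whose walls could lie between those of [alpha_i]. *)
Lemma root_levels a b : Delta a -> exists (s : bool) (c : km_index V -> nat),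
  [/\ forall x, pairing a x = (-1) ^+ s * \sum_j (c j)%:R * level b j x,
      exists j, c j != 0%N &
      forall i, (forall j, j != i -> c j = 0%N) -> c i = 1%N].
Proof.
move=> [z /= [b0 [x bx x0] ->]].
have [w [w0 wE w1]] := root_word bx x0 b0.
have formE y : pairing (map_mx intr (word_weight w)) y =
    (-1) ^+ b * \sum_j (count_mem j w)%:R * level b j y.
  rewrite word_weightE map_mx_sum pairing_suml mulr_sumr; apply: eq_bigr => j _.
  by rewrite map_mxZ pairingZl /level mulrCA signrMK.
pose s := if \sum_i z i *: sroot i == word_weight w then b else ~~ b.
exists s, (fun j => count_mem j w); split.
- move=> y; rewrite /s; case: eqP => [-> //|ne]; case: wE => [//|->].
  by rewrite map_mxN pairingNl formE signrN mulNr.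
- by case: w w0 {wE w1 formE s} => [//|j w] _; exists j; rewrite /= eqxx.
move=> i ci; have wi : all (pred1 i) w.
  apply/allP => j jw /=; apply: contraTT jw => /ci /eqP.
  by rewrite -leqn0 leqNgt -has_count has_pred1.
by rewrite -(w1 i wi); apply/eqP; rewrite -all_count.
Qed.

(** The sets that generate enclosures. Their constants are integers, which is what prevents
    branching between consecutive walls. *)
Definition polyhedron (k : form -> option int) : set AA :=
  \bigcap_(a in Delta) halfspace a (k a).

Definition is_polyhedron (P : set AA) := exists k, P = polyhedron k.

Lemma is_polyhedronT : is_polyhedron setT.
Proof. by exists (fun => None); apply/seteqP; split. Qed.

Lemma is_polyhedron_halfspace a m : Delta a -> is_polyhedron (halfspace a (Some m)).
Proof.
move=> Da; exists (fun a' => if a' == a then Some m else None).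
apply/seteqP; split=> [x ax a' _|x /(_ a Da)]; last by rewrite eqxx.
by case: eqP => [->|].
Qed.

Lemma is_polyhedronI P P' : is_polyhedron P -> is_polyhedron P' -> is_polyhedron (P `&` P').
Proof.
move=> [k ->] [k' ->].
exists (fun a => match k a, k' a with
  | Some m, Some m' => Some (Num.min m m') | None, o => o | o, None => o end).
have key (a : form) (x : AA) (m m' : int) :
    0 <= pairing a x + (Num.min m m')%:~R <->
    0 <= pairing a x + m%:~R /\ 0 <= pairing a x + m'%:~R.
  have [mm|mm] := leP m m'.
    have h : m%:~R <= m'%:~R :> R by rewrite ler_int.
    by split=> [?|[]//]; split=> //; lra.
  have h : m'%:~R < m%:~R :> R by rewrite ltr_int.
  by split=> [?|[]//]; split=> //; lra.
apply/seteqP; split=> x.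
  move=> [xk xk'] a Da; have := xk a Da; have := xk' a Da; rewrite /halfspace /=.
  by case: (k a) => [m|]; case: (k' a) => [m'|] // h h'; apply/key.
by move=> xk; split=> a Da; have := xk a Da; rewrite /halfspace /=;
  case: (k a) => [m|]; case: (k' a) => [m'|] // /key [].
Qed.

Lemma is_polyhedron_level b i (m : int) : is_polyhedron [set x | m%:~R <= level b i x].
Proof.
have [k kE] := is_polyhedron_halfspace (- m) (simple_all_root b i); exists k; rewrite -kE.
apply/seteqP; split=> x; rewrite /halfspace /= /level -pairingZl rmorphN; by rewrite subr_ge0.
Qed.

Lemma is_polyhedron_forall (J : finType) (P : J -> set AA) :
  (forall l, is_polyhedron (P l)) -> is_polyhedron [set x | forall l, P l x].
Proof.
move=> Pj; suff h (r : seq J) : is_polyhedron [set x | forall l, l \in r -> P l x].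
  have := h (enum J); congr is_polyhedron; apply/seteqP; split=> x xP j //.
  by apply: xP; rewrite mem_enum.
elim: r => [|j r IH].
  by have := is_polyhedronT; congr is_polyhedron; apply/seteqP; split.
have := is_polyhedronI (Pj j) IH; congr is_polyhedron; apply/seteqP; split=> x.
  by move=> [xj xr] k; rewrite inE => /orP[/eqP -> //|]; apply: xr.
by move=> xr; split=> [|k kr]; apply: xr; rewrite inE ?eqxx ?kr ?orbT.
Qed.

(** Roots are integral on the coroot lattice, so the translation part shifts each constant by an
    integer; [Num.floor] merely reads that real number as an integer. *)
Lemma polyhedron_image P u : is_polyhedron P -> affine_weyl u -> is_polyhedron (u @` P).
Proof.
move=> [k ->] [w [q [wP [z qE] ->]]].
have wU := weyl_unitmx wP.
exists (fun a => omap (fun m => m - Num.floor (pairing a q)) (k (a *m w))).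
have key a x m : Delta a ->
    pairing a (w *m x + q) + (m - Num.floor (pairing a q))%:~R = pairing (a *m w) x + m%:~R.
  move=> Da; have [c aE] := all_roots_int Da.
  rewrite pairingDr pairing_mulmx; have -> : pairing a q = (pairing c (\sum_i z i *: scoroot i))%:~R.
    by rewrite aE qE pairing_map_int.
  by rewrite intrKfloor rmorphB /=; ring.
apply/seteqP; split=> [_ [x xk <-] a Da|y yk].
  have := xk _ (all_roots_weyl Da wP); rewrite /halfspace /affmap /=.
  by case: (k _) => [m|] //=; rewrite key.
exists (invmx w *m (y - q)); last by rewrite /affmap mulmxA mulmxV // mul1mx subrK.
move=> a Da; have Da' := all_roots_weyl Da (weyl_inv wP).
have := yk _ Da'; rewrite /halfspace /= -mulmxA mulVmx // mulmx1.
case: (k a) => [m|] //=.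
have {1}-> : y = w *m (invmx w *m (y - q)) + q by rewrite mulmxA mulmxV // mul1mx subrK.
by rewrite key // -mulmxA mulVmx // mulmx1.
Qed.

Lemma polyhedron_convex P x y t : is_polyhedron P -> P x -> P y -> 0 <= t <= 1 -> P (x + t *: (y - x)).
Proof.
move=> [k ->] xk yk /andP[t0 t1] a Da; have := xk a Da; have := yk a Da; rewrite /halfspace /=.
case: (k a) => [m|] //; rewrite pairingDr pairingZr pairingDr pairingNr => h h'.
have := mulr_ge0 t0 h; have : 0 <= (1 - t) * (pairing a x + m%:~R) by rewrite mulr_ge0 ?subr_ge0.
lra.
Qed.

Lemma polyhedron_recession P x y u : is_polyhedron P ->
  (forall t, 0 <= t -> P (x + t *: u)) -> P y -> P (y + u).
Proof.
move=> [k ->] xk yk a Da; have := yk a Da; have := fun t t0 => xk t t0 a Da; rewrite /halfspace /=.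
case: (k a) => [m|] // h; rewrite pairingDr => h'.
suff : 0 <= pairing a u by lra.
rewrite leNgt; apply/negP => u0.
pose c := pairing a x + m%:~R; have c0 : 0 <= c by have := h 0 (lexx _); rewrite scale0r addr0.
(* At this parameter the affine form equals [-1] on the ray, which is excluded. *)
have t0 : 0 <= (c + 1) / - pairing a u by apply: divr_ge0; lra.
have := h _ t0; rewrite pairingDr pairingZr invrN mulrN mulNr divfK ?lt_eqF //.
rewrite /c; lra.
Qed.

Lemma polyhedron_limit P y u s : is_polyhedron P -> 0 < s ->
  (forall r, 0 < r <= s -> P (y + r *: u)) -> P y.
Proof.
move=> [k ->] s0 hP a Da; have := fun r r0 => hP r r0 a Da; rewrite /halfspace /=.
case: (k a) => // m am; rewrite leNgt; apply/negP => y0.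
pose c := pairing a y + m%:~R; pose q := `|pairing a u| + 1.
have q0 : 0 < q by rewrite ltr_wpDl.
pose r := Num.min s (- c / (2 * q)).
have r0 : 0 < r by rewrite lt_min s0 divr_gt0 ?oppr_gt0 // mulr_gt0.
have rs : r <= s by rewrite ge_min lexx.
have rc : r * q <= - c / 2.
  have : r <= - c / (2 * q) by rewrite ge_min lexx orbT.
  by rewrite ler_pdivlMr ?mulr_gt0 // => h'; lra.
have := am r; rewrite r0 rs => /(_ isT); rewrite pairingDr pairingZr.
have : r * pairing a u <= r * q.
  by rewrite ler_wpM2l ?(ltW r0) // /q; have := ler_norm (pairing a u); lra.
by rewrite /c in rc *; rewrite /c in y0; lra.
Qed.

End Polyhedra.

(** * No branching between consecutive walls *)

Section Regions.
Variables (R : realType) (V : vectorial_datum) (L : lmodType R[i]) (g : kac_moody_algebra V L).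
Local Notation n := (yrank V).
Local Notation AA := 'cV[R]_n.
Local Notation Delta := (all_roots g).
Implicit Types (i j : km_index V) (x y z : AA) (b : bool).

(* The reflection r_i preserves the set of roots, whence a bound of the i-th
   coefficient of a positive root, other than alpha_i, by the other ones. *)
Lemma root_coefficient_bound a b i (c : km_index V -> nat) j : Delta a ->
  (forall x, pairing a x = \sum_k (c k)%:R * level b k x) -> j != i -> c j != 0%N ->
  (c i)%:R <= \sum_(k | k != i) (c k)%:R * - (km_matrix i k)%:~R :> R.
Proof.
move=> Da aE ji cj.
have aE' x : pairing (a *m srefl R i) x =
    \sum_k (c k)%:R * (level b k x - level b i x * (km_matrix i k)%:~R).
  by rewrite -pairing_mulmx aE; apply: eq_bigr => k _; rewrite level_srefl.
have [s [c' [c'E _ _]]] := root_levels b (all_roots_srefl i Da).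
have dirac (k : km_index V) : exists x : AA, forall l, level b l x = (l == k)%:R.
  exact: level_values.
have sum_dirac (f : km_index V -> R) k (F : km_index V -> R) :
    (forall l, F l = (l == k)%:R) -> \sum_l f l * F l = f k.
  move=> FE; rewrite (bigD1 k) //= FE eqxx mulr1 big1 ?addr0 // => l lk.
  by rewrite FE (negbTE lk) mulr0.
(* The reflection keeps the coefficient of [j], which is positive, so the reflected root is
   positive. The bound says that its [i]-th coefficient is nonnegative. *)
have s0 : s = false.
  have [x xE] := dirac j; have := c'E x; rewrite aE'.
  have xi : level b i x = 0 by rewrite xE eq_sym (negbTE ji).
  rewrite (sum_dirac (fun k => (c k)%:R) j); last by move=> l; rewrite xi xE mul0r subr0.
  rewrite (sum_dirac (fun k => (c' k)%:R) j) //.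
  case: s {c'E} => //; rewrite expr1 mulN1r => h; have : (c j)%:R <= 0 :> R by rewrite h oppr_le0.
  by rewrite lern0 (negbTE cj).
have [x xE] := dirac i; have := c'E x; rewrite s0 expr0 mul1r (sum_dirac _ i) // aE'.
have -> : \sum_k (c k)%:R * (level b k x - level b i x * (km_matrix i k)%:~R) =
    (c i)%:R - \sum_k (c k)%:R * (km_matrix i k)%:~R.
  under eq_bigr => k _ do rewrite !xE eqxx mul1r mulrBr.
  by rewrite sumrB (sum_dirac _ i).
rewrite (bigD1 i) //= km_diag => h; have := ler0n R (c' i); rewrite -h.
under [in X in _ -> _ <= X]eq_bigr => k _ do rewrite mulrN.
rewrite sumrN; lra.
Qed.

(** Since [P] contains a deep sector, its finite constants concern only positive roots. For
    [alpha_i] the constraint holds at [z], below level [m + 1], so by integrality it holds from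
    level [m] on. For another root, passing from [z] to [y] loses at most its [i]-th coefficient,
    and [root_coefficient_bound] lets a gain of [K] on each other level compensate. *)
Lemma polyhedron_region P b i (m : int) z : is_polyhedron g P ->
  (exists M, forall x, (forall j, M <= level b j x) -> P x) -> P z -> level b i z < (m + 1)%:~R ->
  exists M, forall y, m%:~R <= level b i y -> (forall j, j != i -> M <= level b j y) -> P y.
Proof.
move=> [k ->] [M0 PM0] zk zm.
pose K : R := \sum_j `|(km_matrix i j)%:~R|.
have K0 : 0 <= K by apply: sumr_ge0.
pose M : R := K + \sum_j `|level b j z|; exists M => y ym yM a Da.
have Mz j : K <= M - level b j z.
  have : `|level b j z| <= \sum_j `|level b j z| by rewrite (bigD1 j) //= lerDl sumr_ge0.
  have := ler_norm (level b j z); rewrite /M; lra.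
have := zk a Da; have [s [c [aE [j0 cj0] c1]]] := root_levels b Da.
rewrite /halfspace /=; case ka: (k a) => [k0|] // za.
have s0 : s = false.
  (* At the point whose levels all equal [t], which lies in [P], a negative root is at most [- t],
     too small for the constant [k0]. *)
  case: s aE => // aE; pose t := `|M0| + `|k0%:~R| + 1 : R.
  have t0 : 0 < t by rewrite ltr_wpDl ?addr_ge0.
  have [x xt] := @level_values R V b (fun => t).
  have xM j : M0 <= level b j x.
    by rewrite xt /t; have := ler_norm M0; have := normr_ge0 (k0%:~R : R); lra.
  have := PM0 x xM a Da; rewrite /halfspace ka /= aE expr1 mulN1r.
  under eq_bigr => j _ do rewrite xt.
  rewrite -mulr_suml => h; have c_ge1 : 1 <= \sum_j (c j)%:R :> R.
    by rewrite (bigD1 j0) //= ler_wpDr ?sumr_ge0 // ler1n lt0n.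
  have : t <= (\sum_j (c j)%:R) * t by rewrite ler_pMl.
  have := ler_norm (k0%:~R : R); have := normr_ge0 M0; rewrite /t in h *; lra.
have {}aE x : pairing a x = \sum_j (c j)%:R * level b j x by rewrite aE s0 expr0 mul1r.
have [j /andP[ji cj]|ci] := pickP (fun j => (j != i) && (c j != 0%N)); last first.
  have c0 j : j != i -> c j = 0%N by move=> ji; have := ci j; rewrite ji /= => /negbFE/eqP.
  have {}aE x : pairing a x = level b i x.
    by rewrite aE (bigD1 i) //= (c1 i c0) mul1r big1 ?addr0 // => j /c0 ->; rewrite mul0r.
  move: za; rewrite !aE => za; have : (- k0)%:~R < (m + 1)%:~R :> R by rewrite rmorphN /=; lra.
  rewrite ltr_int ltzD1 -(ler_int R) rmorphN /=; lra.
have cb := root_coefficient_bound Da aE ji cj.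
suff : 0 <= pairing a y - pairing a z by lra.
rewrite !aE -sumrB (bigD1 i) //=.
have : \sum_(k | k != i) (c k)%:R * - (km_matrix i k)%:~R <= \sum_(l | l != i)
    ((c l)%:R * level b l y - (c l)%:R * level b l z) :> R.
  apply: ler_sum => l li; rewrite -mulrBr ler_wpM2l //.
  have : `|(km_matrix i l)%:~R| <= K by rewrite /K (bigD1 l) //= lerDl sumr_ge0.
  have := ler_norm (- (km_matrix i l)%:~R : R); rewrite normrN.
  have := Mz l; have := yM l li; lra.
have : - (c i)%:R <= (c i)%:R * level b i y - (c i)%:R * level b i z.
  rewrite -mulrBr -mulrN1 ler_wpM2l //; move: zm ym; rewrite rmorphD /=; lra.
lra.
Qed.

End Regions.

(** * Vectorial faces and sphericity *)

Section ConesAndGerms.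
Variables (R : realType) (V : vectorial_datum) (L : lmodType R[i]) (g : kac_moody_algebra V L).
Local Notation n := (yrank V).
Local Notation AA := 'cV[R]_n.
Local Notation index := (km_index V).
Local Notation tits_cone := (@tits_cone R V).
Implicit Types (i j : index) (x y z u v : AA) (b : bool) (J : {set index}) (P U E : set AA).

Definition cone b J : set AA :=
  [set x | forall i, if i \in J then level b i x = 0 else 0 < level b i x].

Lemma fund_faceE J : fund_face J = cone false J.
Proof.
apply/seteqP; split=> x xJ i; have := xJ i; rewrite /level expr0 mul1r; case: ifP => _ //.
  by move/eqP.
by move=> ->.
Qed.

Lemma coneN b J : cone (~~ b) J = [set - x | x in cone b J].
Proof.
apply/seteqP; split=> [x xJ|_ [x xJ <-] i]; last first.
  by have := xJ i; rewrite levelN level_negb opprK.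
exists (- x); last by rewrite opprK.
by move=> i; have := xJ i; rewrite levelN level_negb.
Qed.

Definition sector_cone b : set AA := [set x | forall i, 0 < level b i x].
Definition panel_cone b i : set AA :=
  [set x | level b i x = 0 /\ forall j, j != i -> 0 < level b j x].
Definition central_cone : set AA := [set x | forall i, level false i x = 0].

Lemma sector_coneE b : sector_cone b = cone b finset.set0.
Proof. by apply/seteqP; split=> x xC i; have := xC i; rewrite finset.inE. Qed.

Lemma panel_coneE b i : panel_cone b i = cone b [set i]%SET.
Proof.
apply/seteqP; split=> [x [xi xj] j|x xC].
  by rewrite finset.inE; case: eqVneq => [->|/xj].
split=> [|j /negbTE ji]; first by have := xC i; rewrite finset.inE eqxx.
by have := xC j; rewrite finset.inE ji.
Qed.

Lemma central_coneE b : central_cone = cone b [set: index]%SET.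
Proof.
case: b; last by apply/seteqP; split=> x xC i; have := xC i; rewrite finset.inE.
rewrite -[true]/(~~ false) coneN; apply/seteqP; split=> [x xC|_ [x xC <-] i].
  by exists (- x); rewrite ?opprK // => i; rewrite finset.inE levelN xC oppr0.
by rewrite levelN; have := xC i; rewrite finset.inE => ->; rewrite oppr0.
Qed.

Lemma fund_chamberE : @fund_chamber R V = sector_cone false.
Proof.
by apply/seteqP; split=> x xC i; have := xC i; rewrite /level expr0 mul1r.
Qed.

Lemma sector_coneN b : sector_cone (~~ b) = [set - x | x in sector_cone b].
Proof. by rewrite !sector_coneE coneN. Qed.

Lemma vect_face_cone w b J : weyl w -> vect_face [set w *m x | x in cone b J].
Proof.
move=> wP; exists J; rewrite fund_faceE; exists w => //; case: b; [right|by left].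
rewrite -[true]/(~~ false) coneN image_comp; congr image.
by apply/funext => x /=; rewrite mulmxN.
Qed.

Lemma image_mul1 (S : set AA) : [set (1%:M : 'M[R]_n) *m x | x in S] = S.
Proof.
apply/seteqP; split=> [_ [x Sx <-]|x Sx]; first by rewrite mul1mx.
by exists x; rewrite ?mul1mx.
Qed.

Lemma vect_face_cone1 b J : vect_face (cone b J).
Proof. by rewrite -[cone b J]image_mul1; apply: vect_face_cone; exact: weyl_1. Qed.

Lemma vect_chamber_cone (F : set AA) : vect_chamber F ->
  exists w b, weyl w /\ F = [set w *m x | x in sector_cone b].
Proof.
rewrite /vect_chamber fund_chamberE => -[w wP [->|->]]; first by exists w, false.
exists w, true; split=> //; rewrite -[true]/(~~ false) sector_coneN image_comp; congr image.
by apply/funext => x /=; rewrite mulmxN.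
Qed.

Lemma near_sector_cone b x : sector_cone b x -> nbhs x (sector_cone b).
Proof.
move=> xC; have : \forall y \near x, forall i, 0 < level b i y; last by [].
apply: (@filter_forall _ _ _ (nbhs x) (nbhs_filter x)) => i; exact: near_level.
Qed.

Lemma unit_levels b : exists v : AA, forall i, level b i v = 1.
Proof. exact: level_values. Qed.

Lemma unit_panel b i : exists v : AA, forall j, level b j v = (j != i)%:R.
Proof. exact: level_values. Qed.

Lemma unit_panel_cone b i v : (forall j, level b j v = (j != i)%:R) -> panel_cone b i v.
Proof. by move=> vE; split=> [|j ji]; rewrite vE ?eqxx ?ji. Qed.

Lemma tits_cone_level x : (forall i, 0 <= level false i x) -> tits_cone x.
Proof.
move=> x0; exists 1%:M; first exact: weyl_1.
exists x; last by rewrite mul1mx.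
rewrite fund_chamberE => U xU.
have [v vE] := unit_levels false; have [t t0 tU] := near_line v xU.
exists (x + t *: v); split; last by apply: tU; rewrite lexx ltW.
by move=> i; rewrite levelD levelZ vE mulr1 ltr_wpDl.
Qed.

Lemma tits_cone_srefl i x : tits_cone (srefl R i *m x) -> tits_cone x.
Proof.
move=> [w wP [y yC e]]; exists (srefl R i *m w); first by apply: weyl_mul => //; exact: weyl_srefl.
by exists y; rewrite // -mulmxA e mulmxA sreflK mul1mx.
Qed.

Lemma level_sign b i x : level false i ((-1) ^+ b *: x) = level b i x.
Proof. by rewrite /level pairingZr expr0 mul1r. Qed.

Lemma pm_tits_interiorP b x : interior tits_cone ((-1) ^+ b *: x) -> @pm_tits_interior R V x.
Proof. by case: b; rewrite ?expr1 ?expr0 ?scaleN1r ?scale1r => h; [right|left]. Qed.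

Lemma spherical_sector b : spherical (sector_cone b).
Proof.
have [v vE] := unit_levels b; exists v; split; first by move=> i; rewrite vE.
apply: (@pm_tits_interiorP b).
have : sector_cone false ((-1) ^+ b *: v) by move=> i; rewrite level_sign vE.
move/near_sector_cone; apply: filterS => y yC; apply: tits_cone_level => i.
exact/ltW/yC.
Qed.

Lemma near_level_bounds b i x c d : c < level b i x < d -> \forall y \near x, c < level b i y < d.
Proof.
move=> /andP[cx xd].
have dx : - d < level (~~ b) i x by rewrite level_negb ltrN2.
apply: filterS2 (near_level cx) (near_level dx) => y cy.
by rewrite level_negb ltrN2 cy.
Qed.

(* Near a point of the open panel, either y or r_i y lies in the closed chamber. *)
Lemma spherical_panel b i : spherical (panel_cone b i).
Proof.
have [v vE] := unit_panel b i; exists v; split; first exact: unit_panel_cone.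
apply: (@pm_tits_interiorP b); set x := _ *: v.
have xE j : level false j x = (j != i)%:R by rewrite level_sign vE.
pose K : R := \sum_j `|(km_matrix i j)%:~R|; have K0 : 0 <= K by apply: sumr_ge0.
(* The reflection changes the other levels by at most [e * K <= 1/2], and these levels stay above
   1/2. *)
pose e := (2 * (1 + K))^-1; have e0 : 0 < e by rewrite invr_gt0; lra.
have near_i : \forall y \near x, - e < level false i y < e.
  by apply: near_level_bounds; rewrite xE eqxx oppr_lt0 e0.
have near_j : \forall y \near x, forall j, j != i -> 2^-1 < level false j y.
  apply: (@filter_forall _ _ _ (nbhs x) (nbhs_filter x)) => j; case: (eqVneq j i) => ji; first by apply: filterE.
  have : 2^-1 < level false j x by rewrite xE ji /= invf_lt1 ?ltr1n.
  by move/near_level; apply: filterS.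
apply: filterS2 near_i near_j => y /andP[yi1 yi2] yj.
have [y0|/ltW y0] := lerP 0 (level false i y).
  apply: tits_cone_level => j; have [->//|/yj] := eqVneq j i; lra.
apply/(@tits_cone_srefl i)/tits_cone_level => j; have [->|ji] := eqVneq j i.
  by rewrite level_srefl_self oppr_ge0.
rewrite level_srefl; have := yj j ji.
have : `|level false i y * (km_matrix i j)%:~R| <= e * K.
  rewrite normrM; apply: ler_pM => //; first by rewrite ler_norml (ltW yi1) (ltW yi2).
  by rewrite /K (bigD1 j) //= lerDl sumr_ge0.
have : e * K <= 2^-1.
  by rewrite /e invfM -mulrA ler_piMr ?invr_ge0 // mulrC ler_pdivrMr ?mul1r; lra.
have := ler_norm (level false i y * (km_matrix i j)%:~R); lra.
Qed.

End ConesAndGerms.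

(** * Germs of chimneys described by levels *)

Section Germs.
Variables (R : realType) (V : vectorial_datum) (L : lmodType R[i]) (g : kac_moody_algebra V L).
Local Notation n := (yrank V).
Local Notation AA := 'cV[R]_n.
Local Notation index := (km_index V).
Local Notation is_polyhedron := (is_polyhedron g).
Local Notation sector_cone := (@sector_cone R V).
Local Notation panel_cone := (@panel_cone R V).
Local Notation central_cone := (@central_cone R V).
Implicit Types (i j : index) (x y z u v : AA) (b : bool) (P U E : set AA).

Lemma level_bound b x : exists2 M : R, 0 <= M & forall j, `|level b j x| <= M.
Proof.
exists (\sum_j `|level b j x|); first exact: sumr_ge0.
by move=> j; rewrite (bigD1 j) //= lerDl sumr_ge0.
Qed.

Definition deep b (M : R) : set AA := [set x | forall j, M <= level b j x].
Definition deep_panel b i (m : int) (M : R) : set AA :=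
  [set x | level b i x = m%:~R /\ forall j, j != i -> M <= level b j x].

Definition deep_germ b : set_system AA := [set E | exists M, deep b M `<=` E].
Definition panel_germ b i m : set_system AA := [set E | exists M, deep_panel b i m M `<=` E].

(* The sets of the face F(x, C) need not contain x. The filter of their enclosures does, and
   it is a solid chimney, of direction the smallest vectorial face. *)
Definition closed_chamber x b : set_system AA :=
  [set E | exists P U, [/\ is_polyhedron P, nbhs x U, U `&` translate x (sector_cone b) `<=` P & P `<=` E]].

Lemma enclosureP (F : set_system AA) E : enclosure g F E <->
  exists2 P, is_polyhedron P & F P /\ P `<=` E.
Proof.
split=> [[k [FP PE]]|[_ [k ->] [FP PE]]]; last by exists k.
by exists (polyhedron g k) => //; exists k.
Qed.

Lemma face_at_polyhedron x (Fv : set AA) P U : is_polyhedron P -> nbhs x U ->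
  U `&` translate x Fv `<=` P -> face_at g x Fv P.
Proof.
move=> [k ->] xU UP; exists k, (fun => None), U; split=> // y; first by move=> yk a Da; have [] := yk a Da.
by move=> /UP yk a Da; split; first exact: yk.
Qed.

Lemma face_at_sub x (Fv : set AA) E : face_at g x Fv E ->
  exists2 U, nbhs x U & U `&` translate x Fv `<=` E.
Proof. by move=> [k [k' [U [xU PE UP]]]]; exists U => // y /UP /PE. Qed.

Lemma face_at_up x (Fv : set AA) E E' : E `<=` E' -> face_at g x Fv E -> face_at g x Fv E'.
Proof. by move=> sE [k [k' [U [xU PE UP]]]]; exists k, k', U; split=> // y /PE /sE. Qed.

Lemma is_polyhedron_deep b (m : int) : is_polyhedron (deep b m%:~R).
Proof. by apply: is_polyhedron_forall => j; apply: is_polyhedron_level. Qed.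

Lemma is_polyhedron_deep_panel b i (m m' : int) : is_polyhedron (deep_panel b i m m'%:~R).
Proof.
have -> : deep_panel b i m m'%:~R = [set x | m%:~R <= level b i x] `&`
   [set x | (- m)%:~R <= level (~~ b) i x] `&`
   [set x | forall j, (if j == i then setT else [set x | m'%:~R <= level b j x]) x].
  apply/seteqP; split=> x /=.
    move=> [xi xj]; rewrite level_negb xi rmorphN; split; first by split.
    by move=> j; case: eqVneq => // /xj.
  move=> [[h h'] xj]; split.
    by apply/eqP; rewrite eq_le h andbT; move: h'; rewrite level_negb rmorphN lerN2.
  by move=> j /negbTE ji; have := xj j; rewrite ji.
apply: is_polyhedronI; first by apply: is_polyhedronI; apply: is_polyhedron_level.
apply: is_polyhedron_forall => j; case: eqP => _; last exact: is_polyhedron_level.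
exact: is_polyhedronT.
Qed.

(** A change of base point only changes the depth, so the germ forgets [x]. *)
Lemma sector_germ_atE x b : sector_germ_at x (sector_cone b) = deep_germ b.
Proof.
apply/seteqP; split=> E.
  move=> [u _ uE]; have [M M0 MP] := level_bound b (x + u).
  exists (M + 1) => y yM; apply: uE; exists (y - (x + u)); last by rewrite addrC subrK.
  by move=> j; rewrite levelB; have := MP j; have := ler_norm (level b j (x + u)); have := yM j; lra.
move=> [M ME]; have [u uE] := @level_values R V b (fun j => `|M - level b j x| + 1).
exists u => [|_ [y yC <-]].
  by apply: subset_closure => j; rewrite uE; have := normr_ge0 (M - level b j x); lra.
apply: ME => j; rewrite !levelD uE; have := yC j; have := ler_norm (M - level b j x); lra.
Qed.

(** Recognizes the sector-germ as the germ of a chimney that is both splayed and solid, so that it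
    may enter (MA3) and (MA4) on either side. *)
Lemma sector_chimney_germ x b :
  chimney_germ g (face_at g x (sector_cone b)) (sector_cone b) = deep_germ b.
Proof.
apply/seteqP; split=> E.
  move=> [u uC /enclosureP[P _ [[E' FE' sE'] PE]]].
  have [U xU UE'] := face_at_sub FE'.
  have [v vE] := @unit_levels R V b; have [t t0 tU] := near_line v xU.
  have e'E : E' (x + t *: v + u).
    apply: UE'; split; first by apply: tU; rewrite lexx ltW.
    by exists (t *: v) => // j; rewrite levelZ vE mulr1.
  have [M M0 MP] := level_bound b (x + t *: v + u).
  exists (M + 1) => y yM; apply/PE/sE'; exists (x + t *: v + u) => //.
  exists (y - (x + t *: v + u)); last by rewrite addrC subrK.
  move=> j; rewrite levelB; have := MP j; have := ler_norm (level b j (x + t *: v + u)).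
  by have := yM j; lra.
move=> [M ME]; pose m := Num.ceil M; have Mm : M <= m%:~R by apply: ceil_ge.
have [N N0 NP] := level_bound b x; pose l := Num.floor (- N); have lN : l%:~R <= - N by apply: floor_le.
have [u uE] := @level_values R V b (fun j => `|m%:~R - l%:~R| + 1).
exists u; first by apply: subset_closure => j; rewrite uE; have := normr_ge0 (m%:~R - l%:~R : R); lra.
apply/enclosureP; exists (deep b m%:~R); first exact: is_polyhedron_deep.
split; last by move=> y ym; apply: ME => j; have := ym j; lra.
exists (deep b (l%:~R + (`|m%:~R - l%:~R| + 1))).
  apply: (@face_at_up _ _ (deep b l%:~R)).
    by move=> y yl j /=; rewrite levelD uE; have := yl j; lra.
  apply: (face_at_polyhedron (is_polyhedron_deep _ _) (U := setT)); first exact: filterT.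
  move=> _ [_ [v vC <-]] j; rewrite levelD; have := vC j; have := NP j.
  by have := ler_norm (- level b j x); rewrite normrN; lra.
move=> _ [y yE [v vC <-]] j; rewrite levelD; have := yE j; have := vC j.
have := ler_norm (m%:~R - l%:~R : R); lra.
Qed.

Lemma polyhedron_central P x u : is_polyhedron P -> central_cone u -> P x -> P (x + u).
Proof.
move=> [k ->] u0 xP a Da; have := xP a Da; rewrite /halfspace /=; case: (k a) => [m|] //.
have [s [c [aE _ _]]] := root_levels false Da.
rewrite pairingDr (aE u) big1 ?mulr0 ?addr0 // => j _; by rewrite u0 mulr0.
Qed.

Lemma closure_level_eq0 (S : set AA) b i u : (forall v, S v -> level b i v = 0) ->
  closure S u -> level b i u = 0.
Proof.
move=> S0 Su; apply/eqP; apply: contraT; rewrite neq_lt => /orP[u0|u0].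
  have : 0 < level (~~ b) i u by rewrite level_negb oppr_gt0.
  by move/near_level/Su => [v [/S0 v0]]; rewrite level_negb v0 oppr0 ltxx.
by move/near_level/Su: u0 => [v [/S0 v0]]; rewrite v0 ltxx.
Qed.

Lemma closed_chamber_chimney x b :
  chimney g (face_at g x (sector_cone b)) central_cone = closed_chamber x b.
Proof.
apply/seteqP; split=> E.
  move=> /enclosureP[P Ppoly [[E' FE' sE'] PE]]; have [U xU UE'] := face_at_sub FE'.
  exists P, U; split=> // y /UE' E'y; apply: sE'; exists y => //; exists 0; rewrite ?addr0 //.
  by move=> j; rewrite level0.
move=> [P [U [Ppoly xU UP PE]]]; apply/enclosureP; exists P => //; split=> //; exists P.
  exact: face_at_polyhedron xU UP.
by move=> _ [y yP [u u0 <-]]; apply: polyhedron_central.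
Qed.

Lemma closed_chamber_chimney_germ x b :
  chimney_germ g (face_at g x (sector_cone b)) central_cone = closed_chamber x b.
Proof.
apply/seteqP; split=> E; last first.
  rewrite -closed_chamber_chimney => h; exists 0.
    by apply: subset_closure => j; rewrite level0.
  have -> // : (fun y => y + 0) @ face_at g x (sector_cone b) = face_at g x (sector_cone b).
  by apply/funext => S; congr (face_at g x _ _); apply/funext => y; rewrite /= addr0.
move=> [u uC /enclosureP[P Ppoly [[E' FE' sE'] PE]]]; have [U xU UE'] := face_at_sub FE'.
have u0 : central_cone (- u).
  by move=> j; rewrite levelN (@closure_level_eq0 central_cone) ?oppr0 // => v; apply.
exists P, U; split=> // y /UE' E'y; rewrite -[y](addrK u); apply: polyhedron_central => //.
by apply: sE'; exists (y + u) => //; exists 0; rewrite ?addr0 // => j; rewrite level0.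
Qed.

(** Of the base point only its [i]-th level survives at infinity. The integrality of that level
    makes the hyperplane through [y] an enclosed set. *)
Lemma panel_chimney_germ y b i (m : int) : level b i y = m%:~R ->
  chimney_germ g (face_at g y (panel_cone b i)) (panel_cone b i) = panel_germ b i m.
Proof.
move=> ym; apply/seteqP; split=> E.
  move=> [u uC /enclosureP[P _ [[E' FE' sE'] PE]]]; have [U yU UE'] := face_at_sub FE'.
  have [v vE] := @unit_panel R V b i; have [t t0 tU] := near_line v yU.
  have vC : panel_cone b i (t *: v).
    by split=> [|j ji]; rewrite levelZ vE ?eqxx ?mulr0 // ji mulr1.
  have e'E : E' (y + t *: v + u).
    apply: UE'; split; first by apply: tU; rewrite lexx ltW.
    by exists (t *: v).
  have ui : level b i u = 0 by apply: closure_level_eq0 uC => w [].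
  have [M M0 MP] := level_bound b (y + t *: v + u).
  exists (M + 1) => z [zm zM]; apply/PE/sE'; exists (y + t *: v + u) => //.
  exists (z - (y + t *: v + u)); last by rewrite addrC subrK.
  split=> [|j ji]; rewrite levelB.
    by rewrite zm !levelD ui addr0 ym; have [-> _] := vC; rewrite addr0 subrr.
  have := MP j; have := ler_norm (level b j (y + t *: v + u)); have := zM j ji; lra.
move=> [M ME]; pose m' := Num.ceil M; have Mm : M <= m'%:~R by apply: ceil_ge.
have [N N0 NP] := level_bound b y; pose l := Num.floor (- N); have lN : l%:~R <= - N by apply: floor_le.
pose c : R := `|m'%:~R - l%:~R| + 1.
have [u uE] := @level_values R V b (fun j => if j == i then 0 else c).
have c0 : 0 < c by rewrite ltr_wpDl.
exists u; first by apply: subset_closure; split=> [|j /negbTE ji]; rewrite uE ?eqxx ?ji.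
apply/enclosureP; exists (deep_panel b i m m'%:~R); first exact: is_polyhedron_deep_panel.
split; last by move=> z [zm zm']; apply: ME; split=> // j /zm'; lra.
exists (deep_panel b i m (l%:~R + c)).
  apply: (@face_at_up _ _ (deep_panel b i m l%:~R)).
    move=> z [zm zl]; split=> [|j ji] /=; rewrite levelD uE; first by rewrite eqxx addr0.
    by rewrite (negbTE ji); have := zl j ji; lra.
  apply: (face_at_polyhedron (is_polyhedron_deep_panel _ _ _ _) (U := setT)); first exact: filterT.
  move=> _ [_ [v [v0 vC] <-]]; split=> [|j ji]; rewrite levelD ?v0 ?addr0 //.
  have := vC j ji; have := NP j.
  by have := ler_norm (- level b j y); rewrite normrN; lra.
move=> _ [z [zm zE] [v [v0 vC] <-]]; split=> [|j ji]; rewrite levelD ?v0 ?addr0 //.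
have := zE j ji; have := vC j ji; have := ler_norm (m'%:~R - l%:~R : R); rewrite /c; lra.
Qed.

Lemma affine_subspace_line (S : set AA) o y (t : R) : affine_subspace S -> 0 < t ->
  S o -> S (o + t *: (y - o)) -> S y.
Proof.
move=> [_ Sline] t0 So St; have := Sline _ _ t^-1 So St.
by rewrite addrAC subrr add0r scalerA mulVf ?lt0r_neq0 // scale1r addrC subrK.
Qed.

Lemma support_open (F : set_system AA) :
  (forall E, F E -> exists p : AA, nbhs p E) -> filter_support F = setT.
Proof.
move=> Fnbhs; apply/seteqP; split=> // y _ S [Sline FS].
have [p pS] := Fnbhs S FS; have [t t0 tS] := near_line (y - p) pS.
apply: (affine_subspace_line Sline t0 (o := p)); first exact: nbhs_singleton.
by apply: tS; rewrite lexx ltW.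
Qed.

(** The support is then the whole space, and only the identity fixes all vectors. *)
Lemma solid_open (F : set_system AA) (Fv : set AA) :
  (forall E, chimney g F Fv E -> exists p : AA, nbhs p E) -> solid g F Fv.
Proof.
move=> Fnbhs; rewrite /solid /= support_open //.
apply: (@sub_finite_set _ _ [set 1%:M]); last exact: finite_set1.
move=> w [_ wP] /=; apply/matrixP => k l.
have := wP 0 (delta_mx l ord0) I I; rewrite subr0 -colE => /matrixP/(_ k ord0).
by rewrite !mxE eqxx andbT => ->.
Qed.

Lemma near_translate x u (S : set AA) : nbhs u S -> nbhs (x + u) (translate x S).
Proof.
move=> uS; have : (fun y : AA => y - x) @ (x + u) --> x + u - x.
  exact: cvgB cvg_id (cvg_cst x).
rewrite [x + u]addrC addrK => h; have hS : nbhs (u + x) [set y | S (y - x)] by exact: h uS.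
apply: filterS hS => y yS.
by exists (y - x) => //; rewrite addrC subrK.
Qed.

Lemma near_sector x b U : nbhs x U -> exists p : AA, nbhs p (U `&` translate x (sector_cone b)).
Proof.
move=> xU; have xU' : nbhs x (interior U) by apply: nbhs_interior.
have [v vE] := @unit_levels R V b; have [t t0 tU] := near_line v xU'.
exists (x + t *: v); apply: filterI; first by apply: tU; rewrite lexx ltW.
by apply/near_translate/near_sector_cone => j; rewrite levelZ vE mulr1.
Qed.

Lemma solid_closed_chamber x b : solid g (face_at g x (sector_cone b)) central_cone.
Proof.
apply: solid_open => E; rewrite closed_chamber_chimney => -[P [U [_ xU UP PE]]].
have [p pU] := near_sector b xU; exists p; apply: filterS pU => y /UP; exact: PE.
Qed.

Lemma solid_sector x b : solid g (face_at g x (sector_cone b)) (sector_cone b).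
Proof.
apply: solid_open => E /enclosureP[P _ [[E' FE' sE'] PE]].
have [U xU UE'] := face_at_sub FE'; have [p /nbhs_singleton pU] := near_sector b xU.
have [v vE] := @unit_levels R V b.
exists (p + v); have vC : nbhs v (sector_cone b) by apply: near_sector_cone => j; rewrite vE.
apply: filterS (near_translate p vC) => _ [w wC <-]; apply/PE/sE'.
by exists p; [exact: UE'|exists w].
Qed.

Lemma near_deep b M x : (forall j, M < level b j x) -> nbhs x (deep b M).
Proof.
move=> xM; have : \forall y \near x, forall j, M < level b j y.
  apply: (@filter_forall _ _ _ (nbhs x) (nbhs_filter x)) => j; exact: near_level.
by apply: filterS => y yM j; apply/ltW.
Qed.

Lemma closed_chamber_up x b E E' : E `<=` E' -> closed_chamber x b E -> closed_chamber x b E'.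
Proof. by move=> sE [P [U [pP xU UP PE]]]; exists P, U; split=> // y /PE /sE. Qed.

Lemma closed_chamberI x b E E' : closed_chamber x b E -> closed_chamber x b E' ->
  closed_chamber x b (E `&` E').
Proof.
move=> [P [U [pP xU UP PE]]] [P' [U' [pP' xU' UP' PE']]]; exists (P `&` P'), (U `&` U').
split; [exact: is_polyhedronI|exact: filterI| |].
  by move=> y [[yU yU'] yC]; split; [exact: UP|exact: UP'].
by move=> y [/PE yE /PE' yE'].
Qed.

(** Directions on the boundary of the cone are allowed: points along them are limits of points of
    the open chamber, and polyhedra are closed. *)
Lemma closed_chamber_line x b E u : closed_chamber x b E -> (forall j, 0 <= level b j u) ->
  exists2 t : R, 0 < t & forall r, 0 <= r <= t -> E (x + r *: u).
Proof.
move=> [P [U [pP xU UP PE]]] u0; have xU' : nbhs x (interior U) by apply: nbhs_interior.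
have [t t0 tU] := near_line u xU'; exists t => // r rt; apply: PE.
have [v vE] := @unit_levels R V b.
have [s s0 sU] := near_line v (open_nbhs_nbhs (conj (@open_interior _ U) (tU r rt))).
apply: (polyhedron_limit (u := v) pP s0) => q /andP[q0 qs]; apply: UP; split.
  by apply: (@interior_subset _ U); apply: sU; rewrite (ltW q0).
exists (r *: u + q *: v); last by rewrite addrA.
move=> j; rewrite levelD !levelZ vE mulr1.
by rewrite ltr_wpDl // mulr_ge0 //; case/andP: rt.
Qed.

Lemma closed_chamber_near x b E (W : set AA) : closed_chamber x b E -> nbhs x W ->
  exists2 p : AA, nbhs p E & nbhs p W.
Proof.
move=> [P [U [_ xU UP PE]]] xW; have [p pUW] := near_sector b (filterI xU xW).
by exists p; apply: filterS pUW => y [[yU yW]] // yC; apply/PE/UP.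
Qed.

End Germs.

(** * A panel and the chamber across it *)

Section PanelsAndChambers.
Variables (R : realType) (V : vectorial_datum) (L : lmodType R[i]) (g : kac_moody_algebra V L).
Local Notation n := (yrank V).
Local Notation AA := 'cV[R]_n.
Local Notation index := (km_index V).
Local Notation is_polyhedron := (is_polyhedron g).
Local Notation sector_cone := (@sector_cone R V).
Local Notation panel_cone := (@panel_cone R V).
Implicit Types (i j : index) (x y z u v : AA) (b : bool) (P U E : set AA).

(** The chamber adjacent to [sector_cone b] across its [i]-th panel. *)
Definition reflected_cone b i : set AA := [set srefl R i *m y | y in sector_cone b].

Lemma near_reflected_cone b i y : sector_cone b y -> nbhs (srefl R i *m y) (reflected_cone b i).
Proof.
move=> yC; set x := srefl R i *m y.
have xE : srefl R i *m x = y by rewrite mulmxA sreflK mul1mx.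
have ri (z : AA) : sector_cone b (srefl R i *m z) -> reflected_cone b i z.
  by move=> rz; exists (srefl R i *m z) => //; rewrite mulmxA sreflK mul1mx.
suff : \forall z \near x, forall j, 0 < level b j (srefl R i *m z).
  by apply: filterS => z; apply: ri.
apply: (@filter_forall _ _ _ (nbhs x) (nbhs_filter x)) => j.
pose a := (-1) ^+ b *: (rsroot R j *m srefl R i).
have aE z : level b j (srefl R i *m z) = pairing a z by rewrite /level pairing_mulmx -pairingZl.
have : 0 < pairing a x by rewrite -aE xE; apply: yC.
move=> ax; have h : nbhs x [set z | 0 < pairing a z] by exact: pairing_continuous (lt_nbhsr ax).
by apply: filterS h => z; rewrite aE.
Qed.

Lemma chamber_reflected x b i : chamber g (face_at g x (reflected_cone b i)).
Proof.
split.
  exists x, (reflected_cone b i); split=> //; rewrite /reflected_cone sector_coneE.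
  by apply: vect_face_cone; apply: weyl_srefl.
apply: support_open => E /face_at_sub[U xU UE].
have [v vE] := @unit_levels R V b.
have xU' : nbhs x (interior U) by apply: nbhs_interior.
have [t t0 tU] := near_line (srefl R i *m v) xU'.
exists (x + t *: (srefl R i *m v)).
have h1 : nbhs (x + t *: (srefl R i *m v)) U by apply: tU; rewrite lexx ltW.
have h2 : nbhs (x + t *: (srefl R i *m v)) (translate x (reflected_cone b i)).
  apply: near_translate; rewrite scalemxAr; apply: near_reflected_cone => j.
  by rewrite levelZ vE mulr1.
by apply: filterS2 h1 h2 => y yU yT; apply: UE.
Qed.

Lemma panel_panel_cone x b i (m : int) : level b i x = m%:~R ->
  panel g (face_at g x (panel_cone b i)).
Proof.
move=> xm; split.
  exists x, (panel_cone b i); split=> //; rewrite panel_coneE; exact: vect_face_cone1.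
(* A hyperplane is written [alpha_i + k = 0] while levels carry the sign of [b], whence this
   constant. *)
exists (rsroot R i), (- (-1) ^+ b * m); split.
  exists (rscoroot R i), 1%:M, i; split; first exact: weyl_1.
  by rewrite invmx1 mulmx1 mul1mx.
have hyp y : hyperplane (rsroot R i) (- (-1) ^+ b * m) y <-> level b i y = m%:~R.
  rewrite /hyperplane /= /level rmorphM rmorphN rmorph_sign mulNr /=; split=> [/eqP|h].
    by rewrite subr_eq0 => /eqP ->; rewrite signrMK.
  by rewrite -h signrMK subrr.
apply/seteqP; split=> y.
  have [N N0 NP] := level_bound b x; pose l := Num.floor (- N).
  have lN : l%:~R <= - N by apply: floor_le.
  move=> /(_ (hyperplane (rsroot R i) (- (-1) ^+ b * m))); apply; split; last first.
    apply: (@face_at_up _ _ _ _ _ _ (deep_panel b i m l%:~R)); first by move=> z [zm _]; apply/hyp.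
    apply: (face_at_polyhedron (is_polyhedron_deep_panel _ _ _ _ _) (U := setT)); first exact: filterT.
    move=> _ [_ [v [v0 vC] <-]]; split=> [|j ji]; rewrite levelD ?v0 ?addr0 //.
    by have := vC j ji; have := NP j; have := ler_norm (- level b j x); rewrite normrN; lra.
  split; first by exists x; apply/hyp.
  by move=> z w t /hyp zm /hyp wm; apply/hyp; rewrite levelD levelZ levelB zm wm subrr mulr0 addr0.
move=> /hyp ym S [Saff /face_at_sub[U xU US]].
have [v vE] := @unit_panel R V b i; have [vi vj] := unit_panel_cone vE.
have xU' : nbhs x (interior U) by apply: nbhs_interior.
have [t t0 tU] := near_line v xU'; pose o := x + t *: v.
have oU : nbhs o U by apply: tU; rewrite lexx ltW.
have oS : nbhs o [set z | level b i z = m%:~R -> S z].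
  have : \forall z \near o, forall j, j != i -> level b j x < level b j z.
    apply: (@filter_forall _ _ _ (nbhs o) (nbhs_filter o)) => j; case: (eqVneq j i) => ji.
      by apply: filterE.
    have : level b j x < level b j o by rewrite /o levelD levelZ ltrDl mulr_gt0 // vj.
    by move/near_level; apply: filterS.
  apply: filterS2 oU => z zU zj zm; apply: US; split=> //.
  exists (z - x); last by rewrite addrC subrK.
  by split=> [|j /zj]; rewrite levelB ?zm ?xm ?subrr // subr_gt0.
have om : level b i o = m%:~R by rewrite levelD levelZ vi mulr0 addr0.
have [s s0 sS] := near_line (y - o) oS.
apply: (affine_subspace_line Saff s0 (o := o)); first exact: (nbhs_singleton oS).
by apply: sS; rewrite ?lexx ?ltW // levelD levelZ levelB ym om subrr mulr0 addr0.
Qed.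

(** [P] keeps both families of constraints, the strict ones made large. Points of the panel near [x]
    satisfy them as limits of chamber points. Conversely a point of [P] is approached along the
    segment to a chamber point [p], where the strict inequalities hold again. *)
Lemma closure_reflected x b i E : face_at g x (reflected_cone b i) E ->
  exists P U, [/\ is_polyhedron P, nbhs x U, U `&` translate x (panel_cone b i) `<=` P &
                  P `<=` closure E].
Proof.
move=> [k [k' [U [xU PE UP]]]].
have [v vE] := @unit_levels R V b; pose rv := srefl R i *m v.
have xU' : nbhs x (interior U) by apply: nbhs_interior.
have in_cone u (s : R) : 0 < s -> panel_cone b i u -> reflected_cone b i (u + s *: rv).
  move=> s0 [ui uj]; exists (u + s *: v).
    move=> j; rewrite levelD levelZ vE mulr1; have [->|/uj] := eqVneq j i; last by lra.
    by rewrite ui add0r.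
  rewrite mulmxDr scalemxAr; congr (_ + _).
  by rewrite srefl_rscoroot; move: ui; rewrite /level => /eqP; rewrite mulf_eq0 signr_eq0 /=
    => /eqP ->; rewrite scale0r subr0.
have [t t0 tU] := near_line rv xU'.
have [p pE] : exists p, (\bigcap_(a in all_roots g) (halfspace a (k a) `&` open_halfspace a (k' a))) p.
  exists (x + t *: rv); apply: UP; split.
    by apply: (@interior_subset _ U); apply: tU; rewrite lexx ltW.
  exists (t *: rv) => //; rewrite /rv scalemxAr; exists (t *: v) => // j.
  by rewrite levelZ vE mulr1.
exists (polyhedron g k `&` polyhedron g k'), (interior U); split=> //.
- by apply: is_polyhedronI; [exists k|exists k'].
- move=> y [yU [u uC uE]].
  have [s s0 sU] := near_line rv (open_nbhs_nbhs (conj (open_interior U) yU)).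
  have yP r : 0 < r <= s -> (polyhedron g k `&` polyhedron g k') (y + r *: rv).
    move=> /andP[r0 rs]; have : (\bigcap_(a in all_roots g)
        (halfspace a (k a) `&` open_halfspace a (k' a))) (y + r *: rv).
      apply: UP; split; first by apply: (@interior_subset _ U); apply: sU; rewrite (ltW r0) rs.
      by exists (u + r *: rv); [exact: in_cone|rewrite addrA uE].
    move=> h; split=> a Da; have [] := h a Da; rewrite /halfspace /open_halfspace /=.
      by case: (k a).
    by case: (k' a) => // ? _ /ltW.
  have pk h : is_polyhedron (polyhedron g h) by exists h.
  by split; apply: (polyhedron_limit (u := rv) (pk _) s0) => r /yP [].
move=> z [zk zk'] W zW; have [s s0 sW] := near_line (p - z) zW.
pose r := Num.min s 1; have r0 : 0 < r by rewrite lt_min s0 ltr01.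
have r1 : r <= 1 by rewrite ge_min lexx orbT.
have rs : r <= s by rewrite ge_min lexx.
exists (z + r *: (p - z)); split; last by apply: sW; rewrite (ltW r0) rs.
apply: PE => a Da; have [] := pE a Da; have := zk a Da; have := zk' a Da.
rewrite /halfspace /open_halfspace /= !pairingDr !pairingZr !pairingDr !pairingNr.
have r1' : 0 <= 1 - r by lra.
move=> h' h hp hp'; split.
  case: (k a) h hp => // m h hp.
  have := mulr_ge0 (ltW r0) hp; have := mulr_ge0 r1' h; lra.
case: (k' a) h' hp' => // m h' hp'.
have := mulr_gt0 r0 hp'; have := mulr_ge0 r1' h'; lra.
Qed.

Lemma reflected_below x b i P : face_at g x (reflected_cone b i) P ->
  exists2 z, P z & level b i z < level b i x.
Proof.
move=> /face_at_sub[U xU UP]; have [v vE] := @unit_levels R V b.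
have [t t0 tU] := near_line (srefl R i *m v) xU.
exists (x + t *: (srefl R i *m v)); last first.
  by rewrite levelD levelZ level_srefl_self vE; lra.
apply: UP; split; first by apply: tU; rewrite lexx ltW.
exists (t *: (srefl R i *m v)) => //; rewrite scalemxAr; exists (t *: v) => // j.
by rewrite levelZ vE mulr1.
Qed.

End PanelsAndChambers.

(** * Charts of the masure *)

Section Charts.
Variables (R : realType) (V : vectorial_datum) (L : lmodType R[i]) (g : kac_moody_algebra V L).
Variables (T : Type) (M : apartment_system R V T).
Hypothesis hM : masure g M.
Local Notation n := (yrank V).
Local Notation AA := 'cV[R]_n.
Local Notation index := (km_index V).
Local Notation is_polyhedron := (is_polyhedron g).
Local Notation sector_cone := (@sector_cone R V).
Local Notation panel_cone := (@panel_cone R V).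
Local Notation central_cone := (@central_cone R V).
Local Notation affine_weyl := (@affine_weyl R V).
Local Notation deep := (@deep R V).
Local Notation deep_germ := (@deep_germ R V).
Local Notation closed_chamber := (@closed_chamber R V L g).
Implicit Types (i j : index) (x y z v : AA) (b : bool) (f h : AA -> T) (A : set T).

Definition chart f := exists2 A, apartment M A & isomw M A f.

Lemma isomw_chart A f : apartment M A -> isomw M A f ->
  [/\ injective f, range f = A & forall h, isomw M A h <-> exists2 u, affine_weyl u & h = f \o u].
Proof.
move=> hA; have [f0 [f0A f0inj f0surj] ->] := MA1 hM hA; move=> [u uW <-].
have [u' [uW' uK uK']] := affine_weyl_inv uW.
have f0_inj : injective f0 by move=> x y; apply: f0inj; rewrite inE.
split.
- by apply: inj_comp => //; apply: affine_weyl_injective.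
- apply/seteqP; split=> [_ [x _ <-]|y /f0surj[x _ <-]]; first exact: f0A.
  by exists (u' x) => //=; rewrite uK'.
move=> h; split=> [[w wW <-]|[w wW ->]].
  exists (u' \o w); first exact: affine_weyl_comp.
  by apply/funext => x /=; rewrite uK'.
by exists (u \o w) => //; apply: affine_weyl_comp.
Qed.

Lemma chartP f : chart f -> [/\ injective f, apartment M (range f), isomw M (range f) f &
  forall h, isomw M (range f) h <-> exists2 u, affine_weyl u & h = f \o u].
Proof. by move=> [A hA fA]; have [finj -> fiso] := isomw_chart hA fA. Qed.

Lemma chart_inj f : chart f -> injective f. Proof. by case/chartP. Qed.

Lemma isomw_range A f : apartment M A -> isomw M A f -> range f = A.
Proof. by move=> hA fA; have [] := isomw_chart hA fA. Qed.

Lemma apartment_chart A : apartment M A -> exists f, isomw M A f.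
Proof.
move=> hA; have [f0 _ ->] := MA1 hM hA; exists (f0 \o id); exists id => //.
exact: affine_weyl_id.
Qed.

Lemma chart_comp f u : chart f -> affine_weyl u -> chart (f \o u) /\ range (f \o u) = range f.
Proof.
move=> cf uW; have [_ hA _ fiso] := chartP cf.
have h : isomw M (range f) (f \o u) by apply/fiso; exists u.
by split; [exists (range f)|exact: isomw_range].
Qed.

Lemma chart_range f h : chart f -> chart h -> range f = range h ->
  exists2 u, affine_weyl u & h = f \o u.
Proof.
move=> cf ch e; have [_ _ _ fiso] := chartP cf; have [_ _ hiso _] := chartP ch.
by apply/fiso; rewrite e.
Qed.

(** The enclosure may be computed in any chart, since the affine Weyl group permutes the
    polyhedra. *)
Lemma enclosure_chart A (X : set_system T) S f : apartment M A -> isomw M A f ->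
  enclosure_in g M A X S -> exists2 P, is_polyhedron P & X (f @` P) /\ f @` P `<=` S.
Proof.
move=> hA fA [f1 f1A]; rewrite /= => /enclosureP[P Ppoly [XP PS]].
have [_ _ fiso] := isomw_chart hA fA; have [u uW f1E] := (fiso f1).1 f1A.
exists (u @` P); first exact: polyhedron_image.
have -> : f @` (u @` P) = f1 @` P by rewrite f1E image_comp.
by split=> // _ [x xP <-]; apply: PS.
Qed.

Lemma weyl_iso_chart A A' phi f : apartment M A -> apartment M A' -> isomw M A f ->
  weyl_iso M A A' phi -> isomw M A' (phi \o f).
Proof.
move=> hA hA' fA [_ phiP]; have [f' fA'] := apartment_chart hA'.
have [u uW ->] := phiP f f' fA fA'; have [_ _ fiso] := isomw_chart hA' fA'.
by apply/fiso; exists u.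
Qed.

Lemma preimage_chart f (P : set AA) : chart f -> f @^-1` (f @` P) = P.
Proof.
move=> cf; apply/seteqP; split=> [x [y yP /(chart_inj cf) <-]//|x xP]; by exists x.
Qed.

Lemma MA2_chart f A' (F0 : set_system AA) : chart f -> apartment M A' -> MA2_filter g F0 ->
  F0 (f @^-1` A') -> exists f' P, [/\ isomw M A' f', is_polyhedron P, F0 P &
    forall x, P x -> f' x = f x].
Proof.
move=> cf hA' hF FA'; have [finj hA fA _] := chartP cf.
have [] := MA2 hM (A := range f) (A' := A') (F := f @ F0).
  by split=> //; exists f => //; exists F0.
move=> _ [phi phi_iso [S encS phiS]].
have [P Ppoly [XP PS]] := enclosure_chart hA fA encS.
exists (phi \o f), P; split=> //; first exact: weyl_iso_chart phi_iso.
  by move: XP; rewrite /= preimage_chart.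
by move=> x xP /=; apply/phiS/PS; exists x.
Qed.

Definition up_closed (F : set_system T) := forall S S', S `<=` S' -> F S -> F S'.

(** (MA4) read on charts: the isomorphism composed with [f] is the chart [f'']. *)
Lemma MA4_chart f f' (Rg F : set_system T) : chart f -> chart f' -> MA3_situation g M Rg F ->
  up_closed Rg -> up_closed F -> Rg (range f) -> F (range f) -> Rg (range f') -> F (range f') ->
  exists f'' P, [/\ chart f'', range f'' = range f', is_polyhedron P,
    Rg (f @` P) /\ F (f @` P) & forall x, P x -> f'' x = f x].
Proof.
move=> cf cf' sit upR upF Rf Ff Rf' Ff'.
have [_ hA fA _] := chartP cf; have [_ hA' _ _] := chartP cf'.
have [phi phi_iso [S encS phiS]] := MA4 hM (And5 hA hA' sit (conj Rf Ff) (conj Rf' Ff')).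
have [P Ppoly [[E RE [E' FE' EE']] PS]] := enclosure_chart hA fA encS.
have h := weyl_iso_chart hA hA' fA phi_iso.
exists (phi \o f), P; split=> //.
- by exists (range f').
- exact: isomw_range.
- by rewrite -EE'; split; [apply: upR RE|apply: upF FE'].
by move=> x xP /=; apply/phiS/PS; exists x.
Qed.

Lemma preimage_chart_range f : f @^-1` range f = setT.
Proof. by apply/seteqP; split=> x // _; exists x. Qed.

Lemma up_closed_map f (F0 : set_system AA) : (forall S S', S `<=` S' -> F0 S -> F0 S') ->
  up_closed (f @ F0).
Proof. by move=> up S S' sS; apply: up => x; apply: sS. Qed.

Lemma up_deep f b : up_closed (f @ deep_germ b).
Proof. by apply: up_closed_map => S S' sS [K KS]; exists K => x /KS /sS. Qed.

Lemma up_panel f b i m : up_closed (f @ panel_germ b i m).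
Proof. by apply: up_closed_map => S S' sS [K KS]; exists K => x /KS /sS. Qed.

Lemma up_chamber f x b : up_closed (f @ closed_chamber x b).
Proof. by apply: up_closed_map => S S' sS; apply: closed_chamber_up. Qed.

Lemma up_face f x (Fv : set AA) : up_closed (f @ face_at g x Fv).
Proof. by apply: up_closed_map => S S' sS; apply: face_at_up. Qed.

Lemma face_sector_cone x b : face g (face_at g x (sector_cone b)).
Proof. by exists x, (sector_cone b); split=> //; rewrite sector_coneE; apply: vect_face_cone1. Qed.

Lemma in_masure_chart P f F0 : chart f -> P F0 -> in_masure M P (f @ F0).
Proof. by move=> [A hA fA] PF; exists A => //; exists f => //; exists F0. Qed.

Lemma deep_splayed f b : chart f -> in_masure M (splayed_chimney_germ g) (f @ deep_germ b).
Proof.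
move=> cf; apply: in_masure_chart => //; exists (face_at g 0 (sector_cone b)), (sector_cone b).
split; [exact: face_sector_cone| |exact: spherical_sector|by rewrite sector_chimney_germ].
by rewrite sector_coneE; apply: vect_face_cone1.
Qed.

Lemma deep_solid f b : chart f -> in_masure M (solid_chimney_germ g) (f @ deep_germ b).
Proof.
move=> cf; apply: in_masure_chart => //; exists (face_at g 0 (sector_cone b)), (sector_cone b).
split; [exact: face_sector_cone| |exact: solid_sector|by rewrite sector_chimney_germ].
by rewrite sector_coneE; apply: vect_face_cone1.
Qed.

Lemma chamber_solid f x b : chart f -> in_masure M (solid_chimney_germ g) (f @ closed_chamber x b).
Proof.
move=> cf; apply: in_masure_chart => //; exists (face_at g x (sector_cone b)), central_cone.
split; [exact: face_sector_cone| |exact: solid_closed_chamber|by rewrite closed_chamber_chimney_germ].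
by rewrite (@central_coneE R V false); apply: vect_face_cone1.
Qed.

Lemma panel_splayed f b i (m : int) : chart f ->
  in_masure M (splayed_chimney_germ g) (f @ panel_germ b i m).
Proof.
move=> cf; apply: in_masure_chart => //.
have [y yE] := @level_values R V b (fun => m%:~R).
have hF : vect_face (panel_cone b i) by rewrite panel_coneE; apply: vect_face_cone1.
exists (face_at g y (panel_cone b i)), (panel_cone b i); split=> //.
- by exists y, (panel_cone b i).
- exact: spherical_panel.
- by rewrite (panel_chimney_germ g (yE i)).
Qed.

Lemma central_face f x : chart f -> in_masure M (face g) (f @ face_at g x central_cone).
Proof.
move=> cf; apply: in_masure_chart => //; exists x, central_cone; split=> //.
by rewrite (@central_coneE R V false); apply: vect_face_cone1.
Qed.

Lemma central_face_mem x E : face_at g x central_cone E -> E x.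
Proof.
move=> /face_at_sub[U xU UE]; apply: UE; split; first exact: nbhs_singleton.
by exists 0; rewrite ?addr0 // => j; rewrite level0.
Qed.

(** Stronger than having the same sector-germ, which a translation would preserve. *)
Definition agree b f f' := exists K : R, forall x, deep b K x -> f x = f' x.

Lemma agree_sym b f f' : agree b f f' -> agree b f' f.
Proof. by move=> [K KP]; exists K => x /KP. Qed.

Lemma agree_trans b f f' f'' : agree b f f' -> agree b f' f'' -> agree b f f''.
Proof.
move=> [K KP] [K' KP']; exists (Num.max K K') => x xK; rewrite KP ?KP' // => j;
  by have := xK j; rewrite ge_max => /andP[].
Qed.

Lemma agree_germ b f f' : agree b f f' -> f @ deep_germ b = f' @ deep_germ b.
Proof.
suff sub f1 f2 : agree b f1 f2 -> f1 @ deep_germ b `<=` f2 @ deep_germ b.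
  by move=> ff; apply/seteqP; split; apply: sub => //; apply: agree_sym.
move=> [K KP] S [K' KS]; exists (Num.max K K') => x xK.
have [xK1 xK2] : deep b K x /\ deep b K' x.
  by split=> j; have := xK j; rewrite ge_max => /andP[].
by rewrite /= -KP //; apply: KS.
Qed.

Lemma deep_nbhs b (K : R) : exists x : AA, nbhs x (deep b K).
Proof.
have [x xE] := @level_values R V b (fun => K + 1); exists x.
by apply: near_deep => j; rewrite xE ltrDl.
Qed.

Lemma chart_eq_local f f' (p : AA) (S : set AA) : chart f -> chart f' -> range f = range f' ->
  nbhs p S -> (forall x, S x -> f x = f' x) -> f = f'.
Proof.
move=> cf cf' e pS fS; have [u uW uE] := chart_range cf cf' e.
rewrite uE; apply/funext => x /=; congr f; apply/esym.
apply: (affine_weyl_local uW pS) => y yS; apply: (chart_inj cf).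
by have := fS y yS; rewrite uE.
Qed.

(** Charts of one apartment differ by an affine Weyl element, which here is the identity on an open
    set. *)
Lemma chart_eq_agree b f f' : chart f -> chart f' -> range f = range f' -> agree b f f' -> f = f'.
Proof.
by move=> cf cf' e [K KP]; have [p pK] := deep_nbhs b K; apply: (chart_eq_local _ _ e pK).
Qed.

(** (MA4) with the sector-germ in both roles. *)
Lemma normalized_chart b f A : chart f -> apartment M A -> (f @ deep_germ b) A ->
  exists f', [/\ chart f', range f' = A & agree b f f'].
Proof.
move=> cf hA fA; have [f0 f0A] := apartment_chart hA.
have cf0 : chart f0 by exists A.
have fT : (f @ deep_germ b) (range f) by rewrite /= preimage_chart_range; exists 0.
have f0T : (f @ deep_germ b) (range f0) by rewrite (isomw_range hA f0A).
have sit : MA3_situation g M (f @ deep_germ b) (f @ deep_germ b).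
  by split; [exact: deep_splayed|right; exact: deep_solid].
have [f' [P [cf' f'E _ [RP _] fP]]] :=
  MA4_chart cf cf0 sit (@up_deep f b) (@up_deep f b) fT fT f0T f0T.
exists f'; split=> //; first by rewrite f'E (isomw_range hA f0A).
by move: RP; rewrite /= preimage_chart // => -[K KP]; exists K => x /KP /fP.
Qed.

Lemma sector_chamber_apartment f h b b' x : chart f -> chart h ->
  exists2 A, apartment M A & (f @ deep_germ b) A /\ (h @ closed_chamber x b') A.
Proof.
by move=> cf ch; apply: (MA3 hM); split; [exact: deep_splayed|right; exact: chamber_solid].
Qed.

Lemma sector_sector_apartment f h b b' : chart f -> chart h ->
  exists2 A, apartment M A & (f @ deep_germ b) A /\ (h @ deep_germ b') A.
Proof.
by move=> cf ch; apply: (MA3 hM); split; [exact: deep_splayed|right; exact: deep_solid].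
Qed.

Lemma sector_point_apartment f b (y : T) : chart f ->
  exists A, [/\ apartment M A, (f @ deep_germ b) A & A y].
Proof.
move=> cf; have : (\bigcup_(A in apartment M) A) y by rewrite (masure_cover hM).
move=> [A0 hA0 yA0]; have [h hA] := apartment_chart hA0.
have ch : chart h by exists A0.
have [x _ xy] : range h y by rewrite (isomw_range hA0 hA).
have [A hAA [fA xA]] := MA3 hM (conj (deep_splayed b cf) (or_introl (central_face x ch))).
by exists A; split=> //; rewrite -xy; apply: (central_face_mem (E := h @^-1` A)).
Qed.

Lemma chamber_chart h A x b : chart h -> apartment M A -> (h @ closed_chamber x b) A ->
  exists h' P, [/\ chart h', range h' = A, closed_chamber x b P & forall y, P y -> h' y = h y].
Proof.
move=> ch hA xA; have [||h' [P [h'A _ xP hP]]] := @MA2_chart h A (closed_chamber x b) ch hA.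
- apply: Or44; rewrite -closed_chamber_chimney.
  exists (face_at g x (sector_cone b)), central_cone; split=> //.
  + exact: face_sector_cone.
  + by rewrite (@central_coneE R V false); apply: vect_face_cone1.
  + exact: solid_closed_chamber.
- exact: xA.
by exists h', P; split=> //; [exists A|exact: isomw_range].
Qed.

(** (MA2) at the point [f' z] brings the smallest face at [z] into the range of [f]. (MA4) for this
    face and the sector-germ gives a polyhedron of coincidence that contains [z] and a deep sector,
    hence [z + u] by recession. *)
Lemma agree_cone b f f' z (u : AA) : chart f -> chart f' -> agree b f f' -> range f (f' z) ->
  (forall j, 0 <= level b j u) -> f (z + u) = f' (z + u).
Proof.
move=> cf cf' ff' zf u0.
have [_ hA _ _] := chartP cf.
have [||h [Q [hh Qpoly Qz hQ]]] := @MA2_chart f' (range f) (globally [set z]) cf' hA.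
- by apply: Or41; exists z.
- by move=> _ ->.
have hfQ : Q `<=` f' @^-1` range f.
  by move=> x /hQ hx; have : range h (h x) by [exists x]; rewrite (isomw_range hA hh) hx.
have zQ : face_at g z central_cone (f' @^-1` range f).
  apply: (face_at_up hfQ); apply: (face_at_polyhedron Qpoly filterT) => _ [_ [w w0 <-]].
  exact: polyhedron_central Qpoly w0 (Qz z erefl).
have sit : MA3_situation g M (f' @ deep_germ b) (f' @ face_at g z central_cone).
  by split; [exact: deep_splayed|left; exact: central_face].
have Rf' : (f' @ deep_germ b) (range f') by rewrite /= preimage_chart_range; exists 0.
have Rf : (f' @ deep_germ b) (range f).
  by rewrite -(agree_germ ff') /= preimage_chart_range; exists 0.
have Ff' : (f' @ face_at g z central_cone) (range f').
  rewrite /= preimage_chart_range; exact: (face_at_polyhedron (is_polyhedronT g) filterT).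
have [f'' [P [cf'' f''E Ppoly [RP FP] fP]]] :=
  MA4_chart cf' cf sit (@up_deep f' b) (@up_face f' z central_cone) Rf' Ff' Rf zQ.
move: RP FP; rewrite /= !preimage_chart // => -[K KP] /central_face_mem zP.
have f''f : f'' = f.
  apply: (chart_eq_agree cf'' cf f''E (b := b)).
  by apply: agree_trans (agree_sym ff'); exists K => x /KP /fP.
rewrite -f''f; apply: fP.
have [x xE] := @level_values R V b (fun => K).
apply: (polyhedron_recession Ppoly (x := x)) => // t t0; apply: KP => j.
by rewrite levelD levelZ xE lerDl mulr_ge0.
Qed.

End Charts.

(** * Straight segments towards a sector-germ *)

Section Bend.
Variables (R : realType) (V : vectorial_datum).
Local Notation AA := 'cV[R]_(yrank V).
Local Notation weyl := (@weyl R V).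

Lemma weyl_fix_central (w : 'M[R]_(yrank V)) (v : AA) :
  weyl w -> (forall j, pairing (rsroot R j) v = 0) -> w *m v = v.
Proof.
move=> /weyl_word[s ->] v0; elim: s => [|i s IH] /=; first by rewrite mul1mx.
by rewrite -mulmxA IH srefl_rscoroot v0 scale0r subr0.
Qed.

Lemma weyl_level_int (w : 'M[R]_(yrank V)) b (v : AA) j : weyl w ->
  (forall k, level b k v = 0 \/ level b k v = -1) -> exists m : int, level b j (w *m v) = m%:~R.
Proof.
move=> wP v01; have [z zE] := weyl_root_lattice j wP.
exists (\sum_k (if level b k v == 0 then 0 else - z k)).
rewrite rmorph_sum /= /level pairing_mulmx zE pairing_suml mulr_sumr; apply: eq_bigr => k _.
rewrite pairingZl mulrCA -/(level b k v); have [->|->] := v01 k; first by rewrite eqxx mulr0.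
by rewrite oppr_eq0 oner_eq0 mulrN1 rmorphN.
Qed.

(* w preserves the root lattice, so that both kappa and 1 / kappa are integers when
   w v = kappa v. *)
Lemma weyl_bend (w : 'M[R]_(yrank V)) b (v : AA) r : weyl w ->
  (forall j, level b j v = 0 \/ level b j v = -1) -> 0 <= r <= 1 ->
  v = r *: (v + w *m v) -> w *m v = v.
Proof.
move=> wP v01 /andP[r0 r1] vE.
have [[j vj]|h] := pselect (exists j, level b j v = -1); last first.
  apply: weyl_fix_central => // j; have [|vj] := v01 j; last by case: h; exists j.
  by rewrite /level => /eqP; rewrite mulf_eq0 signr_eq0 => /eqP.
have v0 : v != 0.
  by apply: contra_eq_neq vj => ->; rewrite level0 eq_sym oppr_eq0 oner_eq0.
have rn0 : r != 0.
  by apply: contraNneq v0 => rE; rewrite vE rE scale0r.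
(* This is kappa; it is nonnegative because [r <= 1]. *)
pose c := r^-1 - 1; have wv : w *m v = c *: v.
  rewrite /c scalerBl scale1r {2}vE scalerA mulVf ?scale1r // [v + _]addrC.
  by rewrite -[in RHS]addrA [X in _ + X](_ : _ = 0) ?addr0 // subrr.
have wU := weyl_unitmx wP.
have c0 : c != 0.
  apply: contraNneq v0 => c0; rewrite -[v](mulKmx wU) wv c0 scale0r.
  by rewrite mulmx0.
have wVv : invmx w *m v = c^-1 *: v.
  by rewrite -{1}[v]scale1r -(mulVf c0) -scalerA -wv -scalemxAr mulKmx.
have [m mE] := weyl_level_int j wP v01.
have [m' mE'] := weyl_level_int j (weyl_inv wP) v01.
move: mE mE'; rewrite wv wVv !levelZ vj !mulrN1 => mE mE'.
have cm : c = (- m)%:~R by rewrite rmorphN /= -mE opprK.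
have cm' : c^-1 = (- m')%:~R by rewrite rmorphN /= -mE' opprK.
have c_gt0 : 0 < c.
  by rewrite lt_def c0 subr_ge0 invf_ge1 // lt_def rn0.
have mm : (- m) * (- m') = 1.
  by apply: (@intr_inj R); rewrite rmorphM /= -cm -cm' mulfV.
have m0 : 0 < - m by rewrite -(ltr_int R) -cm.
have m0' : 0 < - m' by rewrite -(ltr_int R) -cm' invr_gt0.
have m1 : - m = 1 by nia.
by rewrite cm m1 scale1r.
Qed.

End Bend.

(** * Continuation of lines leaving a sector-germ *)

Section StraightExtension.
Variables (R : realType) (V : vectorial_datum) (L : lmodType R[i]) (g : kac_moody_algebra V L).
Variables (T : Type) (M : apartment_system R V T).
Hypothesis hM : masure g M.
Local Notation n := (yrank V).
Local Notation AA := 'cV[R]_n.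
Implicit Types (p q v : AA) (b : bool) (f h : AA -> T) (A : set T) (t : R).

(** The chart [f'] may depend on [t]; agreement with [f] at infinity is what ties these charts
    together. *)
Definition straight b f h p q v t := exists f', [/\ chart M f', agree b f f' &
  forall s : R, 0 <= s <= t -> f' (p + s *: v) = h (q + s *: v)].

(** Directions leaving the sector-germ, with the integral levels required by [weyl_bend]. They are
    used opposite to a sector direction and opposite to a panel direction. *)
Definition steps_back b v := forall j, level b j v = 0 \/ level b j v = -1.

Lemma steps_back_le b v r j : steps_back b v -> r <= 0 -> 0 <= level b j (r *: v).
Proof. by move=> bv r0; rewrite levelZ; case: (bv j) => ->; lra. Qed.

Lemma steps_back_ge b v r j : steps_back b v -> 0 <= r -> 0 <= level (~~ b) j (r *: v).
Proof. by move=> bv r0; rewrite levelZ level_negb; case: (bv j) => ->; lra. Qed.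

(** Going back along [v] is moving in the closed cone of the germ, so [agree_cone] at the endpoint
    recovers the whole segment. *)
Lemma straight_back b f f' h p q v t : chart M f' -> agree b f f' -> steps_back b v ->
  straight b f h p q v t -> 0 <= t -> range f' (h (q + t *: v)) ->
  forall s : R, 0 <= s <= t -> f' (p + s *: v) = h (q + s *: v).
Proof.
move=> cf' ff' bv [ft [cft fft ftP]] t0 ht s /andP[s0 st].
have -> : p + s *: v = p + t *: v + (s - t) *: v by rewrite -addrA -scalerDl [t + _]addrC subrK.
have f't : range f' (ft (p + t *: v)) by rewrite ftP // t0 lexx.
have f'ft : agree b f' ft := agree_trans (agree_sym ff') fft.
rewrite (agree_cone hM cf' cft f'ft f't) => [|j]; last by apply: steps_back_le => //; lra.
by rewrite -addrA -scalerDl [t + _]addrC subrK ftP // s0.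
Qed.

(** The chamber at the endpoint [x] is taken on the side of the germ, so it contains the last piece
    of the segment. Before time [t], [f'] follows [h] by [straight_back]; at time [t] this follows
    because the transition [a] is affine. *)
Lemma straight_limit b f h p q v t : chart M f -> chart M h -> steps_back b v -> 0 < t ->
  (forall s : R, 0 <= s < t -> straight b f h p q v s) -> straight b f h p q v t.
Proof.
move=> cf ch bv t0 fs; pose x := q + t *: v.
have [A hA [fA xA]] := sector_chamber_apartment hM b b x cf ch.
have [f' [cf' f'E ff']] := normalized_chart hM cf hA fA.
have [h' [P [ch' h'E xP hP]]] := chamber_chart hM ch hA xA.
have Nv j : 0 <= level b j (- v) by rewrite -scaleN1r steps_back_le // lerN10.
have [e e0 eP] := closed_chamber_line xP Nv.
have [a aW h'a] := chart_range hM cf' ch' (etrans f'E (esym h'E)).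
have xh (s : R) : t - e <= s <= t -> h' (q + s *: v) = h (q + s *: v).
  move=> /andP[s1 s2]; apply: hP.
  have -> : q + s *: v = x + (t - s) *: - v.
    by rewrite /x scalerN -scaleNr opprB -addrA -scalerDl [t + _]addrC subrK.
  by apply: eP; lra.
have f'h (s : R) : 0 <= s < t -> f' (p + s *: v) = h (q + s *: v).
  move=> /andP[s0 st]; pose s' := Num.max s (t - e).
  have s't : s' < t by rewrite gt_max st ltrBlDr ltrDl.
  have ss' : s <= s' by rewrite le_max lexx.
  have es' : t - e <= s' by rewrite le_max lexx orbT.
  have s'0 : 0 <= s' := le_trans s0 ss'.
  apply: (straight_back cf' ff' bv (t := s')) => //; last by rewrite s0.
    by apply: fs; rewrite s'0.
  rewrite -xh ?es' ?(ltW s't) // f'E -h'E; by exists (q + s' *: v).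
pose m := Num.min t e; have m0 : 0 < m by rewrite lt_min t0.
have mt : m <= t by rewrite ge_min lexx.
have me : m <= e by rewrite ge_min lexx orbT.
have ap (s : R) : t - m <= s < t -> a (q + s *: v) = p + s *: v.
  move=> /andP[s1 s2]; apply: (chart_inj hM cf'); rewrite f'h; last by lra.
  by rewrite -xh ?h'a //; lra.
exists f'; split=> // s /andP[s0 st]; have [st'|st'] := ltP s t; first by rewrite f'h ?s0.
have -> : s = t by apply/eqP; rewrite eq_le st.
rewrite -xh ?lexx ?andbT ?lerBlDr ?lerDl ?(ltW e0) // h'a /=; congr f'.
(* Two earlier times from which the endpoint is extrapolated with factor 2. *)
pose s1 := t - m; pose s2 := t - m / 2.
have sE (y : AA) : y + t *: v = y + s1 *: v + 2 *: (y + s2 *: v - (y + s1 *: v)).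
  have -> : y + s2 *: v - (y + s1 *: v) = (s2 - s1) *: v.
    by rewrite opprD addrACA subrr add0r -scalerBl.
  by rewrite scalerA -addrA -scalerDl /s1 /s2; congr (_ + _ *: _); lra.
rewrite (sE q) affine_weyl_line // !ap; [exact: sE|rewrite /s2; lra|rewrite /s1; lra].
Qed.

Lemma tits_step b v t : steps_back b v -> 0 <= t ->
  tits_cone (if b then t *: v else - (t *: v)).
Proof.
move=> bv t0; apply: tits_cone_level => j.
case: b bv => bv; first by rewrite levelZ -[false]/(~~ true) level_negb; case: (bv j) => ->; lra.
by rewrite levelN levelZ; case: (bv j) => ->; lra.
Qed.

(** The chamber at [x] is now taken on the side away from the germ, so it contains the start of the
    continuation, which has direction [w *m v] in [f']. (MAO) puts the image of [x] on the segment
    from [z1] to [z2], and [weyl_bend] gives [w *m v = v]. *)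
Lemma straight_open b f h p q v t : chart M f -> chart M h -> steps_back b v -> 0 < t ->
  straight b f h p q v t -> exists2 e, 0 < e & straight b f h p q v (t + e).
Proof.
move=> cf ch bv t0 ft; pose x := q + t *: v.
have [A hA [fA xA]] := sector_chamber_apartment hM b (~~ b) x cf ch.
have [f' [cf' f'E ff']] := normalized_chart hM cf hA fA.
have [h' [P [ch' h'E xP hP]]] := chamber_chart hM ch hA xA.
have v_ge0 j : 0 <= level (~~ b) j v by rewrite -[v]scale1r steps_back_ge.
have [e e0 eP] := closed_chamber_line xP v_ge0.
have [a aW h'a] := chart_range hM cf' ch' (etrans f'E (esym h'E)).
have xh (s : R) : 0 <= s <= e -> h' (x + s *: v) = h (x + s *: v) by move=> /eP /hP.
have f'h : forall s : R, 0 <= s <= t -> f' (p + s *: v) = h (q + s *: v).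
  apply: (straight_back cf' ff' bv ft (ltW t0)).
  rewrite -/x -[x]addr0 -(scale0r v) -xh ?lexx ?ltW // f'E -h'E; by eexists.
have ax : a x = p + t *: v.
  apply: (chart_inj hM cf'); rewrite f'h ?lexx ?ltW // -/x -[x in RHS]addr0 -(scale0r v).
  by rewrite -xh ?lexx ?ltW // h'a /= scale0r addr0.
have [w [c [wP cP aE]]] := aW.
have axs (s : R) : a (x + s *: v) = p + t *: v + s *: (w *m v).
  by rewrite -ax aE /affmap mulmxDr -scalemxAr addrAC.
pose m := Num.min t e; have m0 : 0 < m by rewrite lt_min t0.
have mt : m <= t by rewrite ge_min lexx.
have me : m <= e by rewrite ge_min lexx orbT.
pose y1 := q + (t - m) *: v; pose y2 := x + m *: v.
pose z1 := p + (t - m) *: v; pose z2 := p + t *: v + m *: (w *m v).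
have hy1 : h y1 = f' z1 by rewrite f'h //; lra.
have hy2 : h y2 = f' z2 by rewrite /y2 /z2 -axs -xh ?h'a //; lra.
have y12 : y2 - y1 = (2 * m) *: v.
  rewrite /y1 /y2 /x -[q + _ + _]addrA -scalerDl opprD addrACA subrr add0r -scalerBl.
  by congr (_ *: _); lra.
have xm : x = y1 + 2^-1 *: (y2 - y1).
  rewrite y12 scalerA mulrA mulVf ?mul1r // /y1 -addrA -scalerDl subrK //.
have hx : h x = f' (p + t *: v) by rewrite f'h // lexx ltW.
(* (MAO) concerns ordered points: [y1 <= y2] for a negative germ and [y2 <= y1] for a positive
   one. *)
have [r r01 rE] : exists2 r, 0 <= r <= 1 & p + t *: v = z1 + r *: (z2 - z1).
  have [hA' fA'] : apartment M (range h) /\ isomw M (range h) h by have [] := chartP hM ch.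
  have [hB fB] : apartment M (range f') /\ isomw M (range f') f' by have [] := chartP hM cf'.
  have half : 0 <= (2^-1 : R) <= 1 by rewrite invr_ge0 ler0n invf_le1 ?ler1n.
  have := tits_step bv (t := 2 * m); case: (b) => /(_ (mulr_ge0 (ler0n _ 2) (ltW m0))) tle.
    have hseg : h @` segment y1 y2 = f' @` segment z1 z2.
      by apply: (MAO hM hA' hB fA' fB hy1 hy2); rewrite /tits_le y12.
    have : (h @` segment y1 y2) (h x) by exists x => //; exists 2^-1.
    by rewrite hseg hx => -[_ [r r01 <-] /(chart_inj hM cf') <-]; exists r.
  have hseg : h @` segment y2 y1 = f' @` segment z2 z1.
    by apply: (MAO hM hA' hB fA' fB hy2 hy1); rewrite /tits_le -opprB y12.
  have : (h @` segment y2 y1) (h x).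
    exists x => //; exists 2^-1 => //; rewrite xm; move: (y1) (y2) => u1 u2.
    by apply/matrixP => k l; rewrite !mxE; lra.
  rewrite hseg hx => -[_ [r /andP[r0 r1] <-] /(chart_inj hM cf') <-].
  exists (1 - r); first by lra.
  by move: (z1) (z2) => u1 u2; apply/matrixP => k l; rewrite !mxE; ring.
have wv : w *m v = v.
  apply: (weyl_bend wP bv r01); apply: (@scalerI _ _ m); first exact: lt0r_neq0.
  move: rE; rewrite /z1 /z2; move: (w *m v) => u rE; apply/matrixP => k l.
  have := congr1 (fun y : AA => y k l) rE; rewrite !mxE; lra.
exists m => //; exists f'; split=> // s /andP[s0 s1].
have [st|st] := leP s t; first by rewrite f'h ?s0.
have sE (y : AA) : y + s *: v = y + t *: v + (s - t) *: v.
  by rewrite -addrA -scalerDl [t + _]addrC subrK.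
have e1 : p + t *: v + (s - t) *: v = a (x + (s - t) *: v) by rewrite axs wv.
rewrite !sE e1 -/x -xh ?h'a //; lra.
Qed.

Lemma straight_extension b f h p q v t0 : chart M f -> chart M h -> steps_back b v ->
  0 < t0 -> (forall s : R, 0 <= s <= t0 -> f (p + s *: v) = h (q + s *: v)) ->
  forall t, 0 <= t -> straight b f h p q v t.
Proof.
move=> cf ch bv t00 fh t t_ge0.
have mono s s' : s <= s' -> straight b f h p q v s' -> straight b f h p q v s.
  move=> ss' [f' [cf' ff' f'P]]; exists f'; split=> // r /andP[r0 rs].
  by apply: f'P; rewrite r0 (le_trans rs).
have t0P : straight b f h p q v t0 by exists f; split=> //; exists 0.
apply: contrapT => nt.
pose S : set R := [set s | straight b f h p q v s].
have ubS : ubound S t.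
  by move=> s Ss; rewrite leNgt; apply/negP => /ltW ts; apply: nt; apply: mono Ss.
have hS : has_sup S by split; [exists t0|exists t].
pose s := sup S; have st0 : t0 <= s by apply: sup_upper_bound.
have s0 : 0 < s by apply: lt_le_trans st0.
have Ss : S s.
  apply: straight_limit => // r /andP[r0 rs].
  have [|r' Sr'] := @sup_adherent _ S (s - r) _ hS; first by rewrite subr_gt0.
  rewrite opprB addrC subrK => /ltW rr'; exact: mono Sr'.
have [e e0 Se] := straight_open cf ch bv s0 Ss.
have : s + e <= s by apply: sup_upper_bound.
by rewrite gerDl leNgt e0.
Qed.

(** The common line is followed until time [t], when it lies in the deep sector of [h] contained in
    [A]; [straight_back] then leads back to [f p] inside [A]. *)
Lemma opposite_apartment b f h p q v t0 A : chart M f -> chart M h ->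
  (forall j, level b j v = -1) -> 0 < t0 ->
  (forall s : R, 0 <= s <= t0 -> f (p + s *: v) = h (q + s *: v)) ->
  apartment M A -> (f @ deep_germ b) A -> (h @ deep_germ (~~ b)) A -> A (f p).
Proof.
move=> cf ch vE t00 fh hA fA [K KP].
have bv : steps_back b v by move=> j; right.
have [N N0 NP] := level_bound (~~ b) q; pose t := `|K| + N.
have t_ge0 : 0 <= t by rewrite addr_ge0.
have ft := straight_extension cf ch bv t00 fh t_ge0.
have [e [ce eE fe]] := normalized_chart hM cf hA fA.
have ht : range e (h (q + t *: v)).
  rewrite eE; apply: KP => j; rewrite levelD levelZ [level _ j v]level_negb vE opprK mulr1.
  have := NP j; have := ler_norm (- level (~~ b) j q); have := ler_norm K.
  by rewrite normrN /t; lra.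
have := straight_back ce fe bv ft t_ge0 ht (s := 0); rewrite lexx t_ge0 => /(_ isT).
rewrite -(fh 0) ?lexx ?ltW // scale0r addr0 -eE => <-; by exists p.
Qed.

End StraightExtension.

(** * Branching along panels *)

Section Branching.
Variables (R : realType) (V : vectorial_datum) (L : lmodType R[i]) (g : kac_moody_algebra V L).
Variables (T : Type) (M : apartment_system R V T).
Hypotheses (hM : masure g M) (hthick : thick_finite g M).
Local Notation n := (yrank V).
Local Notation AA := 'cV[R]_n.
Implicit Types (x y z : AA) (f h : AA -> T) (k : int).

Variables (b : bool) (i : km_index V).
Local Notation reflected := (@reflected_cone R V b i).

(** The view from the [i]-th panel at infinity: only the [i]-th level has a prescribed bound. *)
Definition same_above k f f' := exists K : R, forall y, k%:~R <= level b i y ->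
  (forall j, j != i -> K <= level b j y) -> f y = f' y.

Lemma agree_same_above h f : agree b h f -> exists k0 : int, forall k, k0 <= k -> same_above k f h.
Proof.
move=> [K KP]; exists (Num.ceil K) => k k0; exists K => y yk yK; apply/esym/KP => j.
have [->|/yK //] := eqVneq j i; apply: le_trans yk; apply: le_trans (ceil_ge K) _.
by rewrite ler_int.
Qed.

(** (MA4) for the germ and the chamber just below level [k + 1] gives a polyhedron of coincidence
    with points below that level; [polyhedron_region] extends it down to level [k]. *)
Lemma same_chamber_above h f f' x k : chart M f -> agree b h f -> chart M f' -> agree b h f' ->
  level b i x = (k + 1)%:~R -> f @ face_at g x reflected = f' @ face_at g x reflected ->
  same_above k f f'.
Proof.
move=> cf hf cf' hf' xk fE.
have sit : MA3_situation g M (f @ deep_germ b) (f @ face_at g x reflected).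
  split; first exact: deep_splayed.
  left; apply: in_masure_chart => //; have [] := chamber_reflected g x b i.
  by move=> + _.
have faceT : face_at g x reflected setT.
  exact: (face_at_polyhedron (is_polyhedronT g) filterT).
have Rf : (f @ deep_germ b) (range f) by rewrite /= preimage_chart_range; exists 0.
have Rf' : (f @ deep_germ b) (range f').
  by rewrite -(agree_germ hf) (agree_germ hf') /= preimage_chart_range; exists 0.
have Ff : (f @ face_at g x reflected) (range f) by rewrite /= preimage_chart_range.
have Ff' : (f @ face_at g x reflected) (range f') by rewrite fE /= preimage_chart_range.
have [f'' [P [cf'' f''E Ppoly [RP FP] fP]]] :=
  MA4_chart hM cf cf' sit (@up_deep _ _ _ f b) (@up_face _ _ _ g _ f x reflected) Rf Ff Rf' Ff'.
move: RP FP; rewrite /= !(preimage_chart hM) // => deepP faceP.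
have f''f' : f'' = f'.
  apply: (chart_eq_agree hM (b := b)) => //.
  apply: (agree_trans (f' := f)); last exact: agree_trans (agree_sym hf) hf'.
  by case: deepP => K KP; exists K => y /KP /fP.
have [z zP zx] := reflected_below faceP; rewrite xk in zx.
have [K KP] := polyhedron_region Ppoly deepP zP zx.
by exists K => y yk yK; rewrite -f''f' fP //; apply: KP.
Qed.

Lemma adjacent_chamber f h x k (N : int) : chart M f -> chart M h ->
  (forall y, (k + 1)%:~R <= level b i y -> (forall j, j != i -> N%:~R <= level b j y) -> f y = h y) ->
  level b i x = (k + 1)%:~R -> (forall j, j != i -> N%:~R <= level b j x) ->
  in_masure M (chamber g) (f @ face_at g x reflected) /\
  lies_in_closure g M (h @ face_at g x (@panel_cone R V b i)) (f @ face_at g x reflected).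
Proof.
move=> cf ch fh xk xN; split; first by apply: in_masure_chart => //; apply: chamber_reflected.
have [_ hA fA _] := chartP hM cf.
exists (range f), f, (face_at g x reflected); split=> //; first exact: chamber_reflected.
move=> Z [E /closure_reflected[P [U [Ppoly xU UP PE]]] EZ].
have [Qpoly Qsub] : is_polyhedron g (P `&` deep_panel b i (k + 1) N%:~R) /\
    P `&` deep_panel b i (k + 1) N%:~R `<=` h @^-1` Z.
  split; first by apply: is_polyhedronI => //; apply: is_polyhedron_deep_panel.
  by move=> y [/PE /EZ yZ [yk yN]]; rewrite /= -fh ?yk.
apply: (face_at_up Qsub); apply: (face_at_polyhedron Qpoly xU) => y [yU yx]; split; first exact: UP.
case: yx => u [u0 uj] <-; split=> [|j ji]; rewrite levelD ?u0 ?addr0 //.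
by have := uj j ji; have := xN j ji; lra.
Qed.

Definition germ_chart h f := chart M f /\ agree b h f.

(* Below level k + 1 a chart is determined by its chamber adjacent to a panel at that level,
   and there are finitely many of them. *)
Lemma branching_step h0 h k : germ_chart h0 h -> exists c : nat -> AA -> T,
  (forall m, germ_chart h0 (c m)) /\
  forall f, germ_chart h0 f -> same_above (k + 1) f h -> exists m, same_above k f (c m).
Proof.
move=> [ch hh].
pose N_agree (N : nat) f := forall y, (k + 1)%:~R <= level b i y ->
  (forall j, j != i -> (N : int)%:~R <= level b j y) -> f y = h y.
suff fam N : exists c : nat -> AA -> T, (forall m, germ_chart h0 (c m)) /\
    forall f, germ_chart h0 f -> N_agree N f -> exists m, same_above k f (c m).
  have [c cP] := choice fam.
  exists (fun m => if unpickle m is Some (N, m') then c N m' else h); split.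
    by move=> m; case: unpickle => [[N m']|//]; apply: (cP N).1.
  move=> f hf [K KP]; pose N := `|Num.ceil K|%N.
  have [|m mP] := (cP N).2 f hf.
    move=> y yk yN; apply: KP => // j /yN; apply: le_trans; apply: le_trans (ceil_ge K) _.
    by rewrite ler_int /N abszE ler_norm.
  by exists (pickle (N, m)); rewrite pickleK.
have [x xE] := @level_values R V b (fun j => if j == i then (k + 1)%:~R else (N : int)%:~R).
have xk : level b i x = (k + 1)%:~R by rewrite xE eqxx.
have xN j : j != i -> (N : int)%:~R <= level b j x by move=> /negbTE ji; rewrite xE ji.
have [Chfin _] := hthick (in_masure_chart ch (panel_panel_cone g xk)).
pose C f := f @ face_at g x reflected.
have /countable_injP[phi phi_inj] := finite_set_countable Chfin.
(* For each code [m], one representative of the charts having it, and [h] as default when there is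
   none. *)
have rep m : exists f', germ_chart h0 f' /\
    ((exists f, [/\ germ_chart h0 f, N_agree N f & phi (C f) = m]) -> N_agree N f' /\ phi (C f') = m).
  have [[f [hf Nf fm]]|no] := pselect (exists f, [/\ germ_chart h0 f, N_agree N f & phi (C f) = m]).
    by exists f.
  by exists h; split.
have [c cP] := choice rep; exists c; split=> [m|f hf Nf]; first by have [] := cP m.
exists (phi (C f)); have [hc] := cP (phi (C f)).
case=> [|Nc ce]; first by exists f.
apply: (same_chamber_above (h := h0) _ _ _ _ xk); [exact: hf.1|exact: hf.2|exact: hc.1|exact: hc.2|].
have mem f1 : germ_chart h0 f1 -> N_agree N f1 -> C f1 \in [set C1 | in_masure M (chamber g) C1 /\
    lies_in_closure g M (h @ face_at g x (panel_cone b i)) C1].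
  by move=> [cf1 _] Nf1; rewrite inE; apply: (adjacent_chamber (N := N) cf1 ch Nf1 xk xN).
by apply: phi_inj; rewrite ?ce //; apply: mem.
Qed.

Lemma branching_descent h0 h k (d : nat) : germ_chart h0 h -> exists c : nat -> AA -> T,
  (forall m, germ_chart h0 (c m)) /\
  forall f, germ_chart h0 f -> same_above k f h -> exists m, same_above (k - d%:Z) f (c m).
Proof.
move=> hh; elim: d => [|d [c [cQ cP]]].
  by exists (fun => h); split=> // f _ fh; exists 0%N; rewrite subr0.
have [c' c'P] := choice (fun m => branching_step (k - d.+1%:Z) (cQ m)).
exists (fun m => if unpickle m is Some (m1, m2) then c' m1 m2 else h); split.
  by move=> m; case: unpickle => [[m1 m2]|//]; apply: (c'P m1).1.
move=> f hf fh; have [m1 fm1] := cP f hf fh.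
have [|m2 fm2] := (c'P m1).2 f hf; last by exists (pickle (m1, m2)); rewrite pickleK.
by rewrite (_ : k - d.+1%:Z + 1 = k - d%:Z) //; lia.
Qed.

(** The level above which [f] agrees with [h0] depends on [f]; hence all starting levels [N] and all
    numbers [d] of descents are put in one family. *)
Lemma countable_branching h0 : chart M h0 -> exists c : nat -> AA -> T,
  (forall m, germ_chart h0 (c m)) /\
  forall f k, germ_chart h0 f -> exists m, same_above k f (c m).
Proof.
move=> ch0; have h00 : germ_chart h0 h0 by split=> //; exists 0.
have [c cP] := choice (fun Nd : nat * nat => branching_descent Nd.1%:Z Nd.2 h00).
exists (fun m => if unpickle m is Some (Nd, m') then c Nd m' else h0); split.
  by move=> m; case: unpickle => [[Nd m']|//]; apply: (cP Nd).1.
move=> f k hf; have [k0 k0P] := agree_same_above hf.2.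
pose N := (`|k0| + `|k|)%N; pose d := `|N%:Z - k|%N.
have [|m mP] := (cP (N, d)).2 f hf; first by apply: k0P => /=; rewrite /N; lia.
exists (pickle ((N, d), m)); rewrite pickleK; move: mP => /=.
by rewrite (_ : N%:Z - d%:Z = k) // /d /N; lia.
Qed.

End Branching.

(** * The countable covering *)

Section AffineMaps.
Variables (R : realType) (V : vectorial_datum).
Local Notation AA := 'cV[R]_(yrank V).
Local Notation affine_weyl := (@affine_weyl R V).

Lemma near_level_affine b j a (x : AA) c d : affine_weyl a -> c < level b j (a x) < d ->
  \forall y \near x, c < level b j (a y) < d.
Proof.
have low s e : affine_weyl a -> e < level s j (a x) -> \forall y \near x, e < level s j (a y).
  move=> [w [q [_ _ aE]]]; pose A := (-1) ^+ s *: (rsroot R j *m w).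
  have lE y : level s j (a y) = pairing A y + level s j q.
    by rewrite aE levelD {1}/level pairing_mulmx -pairingZl.
  rewrite lE -ltrBlDr => eA.
  have h : nbhs x [set y | e - level s j q < pairing A y] by exact: pairing_continuous (lt_nbhsr eA).
  by apply: filterS h => y /=; rewrite lE ltrBlDr.
move=> aW /andP[cx xd].
have dx : - d < level (~~ b) j (a x) by rewrite level_negb ltrN2.
by apply: filterS2 (low _ _ aW cx) (low _ _ aW dx) => y cy; rewrite level_negb ltrN2 cy.
Qed.

(** The midpoints are the images of an open set under an affine bijection, so [u] fixes an open
    set. *)
Lemma affine_weyl_midpoint u a (p : AA) S y' : affine_weyl u -> affine_weyl a -> nbhs p S ->
  (forall x, S x -> u (y' + 2^-1 *: (a x - y')) = y' + 2^-1 *: (a x - y')) ->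
  forall y, u y = y.
Proof.
move=> uW aW pS uS y; have [a' [_ _ a'K]] := affine_weyl_inv aW.
pose mid x := y' + 2^-1 *: (a x - y').
pose x := a' (y' + 2 *: (y - y')).
have mx : mid x = y by rewrite /mid /x a'K; apply/matrixP => k l; rewrite !mxE; lra.
have [t t0 tS] := near_line (x - p) pS.
have midE : mid (p + t *: (x - p)) = mid p + t *: (y - mid p).
  rewrite -mx /mid affine_weyl_line //; move: (a p) (a x) => u1 u2.
  by apply/matrixP => k l; rewrite !mxE; ring.
have h := uS _ (tS t _); rewrite -/(mid _) midE lexx ltW // in h.
have hp : u (mid p) = mid p by apply: uS; exact: nbhs_singleton.
have {h} := h isT; rewrite affine_weyl_line // hp => /addrI /scalerI.
by rewrite gt_eqF // => /(_ isT) /addIr.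
Qed.

End AffineMaps.

(** * Exchange across a panel and the covering *)

Section Covering.
Variables (R : realType) (V : vectorial_datum) (L : lmodType R[i]) (g : kac_moody_algebra V L).
Variables (T : Type) (M : apartment_system R V T).
Hypotheses (hM : masure g M) (hthick : thick_finite g M).
Local Notation n := (yrank V).
Local Notation AA := 'cV[R]_n.
Local Notation affine_weyl := (@affine_weyl R V).
Local Notation srefl := (@srefl R V).
Local Notation closed_chamber := (@closed_chamber R V L g).
Implicit Types (p q x y z : AA) (f h d e : AA -> T) (k : int) (b : bool).

Lemma srefl_invol i x : srefl i *m (srefl i *m x) = x.
Proof. by rewrite mulmxA sreflK mul1mx. Qed.

Lemma chart_srefl e i : chart M e ->
  chart M (fun y => e (srefl i *m y)) /\ range (fun y => e (srefl i *m y)) = range e.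
Proof. by move=> ce; apply: (chart_comp hM ce (u := mulmx (srefl i))); apply/affine_weyl_linear/weyl_srefl. Qed.

Lemma srefl_fix b i x : level b i x = 0 -> srefl i *m x = x.
Proof.
by rewrite /level => /eqP; rewrite mulf_eq0 signr_eq0 /= srefl_rscoroot => /eqP ->;
  rewrite scale0r subr0.
Qed.

(* Moving z = a p far along the panel direction gives a point z0 in a region where d and e
   agree. Extending the ray from z0 back to z puts f p = d z and the points e z0 in a common
   apartment with the sector-germ of e o r_i; then (MA4), applied to the panel germ at level k
   and to the chamber at f p, provides the chart d'. *)
Lemma panel_exchange f p d e i b a P k : chart M f -> chart M d -> chart M e ->
  closed_chamber p b P -> affine_weyl a -> (forall x, P x -> f x = d (a x)) ->
  same_above b i k d e -> k%:~R < level b i (a p) ->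
  exists d' P', [/\ chart M d', agree b (fun y => e (srefl i *m y)) d', closed_chamber p b P' &
    forall x, P' x -> f x = d' (srefl i *m a x)].
Proof.
move=> cf cd ce pP aW fd [K de] kz; pose z := a p.
pose h1 y := e (srefl i *m y).
have [ch1 h1E] := chart_srefl i ce.
have [xi xiE] := @unit_panel R V b i; have xi_i : level b i xi = 0 by rewrite xiE eqxx.
have xi_j j : j != i -> level b j xi = 1 by move=> ji; rewrite xiE ji.
have xi_ge0 j : 0 <= level b j xi by rewrite xiE.
have rxi : srefl i *m xi = xi := srefl_fix xi_i.
have [N N0 NP] := level_bound b z.
(* The other levels of [z0] reach [K + 1]; the extra unit leaves room for an initial segment of
   length 1 on which [d] and [e] agree. *)
pose t := `|K| + N + 1; pose z0 := z + t *: xi.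
have Kt j : K + 1 <= level b j z + t.
  by have := NP j; have := ler_norm (- level b j z); have := ler_norm K; rewrite normrN /t; lra.
have t0 : 0 <= t by rewrite !addr_ge0.
have bxi : steps_back b (- xi).
  by move=> j; rewrite levelN xiE; case: (j != i); [right|left; rewrite oppr0].
have [B [cB h1B Bd]] : straight M b h1 d (srefl i *m z0) z0 (- xi) t.
  apply: (straight_extension hM ch1 cd bxi (t0 := 1)) => // s /andP[s0 s1].
  rewrite /h1 mulmxDr -scalemxAr mulmxN rxi srefl_invol; apply/esym/de.
    by rewrite /z0 !(levelD, levelZ, levelN) xi_i; rewrite oppr0 !mulr0 !addr0 ltW.
  by move=> j ji; rewrite /z0 !(levelD, levelZ, levelN) xi_j //; have := Kt j; lra.
have rz0 : srefl i *m z0 = srefl i *m z + t *: xi by rewrite mulmxDr -scalemxAr rxi.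
have fp : f p = d z.
  apply: fd; have [s s0 /(_ 0)] := closed_chamber_line pP xi_ge0.
  by rewrite scale0r addr0 lexx ltW // => /(_ isT).
have Bz : B (srefl i *m z) = f p.
  by rewrite fp; have := Bd t; rewrite t0 lexx => /(_ isT); rewrite rz0 scalerN !addrK.
have Bz0 : B (srefl i *m z0) = h1 (srefl i *m z0).
  have := Bd 0; rewrite lexx t0 => /(_ isT); rewrite !scale0r !addr0 => ->.
  rewrite /h1 srefl_invol; apply: de => [|j ji]; rewrite /z0 levelD levelZ.
    by rewrite xi_i mulr0 addr0 ltW.
  by rewrite xi_j // mulr1; have := Kt j; lra.
have [A hA [h1A pA]] := sector_chamber_apartment hM b b p ch1 cf.
have [d' [cd' d'E h1d']] := normalized_chart hM ch1 hA h1A.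
have fpA : A (f p).
  have [s s0 /(_ 0)] := closed_chamber_line pA xi_ge0.
  by rewrite scale0r addr0 lexx ltW // => /(_ isT).
have d'z0 : d' (srefl i *m z0) = h1 (srefl i *m z0).
  have Bd' : agree b d' B := agree_trans (agree_sym h1d') h1B.
  have hz : range d' (B (srefl i *m z)) by rewrite Bz d'E.
  have txi j : 0 <= level b j (t *: xi) by rewrite levelZ mulr_ge0.
  by rewrite rz0 (agree_cone hM cd' cB Bd' hz txi) -rz0 Bz0.
have d'cone u : (forall j, 0 <= level b j u) -> d' (srefl i *m z0 + u) = h1 (srefl i *m z0 + u).
  have hz0 : range d' (h1 (srefl i *m z0)) by rewrite -d'z0; eexists.
  exact: (agree_cone hM (f' := h1) (z := srefl i *m z0) cd' ch1 (agree_sym h1d') hz0).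
pose c := level b i z - k%:~R; have c0 : 0 < c by rewrite subr_gt0.
pose C : R := \sum_j `|(km_matrix i j)%:~R|.
have CP j : `|(km_matrix i j)%:~R| <= C by rewrite /C (bigD1 j) //= lerDl sumr_ge0.
have [N' N'0 N'P] := level_bound b z0.
pose K' := `|K| + N' + c * C.
(* On this strip [r_i y - r_i z0] lies in the closed cone: the reflection reverses the [i]-th
   difference, and the depth [K'] absorbs the change, at most [c * C], of the other levels. *)
have common y : k%:~R <= level b i y <= level b i z -> (forall j, j != i -> K' <= level b j y) ->
    d y = d' (srefl i *m y).
  move=> /andP[yk yz] yK'.
  have cC : 0 <= c * C by rewrite mulr_ge0 ?(ltW c0) // sumr_ge0.
  rewrite de //; last first.
    by move=> j ji; have := yK' j ji; have := ler_norm K; rewrite /K'; lra.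
  have -> : srefl i *m y = srefl i *m z0 + srefl i *m (y - z0).
    by rewrite -mulmxDr addrC subrK.
  rewrite d'cone; first by rewrite -mulmxDr [z0 + _]addrC subrK /h1 srefl_invol.
  have z0i : level b i z0 = level b i z by rewrite /z0 levelD levelZ xi_i mulr0 addr0.
  move=> j; have [->|ji] := eqVneq j i; first by rewrite level_srefl_self levelB z0i; lra.
  rewrite level_srefl !levelB z0i.
  have : `|(level b i y - level b i z) * (km_matrix i j)%:~R| <= c * C.
    by rewrite normrM ler_pM // ler_norml /c; lra.
  have := ler_norm ((level b i y - level b i z) * (km_matrix i j)%:~R).
  have := yK' j ji; have := NP j; have := N'P j; have := ler_norm (level b j z0).
  by have := normr_ge0 K; rewrite /K'; lra.
have sit : MA3_situation g M (d @ panel_germ b i k) (f @ closed_chamber p b).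
  by split; [exact: panel_splayed|right; exact: chamber_solid].
have Rd : (d @ panel_germ b i k) (range d) by rewrite /= preimage_chart_range; exists 0.
have Fd : (f @ closed_chamber p b) (range d).
  by apply: closed_chamber_up pP => x xP; rewrite /= fd //; exists (a x).
have Rd' : (d @ panel_germ b i k) (range d').
  exists K' => y [yk yK]; rewrite /= common ?yk ?lexx ?ltW //; by eexists.
have Fd' : (f @ closed_chamber p b) (range d') by rewrite d'E.
have [d'' [Q [cd'' d''E Qpoly [RQ FQ] dQ]]] :=
  MA4_chart hM cd cd' sit (@up_panel _ _ _ d b i k) (@up_chamber _ _ _ g _ f p b) Rd Fd Rd' Fd'.
move: RQ; rewrite /= (preimage_chart hM) // => -[K2 K2P].
pose P' := P `&` f @^-1` (d @` Q).
have P'P : closed_chamber p b P' by apply: closed_chamberI.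
have aQ x : P' x -> Q (a x).
  by move=> [xP [y yQ]]; rewrite fd // => /(chart_inj hM cd) <-.
pose e' y := d' (srefl i *m y).
have [ce' e'E] := chart_srefl i cd'.
have [u uW d''e'] := chart_range hM ce' cd'' (etrans e'E (esym d''E)).
(* A deep point of the wall at level [k]. The midpoints between [y'] and points [a x] close to [z]
   lie in [Q] by convexity and in the strip of [common]; the bound [2 * K' + N + 1] gives them depth
   [K']. *)
have [y' y'E] := @level_values R V b (fun j => if j == i then k%:~R else
   Num.max K2 (2 * K' + N + 1)).
have y'i : level b i y' = k%:~R by rewrite y'E eqxx.
have y'j j : j != i -> K2 <= level b j y' /\ 2 * K' + N + 1 <= level b j y'.
  by move=> /negbTE ji; rewrite y'E ji !le_max !lexx orbT.
have y'Q : Q y' by apply: K2P; split=> // j /y'j [].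
have near_a : \forall x \near p, forall j, level b j z - Num.min c 1 < level b j (a x) <
    level b j z + Num.min c 1.
  apply: (@filter_forall _ _ _ (nbhs p) (nbhs_filter p)) => j.
  apply: near_level_affine => //; rewrite -/z.
  have : 0 < Num.min c 1 by rewrite lt_min c0 ltr01.
  lra.
have [p1 p1P' p1a] := closed_chamber_near P'P near_a.
have mc : Num.min c 1 <= c by rewrite ge_min lexx.
have m1 : Num.min c 1 <= 1 by rewrite ge_min lexx orbT.
have u_id : forall y, u y = y.
  apply: (affine_weyl_midpoint uW aW (filterI p1P' p1a) (y' := y')) => x [xP' xa].
  set y := _ + _; have yQ : Q y.
    apply: (polyhedron_convex Qpoly y'Q (aQ _ xP')).
    by rewrite invr_ge0 ler0n invf_le1 ?ler1n.
  have yE j : level b j y = (level b j (a x) + level b j y') / 2.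
    by rewrite /y levelD levelZ levelB; lra.
  apply: (chart_inj hM ce'); have -> : d' (srefl i *m u y) = d'' y by rewrite d''e'.
  rewrite dQ // common // => [|j ji]; rewrite yE.
    by have := xa i; rewrite y'i; move: mc; rewrite /c; lra.
  by have := xa j; have [_] := y'j j ji; have := NP j; have := ler_norm (- level b j z);
    rewrite normrN; lra.
exists d', P'; split=> // x xP'; rewrite fd; last by case: xP'.
by rewrite -dQ ?d''e' /= ?u_id //; apply: aQ.
Qed.

(* In an apartment containing both the chamber at f p and the sector-germ of h, the word s
   expresses their relative position. *)
Definition joined b f p h s := exists d q P, [/\ chart M d, agree b h d, @coroot_lattice R V q,
  closed_chamber p b P & forall x, P x -> f x = d (affmap (word_mx R s) q x)].

Lemma affine_weyl_word s q : @coroot_lattice R V q -> affine_weyl (affmap (word_mx R s) q).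
Proof. by move=> qQ; exists (word_mx R s), q; split=> //; apply: weyl_word_mx. Qed.

(** The first letter is absorbed by the reflection of some [c m]; the same countable family serves
    all [f] and [p]. *)
Lemma joined_step b f p h i s (c : nat -> AA -> T) : chart M f ->
  (forall m, germ_chart M b h (c m)) ->
  (forall d k, germ_chart M b h d -> exists m, same_above b i k d (c m)) ->
  joined b f p h (i :: s) -> exists m, joined b f p (fun y => c m (srefl i *m y)) s.
Proof.
move=> cf cQ cP [d [q [P [cd hd qQ pP fd]]]].
have aW := affine_weyl_word (i :: s) qQ; set a := affmap _ q in fd aW.
(* The largest integer strictly below this level: the strip under [a p] must have positive width. *)
pose k := Num.ceil (level b i (a p)) - 1.
have kz : k%:~R < level b i (a p) := ceilB1_lt _.
have [m dm] := cP d k (conj cd hd); exists m.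
have [cm hm] := cQ m.
have [d' [P' [cd' md' pP' fd']]] := panel_exchange cf cd cm pP aW fd dm kz.
exists d', (srefl i *m q), P'; split=> //.
  by apply: coroot_lattice_weyl => //; apply: weyl_srefl.
move=> x /fd' ->; rewrite /a /affmap /= mulmxDr; congr (d' (_ + _)).
by rewrite -mulmxA srefl_invol.
Qed.

(** For the empty word the transition is a translation, so both charts share a straight segment that
    starts at [f p] and leaves the germ of sign [b]. *)
Lemma joined_opposite b f p h A : chart M f -> joined (~~ b) f p h [::] -> apartment M A ->
  (f @ deep_germ b) A -> (h @ deep_germ (~~ b)) A -> A (f p).
Proof.
move=> cf [d [q [P [cd hd _ pP fd]]]] hA fA; rewrite (agree_germ hd) => dA.
have [v vE] := @unit_levels R V (~~ b).
have v_ge0 j : 0 <= level (~~ b) j v by rewrite vE.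
have [t t0 tP] := closed_chamber_line pP v_ge0.
have vb j : level b j v = -1.
  by have := vE j; rewrite level_negb => /eqP; rewrite eqr_oppLR => /eqP.
apply: (opposite_apartment hM cf cd vb t0 _ hA fA dA (q := p + q)) => u ut.
by rewrite (fd _ (tP _ ut)) /affmap mul1mx addrAC.
Qed.

Theorem countable_cover f0 b : chart M f0 -> exists A : nat -> set T,
  (forall m, apartment M (A m) /\ (f0 @ deep_germ b) (A m)) /\ forall y : T, exists m, A m y.
Proof.
move=> cf0.
(* The families are chosen before the point [y] to be covered. *)
have fam_ex (hi : (AA -> T) * km_index V) : exists c : nat -> AA -> T, chart M hi.1 ->
    (forall m, germ_chart M (~~ b) hi.1 (c m)) /\
    forall d k, germ_chart M (~~ b) hi.1 d -> exists m, same_above (~~ b) hi.2 k d (c m).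
  have [ch|nch] := pselect (chart M hi.1); last by exists (fun => hi.1).
  by have [c cP] := countable_branching hM hthick (~~ b) hi.2 ch; exists c.
have [fam famP] := choice fam_ex.
(* A list records the reflection and the branch chosen at each stage, and there are countably many
   lists. *)
pose gen := foldr (fun (im : km_index V * nat) h => fun y => fam (h, im.1) im.2 (srefl im.1 *m y)) f0.
have gen_chart l : chart M (gen l).
  elim: l => [//|[i m] l IH] /=; have [/(_ m)[cm _] _] := famP (gen l, i) IH.
  exact: (chart_srefl i cm).1.
have A_ex l : exists A, apartment M A /\
    ((f0 @ deep_germ b) A /\ (gen l @ deep_germ (~~ b)) A).
  by have [A hA h] := sector_sector_apartment hM b (~~ b) cf0 (gen_chart l); exists A.
have [A AP] := choice A_ex.
exists (fun m => if unpickle m is Some l then A l else A [::]); split.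
  by move=> m; case: unpickle => [l|]; [have [? []] := AP l|have [? []] := AP [::]].
move=> y; suff [l yl] : exists l, A l y by exists (pickle l); rewrite pickleK.
have [A1 [hA1 f0A1 yA1]] := sector_point_apartment hM b y cf0.
have [f [cf fE f0f]] := normalized_chart hM cf0 hA1 f0A1.
have [p _ py] : range f y by rewrite fE.
(* The initial opposite germ is that of [f0] itself; the chamber at [p] has sign [~~ b] in [f], so
   it points away from the given germ. *)
have [D hD [f0D pD]] := sector_chamber_apartment hM (~~ b) (~~ b) p cf0 cf.
have [d [cd dE f0d]] := normalized_chart hM cf0 hD f0D.
have [f' [P [cf' f'E pP f'f]]] := chamber_chart hM cf hD pD.
have [a [w [q [wP qP aE]]] f'a] := chart_range hM cd cf' (etrans dE (esym f'E)).
have [s wE] := weyl_word wP.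
have : joined (~~ b) f p (gen [::]) s.
  exists d, q, P; split=> // x xP; by rewrite -f'f // f'a aE wE.
move: [::] => l; elim: s l {wE} => [|i s IH] l jl.
  exists l; have [hAl [f0l gl]] := AP l; rewrite -py.
  by apply: (joined_opposite cf jl) => //; rewrite -(agree_germ f0f).
have [cQ cP] := famP (gen l, i) (gen_chart l).
have [m jm] := joined_step cf cQ cP jl.
exact: (IH ((i, m) :: l)).
Qed.

(** Precomposing with [w] makes any sector-germ standard in a suitable chart. *)
Lemma sector_germ_weyl x w b (E : set AA) : @weyl R V w ->
  sector_germ_at x [set w *m y | y in @sector_cone R V b] E <-> deep_germ b (mulmx w @^-1` E).
Proof.
move=> wP; have wU := weyl_unitmx wP; rewrite -(sector_germ_atE (invmx w *m x) b); split.
  move=> [u _ uE]; rewrite sector_germ_atE.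
  have [N N0 NP] := level_bound b (invmx w *m (x + u)).
  exists (N + 1) => y yN; apply: uE; exists (w *m y - (x + u)); last by rewrite addrC subrK.
  exists (y - invmx w *m (x + u)); last by rewrite mulmxBr mulKVmx.
  move=> j; rewrite levelB; have := NP j; have := yN j.
  by have := ler_norm (level b j (invmx w *m (x + u))); lra.
rewrite sector_germ_atE => -[K KE].
have [v vE] := @level_values R V b (fun j => `|K - level b j (invmx w *m x)| + 1).
exists (w *m v); first by apply: subset_closure; exists v => // j; rewrite vE ltr_wpDl.
move=> _ [_ [y yC <-] <-].
have -> : x + w *m v + w *m y = w *m (invmx w *m x + v + y) by rewrite !mulmxDr mulKVmx.
apply: KE => j; rewrite !levelD vE; have := yC j.
by have := ler_norm (K - level b j (invmx w *m x)); lra.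
Qed.

Lemma sector_germ_chart s : in_masure M (@sector_germ R V) s ->
  exists f b, chart M f /\ s = f @ deep_germ b.
Proof.
move=> [A hA [f fA [F0 [x [C [/vect_chamber_cone[w [b [wP ->]]] ->]]] ->]]].
have cf : chart M f by exists A.
exists (f \o mulmx w), b; split; first exact: (chart_comp hM cf (affine_weyl_linear wP)).1.
by apply/seteqP; split=> E; have [h h'] := sector_germ_weyl x b (f @^-1` E) wP.
Qed.

End Covering.

(** * Baire category *)

Section Baire.
Variables (R : realType) (T : metricType R) (A : nat -> set T).
Hypotheses (A_closed : forall m, closed (A m)) (A_meagre : forall m, interior (A m) = set0).
Hypothesis A_cover : forall x, exists m, A m x.

(** The doubled radius ensures that even cluster points of the next ball avoid [A m]. *)
Lemma shrink_ball m (x : T) (r : R) : 0 < r -> exists ys : T * R,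
  [/\ 0 < ys.2, ys.2 <= r / 2 & ball ys.1 (2 * ys.2) `<=` ball x r `&` ~` A m].
Proof.
move=> r0; pose W := interior (ball x r) `&` ~` A m.
have Wopen : open W by apply: openI; [exact: open_interior|rewrite openC; exact: A_closed].
have xr : nbhs x (interior (ball x r)) by apply/nbhs_interior/nbhsx_ballx.
have [y Wy] : W !=set0.
  apply: contrapT => W0; suff : interior (A m) x by rewrite A_meagre.
  apply: filterS xr => z zr; apply: contrapT => nz; apply: W0; by exists z.
have /nbhs_ballP[e /= e0 eW] : nbhs y W by apply: open_nbhs_nbhs.
exists (y, Num.min (e / 2) (r / 2)) => /=; split.
- by rewrite lt_min !divr_gt0.
- by rewrite ge_min lexx orbT.
move=> z yz; have [] : W z; last by move=> /interior_subset.
apply: eW; apply: le_ball yz; rewrite -ler_pdivlMl // mulrC ge_min lexx //.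
Qed.

(** A cluster point would belong to some [A m], but also to the doubled ball of stage [m + 1], which
    avoids [A m]. *)
Lemma escaping_sequence (U : set T) : open U -> U !=set0 -> exists u : nat -> T,
  [/\ forall m, U (u m), cauchy (u @ \oo) & forall l, ~ cluster (u @ \oo) l].
Proof.
move=> Uopen [x0 Ux0].
have /nbhs_ballP[r0 /= r00 r0U] : nbhs x0 U by apply: open_nbhs_nbhs.
have [F FP] : {F : nat * (T * R) -> T * R & forall mxr, 0 < mxr.2.2 ->
    [/\ 0 < (F mxr).2, (F mxr).2 <= mxr.2.2 / 2 &
     ball (F mxr).1 (2 * (F mxr).2) `<=` ball mxr.2.1 mxr.2.2 `&` ~` A mxr.1]}.
  apply: (@choice _ _ (fun mxr ys => 0 < mxr.2.2 -> [/\ 0 < ys.2, ys.2 <= mxr.2.2 / 2 &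
     ball ys.1 (2 * ys.2) `<=` ball mxr.2.1 mxr.2.2 `&` ~` A mxr.1])) => -[m [x r]] /=.
  have [rp|rn] := pselect (0 < r); last by exists (x, r).
  by have [ys ysP] := shrink_ball m x rp; exists ys.
pose z := fix z m := if m is k.+1 then F (k, z k) else (x0, r0).
have z_gt0 m : 0 < (z m).2 by elim: m => [//|m IH] /=; have [] := FP (m, z m) IH.
have z_small m : (z m).2 <= r0 / 2 ^+ m.
  elim: m => [|m IH]; first by rewrite expr0 divr1.
  have [_ h _] := FP (m, z m) (z_gt0 m); apply: le_trans h _.
  by rewrite exprS invfM mulrCA mulrC ler_pM2l ?invr_gt0.
have z_sub m : ball (z m.+1).1 (2 * (z m.+1).2) `<=` ball (z m).1 (z m).2 `&` ~` A m.
  by have [] := FP (m, z m) (z_gt0 m).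
have z_nest m k : ball (z (m + k)%N).1 (z (m + k)%N).2 `<=` ball (z m).1 (z m).2.
  elim: k => [|k IH]; first by rewrite addn0.
  rewrite addnS => y yz; apply: IH; apply: (z_sub (m + k)%N _ _).1.
  by apply: le_ball yz; rewrite ler_peMl ?ler1n // ltW.
have z_tail m k : (m <= k)%N -> ball (z m).1 (z m).2 (z k).1.
  by move=> /subnKC <-; apply: (@z_nest m (k - m)%N); apply: ballxx.
exists (fun m => (z m).1); split.
- by move=> m; apply/r0U/(z_tail 0%N).
- apply: cauchy_exP => e e0.
  have [m me] : exists m, r0 / 2 ^+ m < e.
    have er : 0 < e / r0 by rewrite divr_gt0.
    have [m _ /(_ m (leqnn _)) h] := near_infty_natSinv_expn_lt (PosNum er).
    by exists m; move: h; rewrite /= ltr_pdivlMr // mul1r mulrC.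
  exists (z m).1; exists m => // k /= mk; apply: le_ball (z_tail m k mk).
  exact: le_trans (z_small m) (ltW me).
move=> l cl; have [m Aml] := A_cover l.
have zm0 := z_gt0 m.+1.
have [|_ [[k mk <-] lk]] := cl [set (z k).1 | k in [set k | (m.+1 <= k)%N]] (ball l (z m.+1).2) _ (nbhsx_ballx _ _ zm0).
  by exists m.+1 => // k mk; exists k.
suff : ball (z m.+1).1 (2 * (z m.+1).2) l by move=> /z_sub[].
rewrite mulr2n mulrDl mul1r; apply: ball_triangle (z_tail _ _ mk) _.
exact: ball_sym.
Qed.

End Baire.

Theorem proposition17
  (R : realType) (V : vectorial_datum)
  (L : lmodType R[i]) (g : kac_moody_algebra V L)
  (* the masure, endowed with a distance *)
  (I : metricType R) (M : apartment_system R V I)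
  (hM : masure g M) (hthick : thick_finite g M)
  (G : groupType) (act : G -> I -> I)
  (hact : strongly_transitive g M act)
  (A0 : set I) (iota : 'cV[R]_(yrank V) -> I)
  (hA0 : apartment M A0) (hiota : isomw M A0 iota)
  (hstab : stabilizer_induces_weyl_Y act A0 iota)
  (hs : exists2 s, in_masure M (@sector_germ R V) s &
          forall A : set I, apartment M A -> s A -> closed A /\ interior A = set0) :
  ~ metric_complete I /\
  forall K : set I, compact K -> interior K = set0.
Proof.
have [s /(sector_germ_chart hM)[f [b [cf sE]]] sA] := hs.
have [A [Af A_cover]] := countable_cover hM hthick b cf.
have A_closed m : closed (A m) by have [hA fA] := Af m; apply: (sA _ hA _).1; rewrite sE.
have A_meagre m : interior (A m) = set0.
  by have [hA fA] := Af m; apply: (sA _ hA _).2; rewrite sE.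
have escape := escaping_sequence A_closed A_meagre A_cover.
split.
  (* A limit of the sequence would be a cluster point. *)
  move=> complete; have [||u [_ cu nu]] := escape setT; first exact: openT.
    by exists (f 0).
  have [l ul] := complete u cu; apply: (nu l) => B C uB lC.
  have : (u @ \oo) (B `&` C) by apply: filterI => //; exact: ul.
  by case=> m _ /(_ m (leqnn m)) [? ?]; exists (u m).
(* In a nonempty interior, compactness would give the escaping sequence a cluster point. *)
move=> K Kcompact; apply/seteqP; split=> // x xK.
have [||u [uK _ nu]] := escape (interior K); [exact: open_interior|by exists x|].
have uF : ProperFilter (u @ \oo) by apply: fmap_proper_filter.
have [|l [_ cl]] := Kcompact (u @ \oo) uF; last exact: (nu l cl).
by exists 0%N => // m _; exact: interior_subset (uK m).
Qed.
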